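(* Let $0<s<1$, $q>1$, $b>0$, and consider the external field $Q(x)=-q\,|x-bi|^{-s}=-q\,(x^2+b^2)^{-s/2}$ on $\mathbb{R}$. Let $\mu_Q$ be the Riesz $s$-equilibrium measure on $\mathbb{R}$ in the external field $Q$ (the minimizer of $\iint|x-y|^{-s}d\nu(x)d\nu(y)+2\int Q\,d\nu$ over Borel probability measures $\nu$ on $\mathbb{R}$). For $a>0$ and $|x|<a$ (and $x=a$) define $$I_a(x)=\int_0^{\infty}\frac{u^{\frac{1-s}{2}}}{(u+a^2+b^2)^{1-\frac{s}{2}}}\,\frac{du}{u+a^2-x^2},$$ so that $I_a(a)=\dfrac{\mathcal{B}\left(\frac12,\frac{1-s}{2}\right)}{\sqrt{a^2+b^2}}$. Define, for $a>0$, $$\mathcal{F}_s(a)=\frac{\Gamma(1+s)}{2^s\,\Gamma\left(\frac{1+s}{2}\right)}\,a^{-s}\left(\Gamma\left(\tfrac{1-s}{2}\right)-q\,\frac{\sqrt{\pi}}{\Gamma\left(1+\frac{s}{2}\right)}\left(\frac{a}{\sqrt{a^2+b^2}}\right)^{s}{}_2F_1\left(\tfrac{s}{2},\tfrac{1+s}{2};1+\tfrac{s}{2};\tfrac{a^2}{a^2+b^2}\right)\right).$$ Then the equation $\mathcal{F}_s'(a)=0$ has a unique solution $\widetilde{a}=\widetilde{a}(s,q,b)\in(0,+\infty)$, the support of $\mu_Q$ is $S_Q=[-\widetilde{a},\widetilde{a}]$, and $\mu_Q$ is absolutely continuous with density $$\mu_Q'(x)=\frac{q\,b^{1-s}}{\mathcal{B}\left(\frac12,\frac{1-s}{2}\right)\mathcal{B}\left(\frac{1+s}{2},\frac{1-s}{2}\right)}\left(\frac{\mathcal{B}\left(\frac{1+s}{2},\frac{1-s}{2}\right)}{(x^2+b^2)^{1-\frac{s}{2}}}-\frac{I_{\widetilde{a}}(\widetilde{a})-I_{\widetilde{a}}(x)}{(\widetilde{a}^2-x^2)^{\frac{1-s}{2}}}\right),\qquad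 |x|<\widetilde{a}.$$
   Context: $\mathcal{B}(\alpha,\beta)$ denotes the Euler Beta function, $\Gamma$ the Gamma function, and ${}_2F_1(\alpha,\beta;\gamma;z)$ the Gauss hypergeometric function. The paper also gives $I_a$ via an equivalent integral over $|t|>a$; only the integral over $u\in(0,\infty)$ is used here. *)

(* Defs.v *)
From HB Require Import structures.
From mathcomp Require Import all_boot all_order all_algebra.
From mathcomp Require Import all_classical all_reals all_analysis.
Set Implicit Arguments. Unset Strict Implicit. Unset Printing Implicit Defensive.
Import Order.TTheory GRing.Theory Num.Theory.
Import numFieldNormedType.Exports.
Local Open Scope classical_set_scope.
Local Open Scope ring_scope.

Section Defs.
Variable R : realType.

Definition Gammaf (x : R) : R :=
  fine (\int[lebesgue_measure]_(t in `]0%R, +oo[) ((t `^ (x - 1)) * expR (- t))%:E)%E.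

Definition Betaf (a b : R) : R :=
  fine (\int[lebesgue_measure]_(t in `]0%R, 1%R[) ((t `^ (a - 1)) * ((1 - t) `^ (b - 1)))%:E)%E.

Definition poch (x : R) (n : nat) : R := \prod_(i < n) (x + i%:R).

Definition hyp2F1 (a b c z : R) : R :=
  limn (fun N : nat => \sum_(0 <= n < N) (poch a n * poch b n / (poch c n * n`!%:R) * z ^+ n)).

Definition extQ (s q b x : R) : R := - q * (x ^+ 2 + b ^+ 2) `^ (- (s / 2)).

Definition riesz_kernel (s x y : R) : \bar R :=
  if x == y then +oo%E else (`|x - y| `^ (- s))%:E.

Definition riesz_energy (s q b : R) (nu : probability R R) : \bar R :=
  ((\int[nu]_x \int[nu]_y riesz_kernel s x y)
   + 2%:E * \int[nu]_x (extQ s q b x)%:E)%E.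

Definition is_equilibrium (s q b : R) (mu : probability R R) : Prop :=
  forall nu : probability R R, (riesz_energy s q b mu <= riesz_energy s q b nu)%E.

Definition msupport (mu : probability R R) : set R :=
  [set x | forall e : R, 0 < e -> (0 < mu (ball x e))%E].

Definition Ia (s b a x : R) : R :=
  fine (\int[lebesgue_measure]_(u in `]0%R, +oo[)
     ((u `^ ((1 - s) / 2)) / ((u + a ^+ 2 + b ^+ 2) `^ (1 - s / 2))
        / (u + a ^+ 2 - x ^+ 2))%:E)%E.

Definition Fs (s q b a : R) : R :=
  Gammaf (1 + s) / (2 `^ s * Gammaf ((1 + s) / 2)) * a `^ (- s) *
  (Gammaf ((1 - s) / 2)
   - q * (Num.sqrt pi / Gammaf (1 + s / 2))
       * (a / Num.sqrt (a ^+ 2 + b ^+ 2)) `^ s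
       * hyp2F1 (s / 2) ((1 + s) / 2) (1 + s / 2) (a ^+ 2 / (a ^+ 2 + b ^+ 2))).

Definition eq_density (s q b ta x : R) : R :=
  q * b `^ (1 - s) /
    (Betaf (1/2) ((1 - s) / 2) * Betaf ((1 + s) / 2) ((1 - s) / 2)) *
  (Betaf ((1 + s) / 2) ((1 - s) / 2) / (x ^+ 2 + b ^+ 2) `^ (1 - s / 2)
   - (Ia s b ta ta - Ia s b ta x) / (ta ^+ 2 - x ^+ 2) `^ ((1 - s) / 2)).

End Defs.

(* Main.v *)
(** Write w_t(y) = (t - y^2)_+^((s-1)/2).  Its Riesz potential is the same constant for
    every t > 0 on the interval y^2 <= t, and smaller outside.  Mixing the w_t over all t > 0 with
    the weight C (t + b^2)^(-3/2) produces, for a suitable C, exactly the potential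
    q (x^2 + b^2)^(-s/2) = - Q(x).  Dropping the part t > a^2 of the mixture subtracts a function
    that is a constant on [-a, a] and at most that constant elsewhere, so the part t < a^2
    satisfies the Frostman conditions with support [-a, a].  Its density is the stated
    one, and its mass is an increasing function of a that equals 1 exactly when F_s'(a) = 0;
    the condition q > 1 makes the value 1 attained.

    That the Frostman conditions characterize the minimizer follows from the representation of
    |x - y|^(-s) as s (s + 1) times the integral of (v - u)^(-s-2) over the intervals ]u, v[
    containing x and y: it turns I(m, m) + I(n, n) - 2 I(m, n) into a weighted squared L^2
    distance between the interval masses of m and n. *)
Require Import Defs.
From HB Require Import structures.
From mathcomp Require Import all_boot all_order all_algebra.
From mathcomp Require Import all_classical all_reals all_analysis.
From mathcomp Require Import measurable_realfun ring lra.
Set Implicit Arguments.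
Unset Strict Implicit.
Unset Printing Implicit Defensive.
Import Order.TTheory GRing.Theory Num.Theory.
Import numFieldNormedType.Exports.
Local Open Scope classical_set_scope.
Local Open Scope ring_scope.

(** The potential of w_t is computable because |x - y|^(-s) (t - y^2)^((s-1)/2) is an integral over
    n > 0 of inverse square roots of quadratics in y, and each of these has an integral over y that
    ignores its constant term as long as that is positive. What remains is a weight in n, cut off by
    x^2 < (1 + n) t. The exponent -3/2 of the mixture is chosen for its tail: above t = x^2/(1 + n)
    it integrates to 2 (x^2/(1 + n) + b^2)^(-1/2), which merges with a factor (1 + n)^(-1/2) of that
    weight into (x^2 + b^2 + n b^2)^(-1/2); the integral over n is then homogeneous of degree -s/2
    in x^2 + b^2. The untruncated mixture has total mass exactly q, whence the condition q > 1.
    Energies and integrals may be infinite, so identities are stated as sums of nonnegative extended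
    reals and proved by Tonelli; terms change sides only once they are known to be finite. No
    compactness is used: existence comes from the explicit measure, uniqueness from the weighted
    distance. *)

(* Unlike x `^ p, this vanishes for x <= 0 even when p = 0, so constraints such
   as y^2 < t are carried by the integrand and every integral ranges over R. *)
Definition pw {R : realType} (p x : R) : R := if 0 < x then x `^ p else 0.

(** * Algebra of truncated powers *)

Section PositivePower.
Context {R : realType}.
Implicit Types p x y c : R.

Lemma pwE p x : 0 < x -> pw p x = x `^ p.
Proof. by rewrite /pw => ->. Qed.

Lemma pw_le0 p x : x <= 0 -> pw p x = 0.
Proof. by rewrite /pw ltNge => ->. Qed.

Lemma pw_ge0 p x : 0 <= pw p x.
Proof. by rewrite /pw; case: ifP => // _; exact: powR_ge0. Qed.

Lemma pw_gt0 p x : 0 < x -> 0 < pw p x.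
Proof. by move=> x0; rewrite pwE// powR_gt0. Qed.

Lemma pwD p q x : pw (p + q) x = pw p x * pw q x.
Proof.
rewrite /pw; case: ifP => x0; last by rewrite mul0r.
by rewrite powRD//; apply/implyP => _; rewrite gt_eqF.
Qed.

Lemma pwM p c x : 0 < c -> pw p (c * x) = pw p c * pw p x.
Proof.
move=> c0; rewrite /pw pmulr_rgt0// c0; case: ifP => x0; last by rewrite mulr0.
by rewrite powRM// ltW.
Qed.

Lemma pwN p x : 0 < x -> pw (- p) x = (pw p x)^-1.
Proof. by move=> x0; rewrite !pwE// powRN. Qed.

Lemma pw0 x : pw 0 x = (0 < x)%R%:R.
Proof. by rewrite /pw; case: ifP => // _; rewrite powRr0. Qed.

Lemma pw1 x : 0 < x -> pw 1 x = x.
Proof. by move=> x0; rewrite pwE// powRr1// ltW. Qed.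

Lemma pw_natr n x : 0 < x -> pw n%:R x = x ^+ n.
Proof. by move=> x0; rewrite pwE// powR_mulrn// ltW. Qed.

Lemma pw_inv p x : 0 < x -> pw p x^-1 = (pw p x)^-1.
Proof.
move=> x0; rewrite !pwE ?invr_gt0//.
apply: (@mulIf _ (x `^ p)); first by rewrite gt_eqF// powR_gt0.
by rewrite -powRM ?invr_ge0 ?(ltW x0)// !mulVf ?gt_eqF ?powR_gt0// powR1.
Qed.

Lemma pw_le p x y : 0 <= p -> x <= y -> pw p x <= pw p y.
Proof.
move=> p0 xy; rewrite {1}/pw; case: ifP => x0; last exact: pw_ge0.
by rewrite pwE ?(lt_le_trans x0)// ge0_ler_powR// ?nnegrE ltW// (lt_le_trans x0).
Qed.

Lemma pw_pw p q x : 0 < x -> pw p (pw q x) = pw (q * p) x.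
Proof. by move=> x0; rewrite pwE ?pw_gt0// !pwE// powRrM. Qed.

Lemma pwX p x n : 0 < x -> pw p (x ^+ n) = pw p x ^+ n.
Proof.
move=> x0; elim: n => [|n IH]; first by rewrite !expr0 pwE// powR1.
by rewrite !exprS pwM// IH.
Qed.

Lemma pw_lt1 p x : 0 < p -> 0 < x < 1 -> pw p x < 1.
Proof.
move=> p0 /andP[x0 x1]; rewrite pwE//.
have e : 1 `^ p = 1 :> R by rewrite powR1.
by rewrite -[ltRHS]e gt0_ltr_powR// ?nnegrE// ltW.
Qed.

End PositivePower.

(** * Measurability and positivity of the integrands *)

Section MeasurableExpressions.
Context {R : realType} d (T : measurableType d) (D : set T).
Implicit Types f g : T -> R.

Lemma measurable_fun_pw p f :
  measurable_fun D f -> measurable_fun D (fun x => pw p (f x)).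
Proof.
move=> mf; apply: (measurableT_comp _ mf).
rewrite /pw; apply: measurable_fun_ifT => //.
by apply: measurable_fun_ltr.
Qed.

Lemma measurable_fun_expRc f :
  measurable_fun D f -> measurable_fun D (fun x => expR (f x)).
Proof. by move=> mf; apply: (measurableT_comp _ mf); exact: measurable_expR. Qed.

Lemma measurable_fun_lt_natr f g : measurable_fun D f -> measurable_fun D g ->
  measurable_fun D (fun x => (f x < g x)%R%:R : R).
Proof.
move=> mf mg.
rewrite (_ : (fun x => _) = (fun x => pw 0 (g x - f x))).
  by apply/measurable_fun_pw/measurable_funB.
by apply/funext => x; rewrite pw0 subr_gt0.
Qed.

End MeasurableExpressions.

Ltac mfun := repeat match goal with
  | |- measurable_fun _ (pw _) => apply: (measurable_fun_pw _ (@measurable_id _ _ _))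
  | |- measurable_fun _ (fun _ => pw _ _) => apply: measurable_fun_pw
  | |- measurable_fun _ (fun _ => expR _) => apply: measurable_fun_expRc
  | |- measurable_fun _ (fun _ => _%:R) =>
      (apply: measurable_fun_lt_natr) || exact: measurable_cst
  | |- measurable_fun _ (fun _ => _ + - _) => apply: measurable_funB
  | |- measurable_fun _ (fun _ => _ + _) => apply: measurable_funD
  | |- measurable_fun _ (fun _ => - _) => apply: measurable_funN
  | |- measurable_fun _ (GRing.add _) =>
      apply: (measurable_funD (@measurable_cst _ _ _ _ _ _) (@measurable_id _ _ _))
  | |- measurable_fun _ (GRing.mul _) =>
      apply: (measurable_funM (@measurable_cst _ _ _ _ _ _) (@measurable_id _ _ _))
  | |- measurable_fun _ (-%R) => exact: oppr_measurable
  | |- measurable_fun _ (fun _ => _ * _) => apply: measurable_funM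
  | |- measurable_fun _ (fun _ => _ ^+ _) => apply: measurable_funX
  | |- measurable_fun _ (fun _ => `|_|) =>
      apply: (measurableT_comp (@normr_measurable _ setT))
  | |- measurable_fun _ (fun _ => (_)%:E) => apply/measurable_EFinP => /=
  | |- measurable_fun _ (fun z => z) => exact: measurable_id
  | |- measurable_fun _ (fun z => z.1) => exact: measurable_fst
  | |- measurable_fun _ (fun z => z.2) => exact: measurable_snd
  | |- measurable_fun _ (fun _ => _) => exact: measurable_cst
  end.

Ltac pos := repeat match goal with
  | |- forall _, _ => move=> ?
  | |- is_true (_ <= EFin _)%E => rewrite lee_fin
  | |- is_true (0 <= _ * _) => apply: mulr_ge0
  | |- is_true (0 <= _ + _) => apply: addr_ge0
  | |- is_true (0 <= _ ^+ _) => apply: exprn_ge0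
  | |- is_true (0 <= _^-1) => rewrite invr_ge0
  | |- is_true (0 <= pw _ _) => exact: pw_ge0
  | |- is_true (0 <= expR _) => exact: expR_ge0
  | |- is_true (0 <= _%:R) => exact: ler0n
  | |- is_true (0 <= `|_|) => exact: normr_ge0
  | |- _ => by [] || (apply: ltW; by [])
  end.

(** * Tonelli's theorem for integrands in two arguments *)

Section Tonelli.
Local Open Scope ereal_scope.
Context {R : realType} d1 d2 (T1 : measurableType d1) (T2 : measurableType d2).
Variables (m1 : {sigma_finite_measure set T1 -> \bar R})
  (m2 : {sigma_finite_measure set T2 -> \bar R}).

Lemma tonelli (f : T1 -> T2 -> \bar R) :
  measurable_fun setT (fun z : T1 * T2 => f z.1 z.2) ->
  (forall x y, 0 <= f x y) ->
  \int[m1]_x \int[m2]_y f x y = \int[m2]_y \int[m1]_x f x y.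
Proof. by move=> mf f0; apply: (fubini_tonelli (fun z => f z.1 z.2)) => //=. Qed.

Lemma measurable_integral_snd (f : T1 -> T2 -> \bar R) :
  measurable_fun setT (fun z : T1 * T2 => f z.1 z.2) ->
  (forall x y, 0 <= f x y) ->
  measurable_fun setT (fun x => \int[m2]_y f x y).
Proof.
by move=> mf f0; apply: (measurable_fun_fubini_tonelli_F (fun z => f z.1 z.2)) => //=.
Qed.

Lemma measurable_integral_fst (f : T1 -> T2 -> \bar R) :
  measurable_fun setT (fun z : T1 * T2 => f z.1 z.2) ->
  (forall x y, 0 <= f x y) ->
  measurable_fun setT (fun y => \int[m1]_x f x y).
Proof.
by move=> mf f0; apply: (measurable_fun_fubini_tonelli_G (fun z => f z.1 z.2)) => //=.
Qed.

End Tonelli.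

(** * Affine changes of variable *)

Section AffineChange.
Local Open Scope ereal_scope.
Context {R : realType}.
Local Notation mu := (@lebesgue_measure R).

(** Lebesgue measure is |c| times its image under x -> c x + e, by uniqueness of the measure that
    gives intervals their length. *)
Lemma ge0_integral_affine (c e : R) (f : R -> \bar R) : c != 0%R ->
  measurable_fun setT f -> (forall x, 0 <= f x) ->
  \int[mu]_x f (c * x + e)%R = (`|c|^-1)%:E * \int[mu]_x f x.
Proof.
move=> c0 mf f0.
have mphi : measurable_fun setT
    ((fun x => c * x + e)%R : measurableTypeR R -> measurableTypeR R).
  by mfun.
have nc0 : (0 < `|c|)%R by rewrite normr_gt0.
pose k : {nonneg R} := NngNum (ltW nc0).
pose nu0 := mscale k (pushforward mu ((fun x => c * x + e)%R : measurableTypeR R -> measurableTypeR R)).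
pose nu := nu0 mphi.
have H A : measurable A -> mu A = nu A.
  apply: lebesgue_measure_unique => _ [[a b] _ <-].
  suff : mu [set` `]a, b]] =
      (`|c|%:E * mu ((fun x => c * x + e)%R @^-1` [set` `]a, b]] : set R)) by [].
  have [cp|cn] := ltP 0%R c.
    rewrite (_ : (fun x => c * x + e)%R @^-1` [set` `]a, b]] =
        [set` `]((a - e) / c)%R, ((b - e) / c)%R]] :> set R); last first.
      by apply/seteqP; split => x /=; rewrite !in_itv/= ltr_pdivrMr// ler_pdivlMr//;
        rewrite ltrBlDr lerBrDr (mulrC x).
    rewrite !lebesgue_measure_itv/= !lte_fin ltr_pM2r ?invr_gt0// ltrD2r.
    by case: ifP; rewrite ?mule0// => _; rewrite -!EFinB -EFinM gtr0_norm//;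
      congr EFin; field.
  have {}cn : (c < 0)%R by rewrite lt_neqAle c0.
  (* A negative slope reverses the interval, which becomes closed on the left; its length is
     unaffected. *)
  rewrite (_ : (fun x => c * x + e)%R @^-1` [set` `]a, b]] =
      [set` `[((b - e) / c)%R, ((a - e) / c)%R[] :> set R); last first.
    by apply/seteqP; split => x /=; rewrite !in_itv/= ler_ndivrMr// ltr_ndivlMr//;
      rewrite ltrBlDr lerBrDr (mulrC x) andbC.
  rewrite !lebesgue_measure_itv/= !lte_fin ltr_nM2r ?invr_lt0// ltrD2r.
  by case: ifP; rewrite ?mule0// => _; rewrite -!EFinB -EFinM ltr0_norm//;
    congr EFin; field.
have := @ge0_integral_pushforward _ _ _ _ R _ mphi mu setT f measurableT mf.
rewrite preimage_setT => /(_ (fun x _ => f0 x)) <-.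
rewrite [in RHS](@eq_measure_integral _ _ _ _ nu); last first.
  by move=> A mA _; exact: H.
by rewrite ge0_integral_mscale//= muleA -EFinM mulVf ?gt_eqF// mul1e.
Qed.

End AffineChange.

(** * Domains, constant factors, scaling, translation and reflection *)

Section IntegralTools.
Local Open Scope ereal_scope.
Context {R : realType}.
Local Notation mu := (@lebesgue_measure R).

(** Carries a domain of integration into the integrand, as Tonelli and the changes of variable are
    used over the whole line. *)
Lemma integral_mkbool (D : set R) (g h : R -> R) :
  (forall x, h x = if x \in D then g x else 0%R) ->
  \int[mu]_(x in D) (g x)%:E = \int[mu]_x (h x)%:E.
Proof.
move=> H; rewrite integral_mkcond; apply: eq_integral => x _.
by rewrite patchE H; case: ifP.
Qed.

Lemma ge0_integralcMl d (T : measurableType d) (m : {measure set T -> \bar R})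
    (k : R) (f : T -> R) : (0 <= k)%R -> measurable_fun setT f ->
  (forall x, (0 <= f x)%R) ->
  \int[m]_x (k * f x)%:E = k%:E * \int[m]_x (f x)%:E.
Proof.
move=> k0 mf f0.
rewrite -ge0_integralZl_EFin//; last exact/measurable_EFinP.
by move=> x _; rewrite lee_fin.
Qed.

Lemma ge0_integralcMr d (T : measurableType d) (m : {measure set T -> \bar R})
    (k : R) (f : T -> R) : (0 <= k)%R -> measurable_fun setT f ->
  (forall x, (0 <= f x)%R) ->
  \int[m]_x (f x * k)%:E = k%:E * \int[m]_x (f x)%:E.
Proof.
move=> k0 mf f0; rewrite -ge0_integralcMl//.
by apply: eq_integral => x _; rewrite mulrC.
Qed.

Lemma ge0_integral_scale (c : R) (f : R -> \bar R) : (0 < c)%R ->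
  measurable_fun setT f -> (forall x, 0 <= f x) ->
  \int[mu]_x f x = c%:E * \int[mu]_x f (c * x)%R.
Proof.
move=> c0 mf f0.
have := @ge0_integral_affine R c 0 f (lt0r_neq0 c0) mf f0.
under eq_integral do rewrite addr0.
by move=> ->; rewrite muleA -EFinM gtr0_norm// divff ?gt_eqF// mul1e.
Qed.

Lemma ge0_integral_shift (e : R) (f : R -> \bar R) :
  measurable_fun setT f -> (forall x, 0 <= f x) ->
  \int[mu]_x f x = \int[mu]_x f (x + e)%R.
Proof.
move=> mf f0; have := @ge0_integral_affine R 1 e f (oner_neq0 _) mf f0.
by under eq_integral do rewrite mul1r; rewrite normr1 invr1 mul1e.
Qed.

Lemma ge0_integral_reflect (e : R) (f : R -> \bar R) :
  measurable_fun setT f -> (forall x, 0 <= f x) ->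
  \int[mu]_x f x = \int[mu]_x f (e - x)%R.
Proof.
move=> mf f0.
have n1 : (-1 != 0 :> R)%R by rewrite oppr_eq0 oner_eq0.
have := @ge0_integral_affine R (-1) e f n1 mf f0.
rewrite normrN1 invr1 mul1e => <-; apply: eq_integral => x _.
by rewrite mulN1r addrC.
Qed.

End IntegralTools.

(** * Integrals of powers near zero and near infinity *)

Section PowerIntegrals.
Local Open Scope ereal_scope.
Context {R : realType}.
Local Notation mu := (@lebesgue_measure R).

Lemma is_derive_pw (p x : R) : (0 < x)%R ->
  is_derive x 1%R (pw p) (p * pw (p - 1) x)%R.
Proof.
move=> x0; rewrite (pwE _ x0).
apply: (@near_eq_is_derive _ _ _ (fun y : R => y `^ p)%R).
  by near=> y; rewrite pwE//; near: y; exact: lt_nbhsr.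
exact: is_derive1_powR.
Unshelve. all: by end_near. Qed.

Lemma continuous_pw (p x : R) : (0 < x)%R -> {for x, continuous (pw p)}.
Proof.
move=> x0; apply: differentiable_continuous; apply/derivable1_diffP.
by case: (is_derive_pw p x0).
Qed.

Lemma integral_pw_itv (p a b : R) : p != 0%R -> (0 < a)%R -> (a < b)%R ->
  \int[mu]_(x in `[a, b]) (pw (p - 1) x)%:E = ((pw p b - pw p a) / p)%:E.
Proof.
move=> p0 a0 ab.
pose F x := (p^-1 *: pw p x : R^o)%R.
have dF (x : R) : (0 < x)%R -> is_derive x 1%R F (pw (p - 1) x).
  move=> x0; apply: is_derive_eq.
    by apply: is_deriveZ; exact: is_derive_pw x0.
  by rewrite scalerA mulVf// scale1r.
have cF (x : R) : (0 < x)%R -> {for x, continuous F}.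
  move=> x0; apply: differentiable_continuous; apply/derivable1_diffP.
  by case: (dF x x0).
rewrite (@continuous_FTC2 _ _ F)//.
- by rewrite /F /GRing.scale/= -EFinB; congr EFin; ring.
- apply: continuous_in_subspaceT => x; rewrite inE/= in_itv/= => /andP[ax _].
  exact/continuous_pw/(lt_le_trans a0).
- split => [x||]/=.
  + by rewrite in_itv/= => /andP[ax _]; case: (dF x (lt_trans a0 ax)).
  + by apply: cvg_at_right_filter; exact: cF.
  + by apply: cvg_at_left_filter; exact/cF/(lt_trans a0).
- move=> x; rewrite in_itv/= => /andP[ax _].
  by rewrite derive1E; case: (dF x (lt_trans a0 ax)).
Qed.

Let half := (2^-1 : R).
Let half01 : (0 < half < 1)%R.
Proof. by rewrite /half invr_gt0 ltr0n/= invf_lt1// ltr1n. Qed.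
Let half_gt0 : (0 < half)%R. Proof. by case/andP: half01. Qed.

Lemma cvg_exprn0 (z : R) : (0 <= z < 1)%R -> (z ^+ n)%R @[n --> \oo] --> (0 : R)%R.
Proof. by move=> /andP[z0 z1]; apply: cvg_expr; rewrite ger0_norm. Qed.

Let half_expr_lt (e : R) : (0 < e)%R -> exists n, (half ^+ n < e)%R.
Proof.
move=> e0; have /cvg_exprn0 : (0 <= half < 1)%R.
  by case/andP: half01 => /ltW -> ->.
move=> /cvgr_lt/(_ _ e0)[N _ HN]; exists N; exact: HN (leqnn N).
Qed.

Let half_expr_le m n : (m <= n)%N -> (half ^+ n <= half ^+ m)%R.
Proof. by move=> mn; rewrite ler_wiXn2l// ltW//; case/andP: half01. Qed.

(** Monotone convergence along the intervals [2^-(n+1), 1]: dyadic endpoints turn the boundary term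
    into the geometric sequence (2^-p)^(n+1). [integral_pw_tail] uses the endpoints c 2^(n+1) in the
    same way. *)
Lemma integral_pw_unit (p : R) : (0 < p)%R ->
  \int[mu]_x (pw (p - 1) x * (x < 1)%R%:R)%:E = (p^-1)%:E.
Proof.
move=> p0.
pose F (n : nat) : set R := `[(half ^+ n.+1)%R, 1%R]%classic.
have nF : nondecreasing_seq F.
  move=> m n mn; rewrite subsetEset => x; rewrite /F/= !in_itv/= => /andP[h ->].
  by rewrite (le_trans _ h)// half_expr_le.
have mp : measurable_fun setT (fun x : R => (pw (p - 1) x)%:E) by mfun.
have cF : \int[mu]_(x in F i) (pw (p - 1) x)%:E @[i --> \oo] -->
    \int[mu]_(x in \bigcup_n F n) (pw (p - 1) x)%:E.
  apply: (@ge0_nondecreasing_set_cvg_integral _ (measurableTypeR R) R F) => //.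
  - by move=> i; rewrite /F; exact: measurable_itv.
  - by move=> i; exact: measurable_funTS mp.
  - by move=> i x _; rewrite lee_fin pw_ge0.
transitivity (\int[mu]_(x in \bigcup_n F n) (pw (p - 1) x)%:E).
  have -> : \bigcup_n F n = `]0%R, 1%R]%classic.
    apply/seteqP; split => x /=.
      case=> n _; rewrite /F/= !in_itv/= => /andP[h ->].
      by rewrite (lt_le_trans _ h)// exprn_gt0.
    rewrite in_itv/= => /andP[/half_expr_lt[n xn] x1]; exists n => //.
    by rewrite /F/= in_itv/= x1 (le_trans _ (ltW xn))// half_expr_le.
  rewrite -integral_itv_bndo_bndc; last exact: measurable_funTS mp.
  apply/esym/integral_mkbool => x.
  rewrite mem_setE; case: (ltP 0%R x) => x0; last first.
    by rewrite pw_le0// mul0r if_same.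
  by rewrite in_itv/= x0/=; case: ifP; rewrite ?mulr1 ?mulr0.
rewrite -(cvg_lim _ cF)//.
have half1 n : (half ^+ n.+1 < 1)%R by rewrite exprn_ilt1// ?ltW//; case/andP: half01.
rewrite (_ : (fun i => _) = fun n => ((1 - pw p half * pw p half ^+ n) / p)%:E).
  apply/cvg_lim => //; apply: cvg_EFin; first exact: nearW.
  rewrite -[X in _ --> X]mul1r; apply: cvgMl.
  rewrite -[X in _ --> X]subr0; apply: cvgB; first exact: cvg_cst.
  rewrite -[X in _ --> X](mulr0 (pw p half)); apply: cvgMr.
  by apply: cvg_exprn0; rewrite pw_ge0 pw_lt1.
apply/funext => n; rewrite integral_pw_itv ?gt_eqF// ?exprn_gt0//.
by rewrite (pwE _ ltr01) powR1 pwX// exprS.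
Qed.

Lemma integral_pw_tail (p c : R) : (0 < p)%R -> (0 < c)%R ->
  \int[mu]_x (pw (- p - 1) x * (c < x)%R%:R)%:E = (pw (- p) c / p)%:E.
Proof.
move=> p0 c0.
pose F (n : nat) : set R := `[c, (c / half ^+ n.+1)%R]%classic.
have nF : nondecreasing_seq F.
  move=> m n mn; rewrite subsetEset => x; rewrite /F/= !in_itv/= => /andP[-> h].
  by rewrite (le_trans h)// ler_pM2l// lef_pV2 ?posrE ?exprn_gt0// half_expr_le.
have mp : measurable_fun setT (fun x : R => (pw (- p - 1) x)%:E) by mfun.
have cF : \int[mu]_(x in F i) (pw (- p - 1) x)%:E @[i --> \oo] -->
    \int[mu]_(x in \bigcup_n F n) (pw (- p - 1) x)%:E.
  apply: (@ge0_nondecreasing_set_cvg_integral _ (measurableTypeR R) R F) => //.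
  - by move=> i; rewrite /F; exact: measurable_itv.
  - by move=> i; exact: measurable_funTS mp.
  - by move=> i x _; rewrite lee_fin pw_ge0.
transitivity (\int[mu]_(x in \bigcup_n F n) (pw (- p - 1) x)%:E).
  have -> : \bigcup_n F n = `[c, +oo[%classic.
    apply/seteqP; split => x /=.
      by case=> n _; rewrite /F/= !in_itv/= andbT => /andP[].
    rewrite in_itv/= andbT => cx.
    have x0 := lt_le_trans c0 cx.
    have [n xn] := half_expr_lt (divr_gt0 c0 x0); exists n => //.
    rewrite /F/= in_itv/= cx/= ler_pdivlMr ?exprn_gt0//.
    rewrite (le_trans (ler_wpM2l (ltW x0) (half_expr_le (leqnSn n))))//.
    by rewrite mulrC -ler_pdivlMr// ltW.
  rewrite -integral_itv_obnd_cbnd; last exact: measurable_funTS mp.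
  apply/esym/integral_mkbool => x.
  rewrite mem_setE in_itv/= andbT.
  by case: ifP; rewrite ?mulr1 ?mulr0.
rewrite -(cvg_lim _ cF)//.
have half1 n : (half ^+ n.+1 < 1)%R by rewrite exprn_ilt1// ?ltW//; case/andP: half01.
have E n : pw (- p) (c / half ^+ n.+1) = (pw (- p) c * pw p half * pw p half ^+ n)%R.
  rewrite pwM// pw_inv ?exprn_gt0// (@pwN _ p (half ^+ n.+1)) ?exprn_gt0// invrK pwX// exprS; ring.
rewrite (_ : (fun i => _) =
    fun n => ((pw (- p) c - pw (- p) c * pw p half * pw p half ^+ n) / p)%:E).
  apply/cvg_lim => //; apply: cvg_EFin; first exact: nearW.
  apply: cvgMl.
  rewrite -[X in _ --> X]subr0; apply: cvgB; first exact: cvg_cst.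
  rewrite -[X in _ --> X](mulr0 (pw (- p) c * pw p half)%R); apply: cvgMr.
  by apply: cvg_exprn0; rewrite pw_ge0 pw_lt1.
apply/funext => n; rewrite integral_pw_itv ?oppr_eq0 ?gt_eqF//; last first.
  by rewrite ltr_pdivlMr ?exprn_gt0// gtr_pMr.
by rewrite E invrN mulrN -mulNr opprB.
Qed.

End PowerIntegrals.

(** * The Gamma function *)

Section GammaBeta.
Local Open Scope ereal_scope.
Context {R : realType}.
Local Notation mu := (@lebesgue_measure R).
Implicit Types a b c p x : R.

(** The exponential distribution has mass one; translating by c factors out e^(-c). *)
Lemma integral_expR_tail c : \int[mu]_x (expR (- x) * (c < x)%R%:R)%:E = (expR (- c))%:E.
Proof.
have int0 : \int[mu]_x (expR (- x) * (0 < x)%R%:R)%:E = 1.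
  have <- := @integral_exponential_pdf R 1%R ltr01.
  transitivity (\int[mu]_(x in `]0%R, +oo[) (expR (- x))%:E).
    apply/esym/integral_mkbool => x; rewrite mem_setE in_itv/= andbT.
    by case: ifP; rewrite ?mulr1 ?mulr0.
  rewrite integral_itv_obnd_cbnd; last by apply: measurable_funTS; mfun.
  apply: integral_mkbool => x; rewrite /exponential_pdf patchE mem_setE.
  by rewrite mulN1r mul1r.
rewrite (ge0_integral_shift c); [|by mfun|pos].
under eq_integral => x _ do
  rewrite -[X in (X < _)%R]add0r ltrD2r opprD expRD mulrAC.
rewrite ge0_integralcMr; [|by pos|by mfun|by pos].
by rewrite int0 mule1.
Qed.

Lemma integral_pw_below p c : (0 < p)%R ->
  \int[mu]_x (pw (p - 1) x * (x < c)%R%:R)%:E = (pw p c / p)%:E.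
Proof.
move=> p0; have [c0|c0] := leP c 0%R.
  rewrite (pw_le0 _ c0) mul0r; apply: integral0_eq => x _.
  case: (ltP x c) => xc; last by rewrite mulr0.
  by rewrite pw_le0 ?mul0r// (le_trans (ltW xc)).
rewrite (ge0_integral_scale c0); [|by mfun|pos].
under eq_integral => x _ do rewrite pwM// gtr_pMr// -mulrA.
rewrite ge0_integralcMl; [|by pos|by mfun|by pos].
rewrite integral_pw_unit// -!EFinM mulrA; congr (_ * _)%:E.
by rewrite -{1}(pw1 c0) -pwD addrC subrK.
Qed.

(** Extended-real version, so that the functional equation is available before finiteness, which is
    deduced from it; [Gammaf] is its [fine]. *)
Definition egamma p := \int[mu]_x (pw (p - 1) x * expR (- x))%:E.

Definition ebeta a b := \int[mu]_x (pw (a - 1) x * pw (b - 1) (1 - x))%:E.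

(** The Beta function in half-line form, the shape that most integrals below take after a
    rescaling. *)
Definition ebetaoo a b := \int[mu]_x (pw (a - 1) x * pw (- (a + b)) (1 + x))%:E.

Lemma egamma_ge0 p : 0 <= egamma p.
Proof. by apply: integral_ge0 => x _; rewrite lee_fin mulr_ge0 ?pw_ge0 ?expR_ge0. Qed.

(** In place of integration by parts: x^p is the integral of p t^(p-1) over 0 < t < x, and
    exchanging the order leaves the tail e^(-t). *)
Lemma egammaD1 p : (0 < p)%R -> egamma (p + 1) = p%:E * egamma p.
Proof.
move=> p0; rewrite /egamma addrK.
transitivity (\int[mu]_x \int[mu]_t
    (p * (pw (p - 1) t * (t < x)%R%:R) * expR (- x))%:E).
  apply: eq_integral => x _.
  rewrite ge0_integralcMr; [|by pos|by mfun|by pos].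
  rewrite ge0_integralcMl; [|by pos|by mfun|by pos].
  rewrite integral_pw_below// -!EFinM mulrC; congr EFin; field.
  by rewrite gt_eqF.
rewrite tonelli/=; [|by mfun|by pos].
rewrite -ge0_integralcMl; [|by pos|by mfun|by pos].
apply: eq_integral => t _.
transitivity (\int[mu]_x (p * pw (p - 1) t * (expR (- x) * (t < x)%R%:R))%:E).
  by apply: eq_integral => x _; congr EFin; ring.
rewrite ge0_integralcMl; [|by pos|by mfun|by pos].
by rewrite integral_expR_tail -EFinM mulrA.
Qed.

(** For exponents in ]0, 1] the integrand is dominated by x^(p-1) on ]0, 1[ and by e^(-x) beyond;
    the functional equation carries finiteness upward in unit steps. *)
Lemma egamma_lty p : (0 < p)%R -> egamma p < +oo.
Proof.
have base q : (0 < q <= 1)%R -> egamma q < +oo.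
  move=> /andP[q0 q1].
  have le1 : egamma q <= \int[mu]_x ((pw (q - 1) x * (x < 1)%R%:R)%:E +
                                      (expR (- x) * (0 < x)%R%:R)%:E).
    apply: ge0_le_integral; [by []|by pos|by mfun|by apply: emeasurable_funD; mfun|].
    move=> x _; rewrite -EFinD lee_fin.
    have [x0|x0] := ltP 0%R x; last by rewrite pw_le0// !mul0r mulr0 addr0.
    rewrite mulr1; have [x1|x1] := ltP x 1%R.
      rewrite mulr1 ler_wpDr ?expR_ge0// ler_piMr ?pw_ge0//.
      by rewrite -expR0 ler_expR oppr_le0 ltW.
    rewrite mulr0 add0r ler_piMl ?expR_ge0// pwE//.
    by rewrite -[leRHS](powRr0 x) ler_powR// subr_le0.
  apply: (le_lt_trans le1).
  rewrite ge0_integralD; [|by []|by pos|by mfun|by pos|by mfun].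
  by rewrite integral_pw_unit// integral_expR_tail -EFinD ltry.
have H n q : (0 < q <= n.+1%:R)%R -> egamma q < +oo.
  elim: n q => [|n IH] q /andP[q0 qn]; first by apply: base; rewrite q0.
  have [q1|q1] := leP q 1%R; first by apply: base; rewrite q0.
  rewrite -(subrK 1%R q) egammaD1 ?subr_gt0//.
  apply: lte_mul_pinfty; rewrite ?lee_fin ?subr_ge0 ?(ltW q1)//.
  by apply: IH; rewrite subr_gt0 q1 lerBlDr natr1.
move=> p0; have [n pn] : exists n : nat, (p <= n.+1%:R)%R.
  exists (Num.bound p); apply: ltW; apply: (lt_le_trans (archi_boundP (ltW p0))).
  by rewrite ler_nat.
by apply: (H n); rewrite p0.
Qed.

Lemma egamma_gt0 p : (0 < p)%R -> 0 < egamma p.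
Proof.
move=> p0; apply: (@lt_le_trans _ _ (expR (-1) * p^-1)%:E).
  by rewrite lte_fin mulr_gt0 ?expR_gt0 ?invr_gt0.
rewrite EFinM -integral_pw_unit// -ge0_integralcMl; [|by pos|by mfun|by pos].
apply: ge0_le_integral; [by []|by pos|by mfun|by mfun|].
move=> x _; rewrite lee_fin mulrC -mulrA ler_wpM2l ?pw_ge0//.
have [x1|x1] := ltP x 1%R; last by rewrite mul0r expR_ge0.
by rewrite mul1r ler_expR lerN2 ltW.
Qed.

Lemma Gammaf_fine p : Gammaf p = fine (egamma p).
Proof.
congr fine; apply: integral_mkbool => x.
rewrite mem_setE in_itv/= andbT; case: ifP => x0; first by rewrite pwE.
by rewrite pw_le0 ?mul0r// leNgt x0.
Qed.

Lemma egammaE p : (0 < p)%R -> egamma p = (Gammaf p)%:E.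
Proof. by move=> p0; rewrite Gammaf_fine fineK// ge0_fin_numE ?egamma_ge0// egamma_lty. Qed.

Lemma Gammaf_gt0 p : (0 < p)%R -> (0 < Gammaf p)%R.
Proof. by move=> p0; rewrite -lte_fin -egammaE// egamma_gt0. Qed.

Lemma GammafD1 p : (0 < p)%R -> Gammaf (p + 1) = (p * Gammaf p)%R.
Proof.
move=> p0; apply: EFin_inj.
by rewrite EFinM -!egammaE ?egammaD1// addr_gt0.
Qed.

Lemma Gammaf1 : Gammaf 1 = 1%R :> R.
Proof.
apply: EFin_inj; rewrite -egammaE// -[RHS]/(1%R%:E) -[in RHS]expR0 -[X in expR X]oppr0.
rewrite -integral_expR_tail; apply: eq_integral => x _.
by rewrite subrr pw0 mulrC.
Qed.

Lemma laplace_pw p c : (0 < p)%R -> (0 < c)%R ->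
  \int[mu]_x (pw (p - 1) x * expR (- (c * x)))%:E = (pw (- p) c * Gammaf p)%:E.
Proof.
move=> p0 c0; have ci0 : (0 < c^-1)%R by rewrite invr_gt0.
rewrite (ge0_integral_scale ci0); [|by mfun|pos].
under eq_integral => x _ do rewrite pwM// mulVKf ?gt_eqF// -mulrA.
rewrite ge0_integralcMl; [|by pos|by mfun|by pos].
rewrite -/(egamma p) egammaE// -!EFinM mulrA; congr (_ * _)%:E.
by rewrite -{1}(pw1 ci0) -pwD addrC subrK pw_inv// pwN.
Qed.

End GammaBeta.

(** * Beta integrals and the value of Gamma at one half *)

Section BetaIntegrals.
Local Open Scope ereal_scope.
Context {R : realType}.
Local Notation mu := (@lebesgue_measure R).
Implicit Types a b c p x : R.

(** Identifies an integral before it is known to be finite: if a positive multiple of it is finite,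
    both infinities are ruled out. *)
Lemma eq_divEFin (k r : R) (x : \bar R) : (0 < k)%R ->
  k%:E * x = r%:E -> x = (r / k)%:E.
Proof.
move=> k0; case: x => [x||]; last 2 first.
- by rewrite gt0_muley ?lte_fin.
- by rewrite gt0_muleNy ?lte_fin.
by rewrite -EFinM => -[<-]; congr EFin; rewrite mulrC mulKf// gt_eqF.
Qed.

Lemma ge0_integralZrE d (T : measurableType d) (m : {measure set T -> \bar R})
    (k : \bar R) (f : T -> R) : 0 <= k -> measurable_fun setT f ->
  (forall t, (0 <= f t)%R) ->
  \int[m]_t ((f t)%:E * k) = (\int[m]_t (f t)%:E) * k.
Proof.
by move=> k0 mf f0; rewrite ge0_integralZr//; [exact/measurable_EFinP|pos].
Qed.

Lemma beta_convolution a b z : (0 < z)%R ->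
  \int[mu]_x (pw (a - 1) x * pw (b - 1) (z - x))%:E = (pw (a + b - 1) z)%:E * ebeta a b.
Proof.
move=> z0; rewrite (ge0_integral_scale z0); [|by mfun|by pos].
rewrite /ebeta.
transitivity (z%:E * \int[mu]_x (pw (a - 1) z * pw (b - 1) z *
    (pw (a - 1) x * pw (b - 1) (1 - x)))%:E).
  congr (_ * _); apply: eq_integral => x _; congr EFin.
  by rewrite -[X in pw _ (X - _)]mulr1 -mulrBr !pwM//; ring.
rewrite ge0_integralcMl; [|by pos|by mfun|by pos].
rewrite muleA -EFinM; congr ((_)%:E * _).
rewrite -[X in (X * _)%R](pw1 z0) -!pwD; congr pw; ring.
Qed.

Lemma ebeta_ge0 a b : 0 <= ebeta a b.
Proof. by apply: integral_ge0; pos. Qed.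

Lemma ebetaoo_ge0 a b : 0 <= ebetaoo a b.
Proof. by apply: integral_ge0; pos. Qed.

(** The convolution of x^(a-1) and x^(b-1) is B(a, b) z^(a+b-1). Integrated against e^(-z) it gives
    the left side; in the other order the double integral factors. *)
Lemma Gammaf_mul_ebeta a b : (0 < a)%R -> (0 < b)%R ->
  (Gammaf (a + b))%:E * ebeta a b = (Gammaf a * Gammaf b)%:E.
Proof.
move=> a0 b0.
transitivity (\int[mu]_z \int[mu]_x
    (expR (- z) * (pw (a - 1) x * pw (b - 1) (z - x)))%:E).
  rewrite -(egammaE (addr_gt0 a0 b0)) /egamma -ge0_integralZrE;
    [|exact: ebeta_ge0|by mfun|by pos].
  apply: eq_integral => z _.
  rewrite ge0_integralcMl; [|by pos|by mfun|by pos].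
  have [z0|z0] := ltP 0%R z.
    by rewrite (beta_convolution _ _ z0) muleA -EFinM mulrC.
  rewrite (pw_le0 _ z0) mul0r mul0e.
  have -> : \int[mu]_x (pw (a - 1) x * pw (b - 1) (z - x))%:E = 0.
    apply: integral0_eq => x _.
    have [x0|x0] := ltP 0%R x; last by rewrite pw_le0// mul0r.
    by rewrite [X in (_ * X)%R]pw_le0 ?mulr0// subr_le0 (le_trans z0)// ltW.
  by rewrite mule0.
rewrite -tonelli/=; [|by mfun|by pos].
transitivity ((Gammaf b)%:E * egamma a); last by rewrite (egammaE a0) -EFinM mulrC.
rewrite /egamma -ge0_integralcMl;
  [|exact/ltW/Gammaf_gt0|by mfun|by pos].
apply: eq_integral => x _.
rewrite (ge0_integral_shift x); [|by mfun|by pos].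
transitivity (\int[mu]_z (pw (a - 1) x * expR (- x) * (pw (b - 1) z * expR (- z)))%:E).
  apply: eq_integral => z _; congr EFin; rewrite addrK opprD expRD; ring.
rewrite ge0_integralcMl; [|by pos|by mfun|by pos].
by rewrite -/(egamma b) (egammaE b0) -EFinM mulrC.
Qed.

Lemma ebetaE a b : (0 < a)%R -> (0 < b)%R ->
  ebeta a b = (Gammaf a * Gammaf b / Gammaf (a + b))%:E.
Proof.
move=> a0 b0; apply: eq_divEFin; first by rewrite Gammaf_gt0 ?addr_gt0.
exact: Gammaf_mul_ebeta.
Qed.

Lemma BetafE a b : (0 < a)%R -> (0 < b)%R ->
  Betaf a b = (Gammaf a * Gammaf b / Gammaf (a + b))%R.
Proof.
move=> a0 b0; rewrite -[RHS]/(fine (_%:E)) -ebetaE//.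
congr fine; apply: integral_mkbool => x.
rewrite mem_setE in_itv/=; have [x0|x0] := ltP 0%R x; last by rewrite pw_le0 ?mul0r.
have [x1|x1] /= := ltP x 1%R; last by rewrite [X in (_ * X)%R]pw_le0 ?mulr0 ?subr_le0.
by rewrite !pwE// subr_gt0.
Qed.

(** Gamma(a+b) (1 + v)^(-(a+b)) is a Laplace integral of x^(a+b-1); integrating over v first leaves
    Gamma(a) x^(-a), and then Gamma(b). *)
Lemma Gammaf_mul_ebetaoo a b : (0 < a)%R -> (0 < b)%R ->
  (Gammaf (a + b))%:E * ebetaoo a b = (Gammaf a * Gammaf b)%:E.
Proof.
move=> a0 b0.
transitivity (\int[mu]_v \int[mu]_x
    (pw (a - 1) v * (pw (a + b - 1) x * expR (- ((1 + v) * x))))%:E).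
  rewrite muleC /ebetaoo -ge0_integralZrE;
    [|exact/ltW/Gammaf_gt0/addr_gt0|by mfun|by pos].
  apply: eq_integral => v _.
  rewrite ge0_integralcMl; [|by pos|by mfun|by pos].
  have [v0|v0] := ltP 0%R v; last by rewrite (pw_le0 _ v0) mul0r !mul0e.
  by rewrite (laplace_pw (addr_gt0 a0 b0) (addr_gt0 ltr01 v0)) -!EFinM mulrA.
rewrite tonelli/=; [|by mfun|by pos].
transitivity ((Gammaf a)%:E * egamma b); last by rewrite (egammaE b0) -EFinM.
rewrite /egamma -ge0_integralcMl;
  [|exact/ltW/Gammaf_gt0|by mfun|by pos].
apply: eq_integral => x _.
have [x0|x0] := ltP 0%R x; last first.
  rewrite !(pw_le0 _ x0) mul0r mulr0; apply: integral0_eq => v _.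
  by rewrite mul0r mulr0.
transitivity ((x * (pw (b - 1) x * expR (- x)))%:E *
    \int[mu]_v (pw (a - 1) (x * v) * expR (- (x * v)))%:E).
  rewrite -ge0_integralcMl; [|by rewrite mulr_ge0 ?(ltW x0)//; pos|by mfun|by pos].
  apply: eq_integral => v _; congr EFin; rewrite pwM// mulrDl mul1r opprD expRD.
  rewrite (_ : (a + b - 1 = (a - 1) + 1 + (b - 1))%R); last by ring.
  by rewrite !pwD pw1// [(v * x)%R]mulrC; ring.
rewrite [(x * _)%R]mulrC EFinM -muleA.
rewrite -(@ge0_integral_scale _ x (fun v => (pw (a - 1) v * expR (- v))%:E) x0);
  [|by mfun|by pos].
by rewrite -/(egamma a) (egammaE a0) muleC.
Qed.

Lemma ebetaooE a b : (0 < a)%R -> (0 < b)%R ->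
  ebetaoo a b = (Gammaf a * Gammaf b / Gammaf (a + b))%:E.
Proof.
move=> a0 b0; apply: eq_divEFin; first by rewrite Gammaf_gt0 ?addr_gt0.
exact: Gammaf_mul_ebetaoo.
Qed.

(** This is B(1/2, p); at p = (1 + s)/2 it is the mass of w_1, and at p = 1/2 the integral of the
    inverse square root of 1 - y^2. *)
Definition ehalfbeta p := \int[mu]_y (pw (p - 1) (1 - y ^+ 2))%:E.

Lemma ehalfbeta_ge0 p : 0 <= ehalfbeta p.
Proof. by apply: integral_ge0; pos. Qed.

Lemma sqr_pw_half x : (0 < x)%R -> (pw 2^-1 x ^+ 2)%R = x.
Proof.
move=> x0; rewrite expr2 -pwD (_ : (2^-1 + 2^-1 = 1 :> R)%R) ?pw1//.
by field.
Qed.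

Lemma integral_pw_sub_sqr p t : (0 < t)%R ->
  \int[mu]_y (pw (p - 1) (t - y ^+ 2))%:E = (pw (p - 2^-1) t)%:E * ehalfbeta p.
Proof.
move=> t0; rewrite (ge0_integral_scale (pw_gt0 2^-1 t0)); [|by mfun|by pos].
under eq_integral => y _ do
  rewrite exprMn sqr_pw_half// -[X in pw _ (X - _)]mulr1 -mulrBr pwM//.
rewrite ge0_integralcMl; [|by pos|by mfun|by pos].
rewrite muleA -EFinM -pwD; by congr ((pw _ _)%:E * _); field.
Qed.

(** Averaging [integral_pw_sub_sqr] over t with weight e^(-t) makes y Gaussian, which is where the
    square root of pi comes from. *)
Lemma Gammaf_mul_ehalfbeta p : (0 < p)%R ->
  (Gammaf (p + 2^-1))%:E * ehalfbeta p = (Num.sqrt pi * Gammaf p)%:E.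
Proof.
move=> p0; have ph0 : (0 < p + 2^-1)%R by rewrite addr_gt0.
transitivity (\int[mu]_t \int[mu]_y (expR (- t) * pw (p - 1) (t - y ^+ 2))%:E).
  rewrite -(egammaE ph0) /egamma -ge0_integralZrE; [|exact: ehalfbeta_ge0|by mfun|by pos].
  apply: eq_integral => t _.
  rewrite ge0_integralcMl; [|by pos|by mfun|by pos].
  have [t0|t0] := ltP 0%R t.
    rewrite (integral_pw_sub_sqr _ t0) muleA -EFinM mulrC; congr ((_ * pw _ _)%:E * _).
    by field.
  rewrite (pw_le0 _ t0) mul0r mul0e.
  have -> : \int[mu]_y (pw (p - 1) (t - y ^+ 2))%:E = 0; last by rewrite mule0.
  apply: integral0_eq => y _.
  by rewrite pw_le0// subr_le0 (le_trans t0)// sqr_ge0.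
rewrite tonelli/=; [|by mfun|by pos].
transitivity ((Gammaf p)%:E * \int[mu]_y (expR (- y ^+ 2))%:E);
  last by rewrite integralT_gauss -EFinM mulrC.
rewrite -ge0_integralcMl;
  [|exact/ltW/Gammaf_gt0|by mfun|by pos].
apply: eq_integral => y _.
rewrite (ge0_integral_shift (y ^+ 2)%R); [|by mfun|by pos].
transitivity (\int[mu]_t (expR (- y ^+ 2) * (pw (p - 1) t * expR (- t)))%:E).
  apply: eq_integral => t _; congr EFin; rewrite addrK opprD expRD; ring.
rewrite ge0_integralcMl; [|by pos|by mfun|by pos].
by rewrite -/(egamma p) (egammaE p0) -EFinM mulrC.
Qed.

Lemma ehalfbetaE p : (0 < p)%R ->
  ehalfbeta p = (Num.sqrt pi * Gammaf p / Gammaf (p + 2^-1))%:E.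
Proof.
move=> p0; apply: eq_divEFin; first by rewrite Gammaf_gt0 ?addr_gt0.
exact: Gammaf_mul_ehalfbeta.
Qed.

Lemma ehalfbeta1 : ehalfbeta 1 = 2%:E.
Proof.
transitivity (\int[mu]_(y in `](-1)%R, 1%R[) (cst 1%R y)%:E).
  apply/esym/integral_mkbool => y; rewrite subrr pw0 subr_gt0 mem_setE in_itv/=.
  by rewrite -ltr_norml -[X in (_ < X)%R](expr1n _ 2) -real_normK ?num_real//
    ltr_pXn2r ?nnegrE//; case: ifP.
transitivity (lebesgue_measure (`](-1)%R, 1%R[%classic : set R)).
  by rewrite (integral_cst mu (measurable_itv _) 1) mul1e.
rewrite lebesgue_measure_itv/= lte_fin ifT.
  by rewrite -EFinB opprK.
by rewrite (@lt_trans _ _ 0%R)// oppr_lt0.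
Qed.

(** The case p = 1 of [Gammaf_mul_ehalfbeta], where the integral is the length 2 of ]-1, 1[, gives
    Gamma(3/2); the functional equation steps down to 1/2. *)
Lemma Gammaf_half : Gammaf 2^-1 = Num.sqrt pi :> R.
Proof.
have := @Gammaf_mul_ehalfbeta 1 ltr01; rewrite ehalfbeta1 Gammaf1 mulr1.
rewrite addrC GammafD1 ?invr_gt0// -EFinM => -[<-].
by rewrite mulrC mulrA divff ?mul1r.
Qed.

End BetaIntegrals.

(** * The Riesz potential of a single w_t *)

Section RieszPotential.
Local Open Scope ereal_scope.
Context {R : realType}.
Local Notation mu := (@lebesgue_measure R).

(** Single points are negligible. This serves where two integrands follow different conventions at
    one point: at y = x, where [pw (- s) 0] is 0, and at a truncation level t = T. *)
Lemma eq_integral_setD1 (x : R) (f g : R -> \bar R) :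
  measurable_fun setT f -> measurable_fun setT g ->
  (forall y, y != x -> f y = g y) -> \int[mu]_y f y = \int[mu]_y g y.
Proof.
move=> mf mg fg.
have mD : measurable ([set: R] `\ x) by exact: measurableD.
rewrite -(integral_setD1 mD (measurable_funTS mf)).
rewrite -(integral_setD1 mD (measurable_funTS mg)).
by apply: eq_integral => y; rewrite inE/= => -[_ /eqP /fg].
Qed.

Variables s : R.
Hypotheses (s0 : (0 < s)%R) (s1 : (s < 1)%R).

(** B(1/2, s/2), the normalization of [riesz_subordination]. *)
Definition half_beta_const : R := (Gammaf 2^-1 * Gammaf (s / 2) / Gammaf (2^-1 + s / 2))%R.
Local Notation c := half_beta_const.

Lemma half_beta_const_gt0 : (0 < c)%R.
Proof.
have s20 : (0 < s / 2)%R by rewrite divr_gt0.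
by rewrite /c divr_gt0 ?mulr_gt0 ?Gammaf_gt0 ?addr_gt0.
Qed.
Hint Resolve half_beta_const_gt0 : core.

(* The substitution n = (D^2 / B) (1 + v) turns this into a beta integral. *)
Lemma riesz_subordination (B D : R) : (0 < D)%R ->
  \int[mu]_n (pw (- (2^-1 + s / 2)) n * pw (2^-1 - 1) (n * B - D ^+ 2))%:E =
  (pw (- s) D * pw ((s - 1) / 2) B * c)%:E.
Proof.
move=> D0; have [B0|B0] := ltP 0%R B; last first.
  rewrite (pw_le0 _ B0) mulr0 mul0r; apply: integral0_eq => n _.
  have [n0|n0] := ltP 0%R n; last by rewrite (pw_le0 _ n0) mul0r.
  rewrite [X in (_ * X)%R]pw_le0 ?mulr0// subr_le0 (@le_trans _ _ 0%R) ?sqr_ge0//.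
  by rewrite pmulr_rle0.
have D20 : (0 < D ^+ 2)%R by rewrite exprn_gt0.
have k0 : (0 < D ^+ 2 / B)%R by rewrite divr_gt0.
rewrite (ge0_integral_scale k0); [|by mfun|by pos].
rewrite (ge0_integral_shift 1%R); [|by mfun|by pos].
transitivity ((D ^+ 2 / B)%:E * \int[mu]_v
  (pw (- (2^-1 + s / 2)) (D ^+ 2 / B) * pw (2^-1 - 1) (D ^+ 2) *
   (pw (2^-1 - 1) v * pw (- (2^-1 + s / 2)) (1 + v)))%:E).
  congr (_ * _); apply: eq_integral => v _; congr EFin.
  rewrite (_ : (D ^+ 2 / B * (v + 1) * B - D ^+ 2 = D ^+ 2 * v)%R); last first.
    by field; rewrite gt_eqF.
  by rewrite !pwM// [(v + 1)%R]addrC; ring.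
rewrite ge0_integralcMl; [|by pos|by mfun|by pos].
rewrite -/(ebetaoo 2^-1 (s / 2)) ebetaooE ?divr_gt0// -!EFinM; congr (_)%:E.
rewrite -/c mulrA; congr (_ * _)%R.
rewrite -[X in (X * (_ * _))%R](pw1 k0) mulrA -pwD pwM ?invr_gt0//.
rewrite pw_inv// -pwN// mulrAC -pwD.
by rewrite expr2 pwM// -pwD; congr (pw _ _ * pw _ _)%R; field.
Qed.

Definition riesz_pot (t x : R) : \bar R :=
  \int[mu]_y (pw (- s) `|x - y| * pw ((s - 1) / 2) (t - y ^+ 2))%:E.

(** What integrating out y leaves of the subordinated kernel: pi (1 + n)^(-1/2) from
    [integral_inv_sqrt_quad] and 1 / c from [riesz_subordination]. *)
Definition mix_weight (n : R) : R :=
  (pi / c * (pw (- (2^-1 + s / 2)) n * pw (- 2^-1) (1 + n)))%R.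

Lemma mix_weight_ge0 n : (0 <= mix_weight n)%R.
Proof. by rewrite /mix_weight !mulr_ge0 ?pw_ge0 ?invr_ge0 ?pi_ge0// ltW. Qed.

Lemma measurable_mix_weight : measurable_fun setT mix_weight.
Proof. by rewrite /mix_weight; mfun. Qed.

Lemma ehalfbeta_half : ehalfbeta 2^-1 = pi%:E :> \bar R.
Proof.
rewrite ehalfbetaE ?invr_gt0// Gammaf_half (_ : (2^-1 + 2^-1 = 1 :> R)%R); last by field.
by rewrite Gammaf1 divr1 -expr2 sqr_sqrtr// pi_ge0.
Qed.

(** For a > 0, rescaling y by sqrt(a / b) removes a altogether; this independence makes the
    potential of w_t constant wherever no n is cut off. *)
Lemma integral_inv_sqrt_quad (a b e : R) : (0 < b)%R ->
  \int[mu]_y (pw (2^-1 - 1) (a - b * (y - e) ^+ 2))%:E =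
  (pi * pw (- 2^-1) b * (0 < a)%R%:R)%:E.
Proof.
move=> b0; rewrite (ge0_integral_shift e); [|by mfun|by pos].
rewrite (ge0_integral_scale (pw_gt0 (- 2^-1) b0)); [|by mfun|by pos].
have -> : \int[mu]_y (pw (2^-1 - 1) (a - b * (pw (- 2^-1) b * y + e - e) ^+ 2))%:E =
    \int[mu]_y (pw (2^-1 - 1) (a - y ^+ 2))%:E.
  apply: eq_integral => y _; congr (pw _ (_ - _))%:E; rewrite addrK exprMn mulrA.
  by rewrite pwN// exprVn sqr_pw_half// divff ?mul1r ?gt_eqF.
have [a0|a0] := ltP 0%R a.
  rewrite integral_pw_sub_sqr// ehalfbeta_half subrr pw0 a0 mul1e -EFinM; congr EFin.
  by rewrite mulr1 mulrC.
rewrite integral0_eq ?mule0 ?mulr0// => y _.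
by rewrite pw_le0// subr_le0 (le_trans a0)// sqr_ge0.
Qed.

(* Completing the square in y after subordination leaves
   n (t - y^2) - (x - y)^2 = n (t - x^2 / (1 + n)) - (1 + n) (y - x / (1 + n))^2. *)
Lemma riesz_potE t x :
  riesz_pot t x = \int[mu]_n (mix_weight n * (x ^+ 2 < (1 + n) * t)%R%:R)%:E.
Proof.
have c0 := half_beta_const_gt0.
transitivity (c^-1%:E * \int[mu]_y \int[mu]_n
    (pw (- (2^-1 + s / 2)) n * pw (2^-1 - 1) (n * (t - y ^+ 2) - `|x - y| ^+ 2))%:E).
  rewrite -ge0_integralZl_EFin; last 4 first.
  - by [].
  - by move=> y _; apply: integral_ge0; pos.
  - by apply: measurable_integral_snd; [mfun|pos].
  - by rewrite invr_ge0 ltW.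
  apply: (@eq_integral_setD1 x).
  - by mfun.
  - apply: measurable_funeM; apply: measurable_integral_snd; [by mfun|by pos].
  move=> y yx; rewrite riesz_subordination ?normr_gt0 ?subr_eq0 1?eq_sym//.
  by rewrite -EFinM [X in _ = X%:E]mulrC mulfK// gt_eqF.
rewrite tonelli/=; [|by mfun|by pos].
rewrite -ge0_integralZl_EFin; last 4 first.
- by [].
- by move=> y _; apply: integral_ge0; pos.
- by apply: measurable_integral_fst; [mfun|pos].
- by rewrite invr_ge0 ltW.
apply: eq_integral => n _.
rewrite ge0_integralcMl; [|by pos|by mfun|by pos].
rewrite /mix_weight; have [n0|n0] := ltP 0%R n; last first.
  by rewrite (pw_le0 _ n0) mul0r mul0e mulr0 mul0r mule0.
have n10 : (0 < 1 + n)%R by rewrite addr_gt0.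
transitivity (c^-1%:E * ((pw (- (2^-1 + s / 2)) n)%:E * \int[mu]_y
    (pw (2^-1 - 1) (n * (t - x ^+ 2 / (1 + n)) - (1 + n) * (y - x / (1 + n)) ^+ 2))%:E)).
  congr (_ * (_ * _)); apply: eq_integral => y _; congr (pw _ _)%:E.
  by rewrite real_normK ?num_real//; field; rewrite gt_eqF.
rewrite integral_inv_sqrt_quad// -!EFinM; congr EFin.
rewrite (_ : (0 < n * (t - x ^+ 2 / (1 + n)))%R = (x ^+ 2 < (1 + n) * t)%R); first by ring.
by rewrite pmulr_rgt0// subr_gt0 ltr_pdivrMr// mulrC.
Qed.

End RieszPotential.

(** * Mixtures of the w_t and their potentials *)

Section MixturePotential.
Local Open Scope ereal_scope.
Context {R : realType}.
Implicit Types (w : R -> R) (t x y : R).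
Local Notation mu := (@lebesgue_measure R).
Variables s : R.
Hypotheses (s0 : (0 < s)%R) (s1 : (s < 1)%R).

Let h0 : (0 < s / 2)%R. Proof. by rewrite divr_gt0. Qed.
Let hm0 : (0 < (1 - s) / 2)%R. Proof. by rewrite divr_gt0 ?subr_gt0. Qed.
Let hp0 : (0 < (1 + s) / 2)%R. Proof. by rewrite divr_gt0 ?addr_gt0. Qed.

(** The value of the potential of w_t on x^2 <= t; also B((1 + s)/2, (1 - s)/2). *)
Definition riesz_const : R := (Gammaf ((1 - s) / 2) * Gammaf ((1 + s) / 2))%R.
Local Notation K := riesz_const.

Lemma riesz_const_gt0 : (0 < K)%R.
Proof. by rewrite mulr_gt0 ?Gammaf_gt0. Qed.

Lemma ebetaoo_riesz_const :
  (pi / half_beta_const s)%:E * ebetaoo ((1 - s) / 2) (s / 2) = K%:E.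
Proof.
rewrite ebetaooE// -EFinM; congr EFin; rewrite /half_beta_const /K.
rewrite (_ : ((1 - s) / 2 + s / 2 = 2^-1)%R); last by field.
rewrite (_ : (2^-1 + s / 2 = (1 + s) / 2)%R); last by field.
rewrite Gammaf_half.
have F (r p k m g : R) : r != 0%R -> (r ^+ 2 = p)%R -> g != 0%R -> k != 0%R ->
    (p / (r * g / k) * (m * g / r) = m * k)%R.
  by move=> rn <- gn kn; field; rewrite rn gn kn.
apply: F; rewrite ?gt_eqF ?Gammaf_gt0 ?sqrtr_gt0 ?pi_gt0//.
by rewrite sqr_sqrtr// pi_ge0.
Qed.

Lemma integral_mix_weight : \int[mu]_n (mix_weight s n)%:E = K%:E.
Proof.
rewrite -ebetaoo_riesz_const /ebetaoo -ge0_integralcMl; [|by rewrite mulr_ge0 ?pi_ge0// invr_ge0 ltW ?half_beta_const_gt0|by mfun|by pos].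
by apply: eq_integral => n _; congr (_ * (pw _ _ * pw _ _))%:E; field.
Qed.

(** The cutoff x^2 < (1 + n) t only removes mass from [mix_weight]; in [riesz_pot_in] it removes
    none, since x^2 <= t < (1 + n) t for n > 0. *)
Lemma riesz_pot_le t x : riesz_pot s t x <= K%:E.
Proof.
rewrite riesz_potE// -integral_mix_weight; apply: ge0_le_integral.
- by [].
- by move=> n _; rewrite lee_fin mulr_ge0 ?mix_weight_ge0.
- by apply/measurable_EFinP/measurable_funM; [exact: measurable_mix_weight|mfun].
- by apply/measurable_EFinP; exact: measurable_mix_weight.
- move=> n _; rewrite lee_fin ler_piMr ?mix_weight_ge0//.
  by case: ltP.
Qed.

Lemma riesz_pot_in t x : (0 < t)%R -> (x ^+ 2 <= t)%R -> riesz_pot s t x = K%:E.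
Proof.
move=> t0 xt; rewrite riesz_potE// -integral_mix_weight; apply: eq_integral => n _.
congr EFin; rewrite /mix_weight; have [n0|n0] := ltP 0%R n; last first.
  by rewrite (pw_le0 _ n0) mul0r mulr0 mul0r.
by rewrite (le_lt_trans xt) ?mulr1// mulrDl mul1r ltrDl mulr_gt0.
Qed.

Definition mix_density (w : R -> R) (y : R) : \bar R :=
  \int[mu]_t (w t * pw ((s - 1) / 2) (t - y ^+ 2))%:E.

Definition mix_pot (w : R -> R) (x : R) : \bar R :=
  \int[mu]_y ((pw (- s) `|x - y|)%:E * mix_density w y).

Lemma mix_density_ge0 w y : (forall t, (0 <= w t)%R) -> 0 <= mix_density w y.
Proof. by move=> w0; apply: integral_ge0 => t _; rewrite lee_fin mulr_ge0 ?pw_ge0. Qed.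

Lemma measurable_mix_density w : measurable_fun setT w -> (forall t, (0 <= w t)%R) ->
  measurable_fun setT (mix_density w).
Proof.
move=> mw w0; rewrite /mix_density; apply: measurable_integral_snd => /=.
  apply/measurable_EFinP/measurable_funM; last by mfun.
  exact: (measurableT_comp mw).
by move=> *; rewrite lee_fin mulr_ge0 ?pw_ge0.
Qed.

(** The weights need to add up off T only, since [low_weight] and [high_weight] both cut with a
    strict inequality. *)
Lemma mix_density_split w (w1 w2 : R -> R) (T : R) y :
  measurable_fun setT w -> measurable_fun setT w1 -> measurable_fun setT w2 ->
  (forall t, (0 <= w1 t)%R) -> (forall t, (0 <= w2 t)%R) ->
  (forall t, t != T -> w t = w1 t + w2 t)%R ->
  mix_density w y = mix_density w1 y + mix_density w2 y.
Proof.
move=> mw m1 m2 w10 w20 E; rewrite /mix_density -ge0_integralD//; last 4 first.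
- by move=> t _; rewrite lee_fin mulr_ge0 ?pw_ge0.
- by apply/measurable_EFinP/measurable_funM => //; mfun.
- by move=> t _; rewrite lee_fin mulr_ge0 ?pw_ge0.
- by apply/measurable_EFinP/measurable_funM => //; mfun.
apply: (@eq_integral_setD1 _ T).
- by apply/measurable_EFinP/measurable_funM => //; mfun.
- by apply: emeasurable_funD; apply/measurable_EFinP/measurable_funM => //; mfun.
by move=> t /E ->; rewrite -EFinD mulrDl.
Qed.

Lemma mix_potE w x : measurable_fun setT w -> (forall t, (0 <= w t)%R) ->
  mix_pot w x = \int[mu]_t ((w t)%:E * riesz_pot s t x).
Proof.
move=> mw w0; rewrite /mix_pot.
transitivity (\int[mu]_y \int[mu]_t
   (w t * (pw (- s) `|x - y| * pw ((s - 1) / 2) (t - y ^+ 2)))%:E).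
  apply: eq_integral => y _; rewrite /mix_density -ge0_integralcMl.
  - by apply: eq_integral => t _; congr EFin; ring.
  - by pos.
  - by apply: measurable_funM => //; mfun.
  - by move=> t; rewrite mulr_ge0 ?pw_ge0.
rewrite tonelli/=.
- apply: eq_integral => t _; rewrite ge0_integralcMl; [|exact: w0|by mfun|by pos].
  by rewrite -/(riesz_pot s t x).
- apply/measurable_EFinP/measurable_funM; last by mfun.
  exact: (measurableT_comp mw).
- by move=> *; rewrite lee_fin !mulr_ge0 ?pw_ge0.
Qed.

Lemma integral_mix_density w : measurable_fun setT w -> (forall t, (0 <= w t)%R) ->
  \int[mu]_y mix_density w y =
  (\int[mu]_t (w t * pw (s / 2) t)%:E) * ehalfbeta ((1 + s) / 2).
Proof.
move=> mw w0; rewrite /mix_density tonelli/=; last 2 first.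
- apply/measurable_EFinP/measurable_funM; last by mfun.
  exact: (measurableT_comp mw).
- by move=> *; rewrite lee_fin !mulr_ge0 ?pw_ge0.
rewrite -ge0_integralZrE ?ehalfbeta_ge0//; last 2 first.
- by apply: measurable_funM => //; mfun.
- by move=> t; rewrite mulr_ge0 ?pw_ge0.
apply: eq_integral => t _; rewrite ge0_integralcMl; [|exact: w0|by mfun|by pos].
have [t0|t0] := ltP 0%R t; last first.
  rewrite (pw_le0 _ t0) mulr0 mul0e integral0_eq ?mule0// => y _.
  by rewrite pw_le0// subr_le0 (le_trans t0)// sqr_ge0.
rewrite EFinM -muleA; congr (_ * _).
rewrite (_ : ((s - 1) / 2 = (1 + s) / 2 - 1)%R); last by field.
rewrite (integral_pw_sub_sqr _ t0).
by congr ((pw _ _)%:E * _); field.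
Qed.

Variables (b C : R).
Hypotheses (b0 : (0 < b)%R) (C0 : (0 < C)%R).

Let b20 : (0 < b ^+ 2)%R. Proof. by rewrite exprn_gt0. Qed.

Definition full_weight (t : R) : R := (C * pw (- (3 / 2)) (t + b ^+ 2))%R.
Definition low_weight T t := (full_weight t * (t < T)%R%:R)%R.
Definition high_weight T t := (full_weight t * (T < t)%R%:R)%R.

Lemma full_weight_ge0 t : (0 <= full_weight t)%R.
Proof. by rewrite mulr_ge0 ?pw_ge0// ltW. Qed.
Lemma low_weight_ge0 T t : (0 <= low_weight T t)%R.
Proof. by rewrite mulr_ge0 ?full_weight_ge0. Qed.
Lemma high_weight_ge0 T t : (0 <= high_weight T t)%R.
Proof. by rewrite mulr_ge0 ?full_weight_ge0. Qed.
Lemma measurable_full_weight : measurable_fun setT full_weight.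
Proof. by rewrite /full_weight; mfun. Qed.
Lemma measurable_low_weight T : measurable_fun setT (low_weight T).
Proof. by apply: measurable_funM; [exact: measurable_full_weight|mfun]. Qed.
Lemma measurable_high_weight T : measurable_fun setT (high_weight T).
Proof. by apply: measurable_funM; [exact: measurable_full_weight|mfun]. Qed.
Hint Resolve full_weight_ge0 low_weight_ge0 high_weight_ge0 measurable_full_weight
  measurable_low_weight measurable_high_weight : core.

Lemma full_weight_split T t : t != T -> full_weight t = (low_weight T t + high_weight T t)%R.
Proof.
by rewrite /low_weight /high_weight; case: ltgtP => // _ _; rewrite mulr0 mulr1 ?addr0 ?add0r.
Qed.

Lemma integral_high_weight T : (0 <= T)%R ->
  \int[mu]_t (high_weight T t)%:E = (2 * C * pw (- 2^-1) (T + b ^+ 2))%:E.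
Proof.
move=> T0; rewrite (ge0_integral_shift (- b ^+ 2)%R); last 2 first.
- by apply/measurable_EFinP; exact: measurable_high_weight.
- by move=> t; rewrite lee_fin high_weight_ge0.
transitivity (\int[mu]_t (C * (pw (- 2^-1 - 1) t * (T + b ^+ 2 < t)%R%:R))%:E).
  apply: eq_integral => t _; congr EFin; rewrite /high_weight /full_weight subrK.
  by rewrite ltrBrDr -mulrA; congr (_ * (pw _ _ * _))%R; field.
rewrite ge0_integralcMl; [|exact: ltW|by mfun|by pos].
rewrite integral_pw_tail ?invr_gt0// ?ltr_wpDl//.
by rewrite -EFinM invrK; congr EFin; ring.
Qed.

(** For fixed n the cutoff selects the part t > x^2/(1 + n) of the weight, hence [high_weight]; the
    resulting inverse square root absorbs the (1 + n)^(-1/2) of [mix_weight]. *)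
Lemma mix_pot_full x :
  mix_pot full_weight x = (2 * C * K * pw (s - 1) b * pw (- (s / 2)) (x ^+ 2 + b ^+ 2))%:E.
Proof.
rewrite mix_potE//.
transitivity (\int[mu]_t \int[mu]_n
    (mix_weight s n * (full_weight t * (x ^+ 2 < (1 + n) * t)%R%:R))%:E).
  apply: eq_integral => t _; rewrite riesz_potE// -ge0_integralcMl//.
  - by apply: eq_integral => n _; congr EFin; ring.
  - by apply: measurable_funM; [exact: measurable_mix_weight|mfun].
  - by move=> n; rewrite mulr_ge0 ?mix_weight_ge0.
rewrite tonelli/=; last 2 first.
- apply/measurable_EFinP/measurable_funM.
    exact: (measurableT_comp (measurable_mix_weight _)).
  apply: measurable_funM; last by mfun.
  exact: (measurableT_comp measurable_full_weight).
- move=> t n; rewrite lee_fin; apply: mulr_ge0; first exact: mix_weight_ge0.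
  by apply: mulr_ge0; rewrite ?full_weight_ge0.
have A0 : (0 < x ^+ 2 + b ^+ 2)%R by rewrite ltr_wpDl ?sqr_ge0.
set A := (x ^+ 2 + b ^+ 2)%R in A0 *.
have c0 := half_beta_const_gt0 s0.
transitivity (\int[mu]_n (2 * C * (pi / half_beta_const s) *
    (pw (- (2^-1 + s / 2)) n * pw (- 2^-1) (A + n * b ^+ 2)))%:E).
  apply: eq_integral => n _.
  rewrite ge0_integralcMl ?mix_weight_ge0//; last 2 first.
  - by apply: measurable_funM => //; mfun.
  - by move=> t; rewrite mulr_ge0 ?full_weight_ge0.
  rewrite /mix_weight; have [n0|n0] := ltP 0%R n; last first.
    by rewrite (pw_le0 _ n0) !(mul0r, mulr0) mul0e.
  have n10 : (0 < 1 + n)%R by rewrite addr_gt0.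
  have -> : \int[mu]_t (full_weight t * (x ^+ 2 < (1 + n) * t)%R%:R)%:E =
      \int[mu]_t (high_weight (x ^+ 2 / (1 + n)) t)%:E.
    by apply: eq_integral => t _; rewrite /high_weight ltr_pdivrMr// [(t * _)%R]mulrC.
  rewrite integral_high_weight ?divr_ge0 ?sqr_ge0 ?(ltW n10)// -EFinM; congr EFin.
  have -> : (A + n * b ^+ 2 = (1 + n) * (x ^+ 2 / (1 + n) + b ^+ 2))%R.
    by rewrite /A; field; rewrite gt_eqF.
  by rewrite pwM//; ring.
(* Scaling n by A / b^2 turns A + n b^2 into A (1 + n), and the integral into the one of
   [ebetaoo_riesz_const]. *)
have k0 : (0 < A / b ^+ 2)%R by rewrite divr_gt0.
rewrite ge0_integralcMl; [|by rewrite !mulr_ge0 ?pi_ge0 ?(ltW C0)// invr_ge0 ltW|by mfun|by pos].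
rewrite (ge0_integral_scale k0); [|by mfun|by pos].
transitivity ((2 * C * (pi / half_beta_const s))%:E * ((A / b ^+ 2)%:E * \int[mu]_n
    (pw (- (2^-1 + s / 2)) (A / b ^+ 2) * pw (- 2^-1) A *
     (pw ((1 - s) / 2 - 1) n * pw (- ((1 - s) / 2 + s / 2)) (1 + n)))%:E)).
  congr (_ * (_ * _)); apply: eq_integral => n _; congr EFin.
  have -> : (A + A / b ^+ 2 * n * b ^+ 2 = A * (1 + n))%R.
    by field; rewrite gt_eqF.
  rewrite !pwM//.
  rewrite (_ : ((1 - s) / 2 - 1 = - (2^-1 + s / 2))%R); last by field.
  rewrite (_ : (- ((1 - s) / 2 + s / 2) = - 2^-1)%R); last by field.
  by ring.
rewrite ge0_integralcMl; [|by pos|by mfun|by pos].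
rewrite -/(ebetaoo _ _) EFinM -muleA muleCA; rewrite [X in _ * X]muleCA.
have H : (A / b ^+ 2 * (pw (- (2^-1 + s / 2)) (A / b ^+ 2) * pw (- 2^-1) A) =
    pw (s - 1) b * pw (- (s / 2)) A)%R.
  rewrite -[X in (X * (_ * _))%R](pw1 k0) mulrA -pwD pwM ?invr_gt0//.
  rewrite pw_inv// -pwN// expr2 pwM// -pwD mulrAC -pwD mulrC.
  by congr (pw _ _ * pw _ _)%R; field.
have := ebetaoo_riesz_const; rewrite (ebetaooE hm0 h0).
move: (_ / Gammaf _)%R => e; rewrite -!EFinM => -[<-]; congr EFin.
by rewrite -[RHS]mulrA -H; ring.
Qed.

Lemma mix_pot_split T x :
  mix_pot full_weight x = mix_pot (low_weight T) x + mix_pot (high_weight T) x.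
Proof.
rewrite /mix_pot -ge0_integralD//; last 4 first.
- by move=> y _; rewrite mule_ge0 ?lee_fin ?pw_ge0// mix_density_ge0.
- by apply: emeasurable_funM; [mfun|exact: measurable_mix_density].
- by move=> y _; rewrite mule_ge0 ?lee_fin ?pw_ge0// mix_density_ge0.
- by apply: emeasurable_funM; [mfun|exact: measurable_mix_density].
apply: eq_integral => y _.
rewrite (mix_density_split (w1 := low_weight T) (w2 := high_weight T) (T := T))//;
  last exact: full_weight_split.
by rewrite muleDr// ge0_adde_def// inE mix_density_ge0.
Qed.

Lemma mix_pot_high_le T x : (0 <= T)%R ->
  mix_pot (high_weight T) x <= (2 * C * K * pw (- 2^-1) (T + b ^+ 2))%:E.
Proof.
move=> T0; rewrite mix_potE//.
apply: (@le_trans _ _ (\int[mu]_t ((high_weight T t)%:E * K%:E))).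
  apply: ge0_le_integral => //.
  - move=> t _; rewrite mule_ge0 ?lee_fin// integral_ge0// => y _; pos.
  - apply: emeasurable_funM; first by apply/measurable_EFinP; exact: measurable_high_weight.
    by rewrite /riesz_pot; apply: measurable_integral_snd; [mfun|pos].
  - apply: emeasurable_funM; last by mfun.
    by apply/measurable_EFinP; exact: measurable_high_weight.
  - move=> t _; apply: lee_wpmul2l; last exact: riesz_pot_le.
    by rewrite lee_fin high_weight_ge0.
rewrite ge0_integralZrE; [|by rewrite lee_fin ltW ?riesz_const_gt0|
  exact: measurable_high_weight|exact: high_weight_ge0].
by rewrite integral_high_weight// -EFinM lee_fin mulrAC.
Qed.

Lemma mix_pot_high_in T x : (0 < T)%R -> (x ^+ 2 <= T)%R ->
  mix_pot (high_weight T) x = (2 * C * K * pw (- 2^-1) (T + b ^+ 2))%:E.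
Proof.
move=> T0 xT; rewrite mix_potE//.
transitivity (\int[mu]_t ((high_weight T t)%:E * K%:E)).
  apply: eq_integral => t _; rewrite /high_weight.
  (* Where the weight is nonzero, x^2 <= T < t, so x lies where w_t has constant potential. *)
  have [Tt|Tt] := ltP T t; last by rewrite mulr0 !mul0e.
  by rewrite riesz_pot_in ?(lt_trans T0)// (le_trans xT)// ltW.
rewrite ge0_integralZrE; [|by rewrite lee_fin ltW ?riesz_const_gt0|
  exact: measurable_high_weight|exact: high_weight_ge0].
by rewrite integral_high_weight ?(ltW T0)// -EFinM mulrAC.
Qed.

End MixturePotential.

(** * Probability measures given by a density *)

Section DensityMeasures.
Local Open Scope ereal_scope.
Context {R : realType}.
Local Notation mu := (@lebesgue_measure R).

(** Open intervals generate the Borel sets, are stable under intersection and exhaust the line, so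
    the uniqueness theorem for measures applies. *)
Lemma probability_eq_itvoo (m1 m2 : probability R R) :
  (forall a b : R, m1 `]a, b[%classic = m2 `]a, b[%classic) ->
  forall A, measurable A -> m1 A = m2 A.
Proof.
move=> H A; rewrite [X in X A](RGenOpens.measurableE R) => mA.
apply: (@g_sigma_algebra_measure_unique _ R R (@RGenOpens.G R) _
  (fun n => `](- n%:R)%R, n%:R[%classic) _ _ m1 m2 _ _ _ A mA).
- by move=> _ [a [b ->]]; exact: measurable_itv.
- by move=> n; exists (- n%:R)%R, n%:R.
- rewrite -subTset => x _; exists (Num.bound x) => //=.
  rewrite in_itv/= -ltr_norml.
  by have := archi_boundP (normr_ge0 x); rewrite /Num.bound normr_id.
- move=> _ _ [a [b ->]] [c [d ->]]; exists (Num.max a c), (Num.min b d).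
  apply/seteqP; split => x /=; rewrite !in_itv/= gt_max lt_min.
    by case=> /andP[-> ->] /andP[-> ->].
  by move=> /andP[/andP[-> ->] /andP[-> ->]].
- by move=> _ [a [b ->]]; exact: H.
- by move=> n; rewrite (le_lt_trans (probability_le1 _ _))// ltry.
Qed.

Lemma exists_density_probability (rho : R -> \bar R) :
  measurable_fun setT rho -> (forall x, 0 <= rho x) -> \int[mu]_x rho x = 1 ->
  exists m : probability R R, forall A, measurable A -> m A = \int[mu]_(x in A) rho x.
Proof.
move=> mr r0 r1.
pose m A := \int[mu]_(x in A) rho x.
have m0 : m set0 = 0 by rewrite /m integral_set0.
have mge A : 0 <= m A by exact: integral_ge0.
have msigma : semi_sigma_additive (m : set R -> \bar R).
  move=> F mF tF mUF; rewrite /m; apply: cvg_toP.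
    by apply: ereal_nondecreasing_is_cvgn => i j ij; apply: lee_sum_nneg_natr => // k _ _; exact: mge.
  rewrite ge0_integral_bigcup//=; exact: measurable_funTS.
pose M := isMeasure.Build _ R R m m0 mge msigma.
pose mm : {measure set R -> \bar R} := HB.pack m M.
pose P := @Measure_isProbability.Build _ _ R mm r1.
pose pm : probability R R := HB.pack m M P.
by exists pm.
Qed.

(** Layer cake: f x is the length of the set 0 < t < f x, which reduces the claim to superlevel
    sets. The exponent 1 - 1 makes [pw (1 - 1) t] the indicator of t > 0 in the shape of
    [integral_pw_below]. *)
Lemma integral_density (m : probability R R) (rho : R -> \bar R) (f : R -> R) :
  measurable_fun setT rho -> (forall x, 0 <= rho x) ->
  (forall A, measurable A -> m A = \int[mu]_(x in A) rho x) ->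
  measurable_fun setT f -> (forall x, (0 <= f x)%R) ->
  \int[m]_x (f x)%:E = \int[mu]_x ((f x)%:E * rho x).
Proof.
move=> mr r0 Hm mf f0.
have layer x : (f x)%:E = \int[mu]_t (pw (1 - 1) t * (t < f x)%R%:R)%:E.
  rewrite integral_pw_below// divr1; case: (ltP 0%R (f x)) => fx; first by rewrite pw1.
  by rewrite pw_le0//; congr EFin; apply/le_anti; rewrite fx f0.
transitivity (\int[m]_x \int[mu]_t (pw (1 - 1) t * (t < f x)%R%:R)%:E).
  by apply: eq_integral => x _; exact: layer.
transitivity (\int[mu]_x \int[mu]_t ((pw (1 - 1) t * (t < f x)%R%:R)%:E * rho x)); last first.
  apply: eq_integral => x _.
  rewrite ge0_integralZrE//; [by rewrite -layer|by mfun|by pos].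
have mf2 : measurable_fun setT (fun z : R * R => f z.1) by exact: measurableT_comp.
have mf1 : measurable_fun setT (fun z : R * R => pw (1 - 1) z.2 * (z.2 < f z.1)%R%:R)%R.
  by apply: measurable_funM; [mfun|exact: measurable_fun_lt_natr].
rewrite tonelli/=; [|exact/measurable_EFinP|by pos].
have mr2 : measurable_fun setT (fun z : R * R => rho z.1) by exact: measurableT_comp.
rewrite [RHS]tonelli/=; [|by apply: emeasurable_funM => //; exact/measurable_EFinP|
  by move=> x t; rewrite mule_ge0// lee_fin mulr_ge0 ?pw_ge0].
apply: eq_integral => t _.
have mA : measurable [set x | (t < f x)%R].
  rewrite (_ : [set x | _] = setT `&` f @^-1` `]t, +oo[%classic).
    by apply: mf => //; exact: measurable_itv.
  by apply/seteqP; split => x /=; rewrite in_itv/= andbT; [split|case].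
rewrite ge0_integralcMl; [|by pos|exact: measurable_fun_lt_natr|by pos].
transitivity ((pw (1 - 1) t)%:E * m [set x | (t < f x)%R]).
  congr (_ * _); rewrite -(setIT [set x | (t < f x)%R]) -integral_indic//.
  by apply: eq_integral => x _; rewrite indicE mem_setE.
rewrite Hm// integral_mkcond -ge0_integralZl; [|by []|
  by apply/(measurable_restrictT _ mA); exact: measurable_funTS|
  by move=> x _; apply: erestrict_ge0|by rewrite lee_fin pw_ge0].
apply: eq_integral => x _; rewrite EFinM -muleA; congr (_ * _).
rewrite patchE; case: (boolP (t < f x)%R) => tf; first by rewrite mem_set// mul1e.
by rewrite memNset ?mul0e//=; exact/negP.
Qed.

End DensityMeasures.

(** For fixed z the integrand is a function of x times a function of y, so Tonelli can bring z
    outermost. It serves for energies whose kernel is a superposition of such products. *)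
Lemma integral_rank_one (R : realType) d1 (X : measurableType d1) d2 (Z : measurableType d2)
    (m1 m2 : {sigma_finite_measure set X -> \bar R})
    (P : {sigma_finite_measure set Z -> \bar R}) (W F1 F2 : Z -> R) (k : Z -> X -> R) :
  (forall z, 0 <= W z)%R -> (forall z x, 0 <= k z x)%R ->
  measurable_fun setT W -> measurable_fun setT (fun t : X * Z => k t.2 t.1) ->
  (forall z, \int[m1]_x (k z x)%:E = (F1 z)%:E)%E ->
  (forall z, \int[m2]_x (k z x)%:E = (F2 z)%:E)%E ->
  (\int[m1]_x \int[m2]_y \int[P]_z (W z * (k z x * k z y))%:E =
   \int[P]_z (W z * (F1 z * F2 z))%:E)%E.
Proof.
move=> W0 k0 mW mk E1 E2.
have mW2 : measurable_fun setT (fun t : X * Z => W t.2).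
  exact: (measurableT_comp mW measurable_snd).
have mkx x : measurable_fun setT (k^~ x).
  exact: (measurable_fun_pair2 x mk).
have mkz z : measurable_fun setT (k z).
  exact: (measurable_fun_pair1 z mk).
have F20 z : (0 <= F2 z)%R.
  by rewrite -lee_fin -E2; apply: integral_ge0 => y _; rewrite lee_fin.
have mF2 : measurable_fun setT F2.
  apply/measurable_EFinP; rewrite (_ : EFin \o _ = fun z => \int[m2]_x (k z x)%:E)%E.
    apply: measurable_integral_fst; last by move=> *; rewrite lee_fin.
    exact/measurable_EFinP.
  by apply/funext => z /=; rewrite E2.
transitivity (\int[m1]_x \int[P]_z (W z * (k z x * F2 z))%:E)%E.
  apply: eq_integral => x _.
  rewrite tonelli.
  - apply: eq_integral => z _.
    transitivity (\int[m2]_y (W z * k z x * k z y)%:E)%E.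
      by apply: eq_integral => y _; rewrite mulrA.
    by rewrite ge0_integralcMl ?E2 -?EFinM ?mulrA// mulr_ge0.
  - apply/measurable_EFinP/measurable_funM => //; apply: measurable_funM => //.
    exact: (measurableT_comp (mkx x) measurable_snd).
  - by move=> y z; rewrite lee_fin !mulr_ge0.
rewrite tonelli.
- apply: eq_integral => z _.
  transitivity (\int[m1]_x (W z * F2 z * k z x)%:E)%E.
    by apply: eq_integral => x _; congr EFin; ring.
  rewrite ge0_integralcMl ?E1 -?EFinM ?mulr_ge0//; congr EFin; ring.
- apply/measurable_EFinP/measurable_funM => //; apply: measurable_funM => //.
  exact: (measurableT_comp mF2 measurable_snd).
- by move=> x z; rewrite lee_fin !mulr_ge0.
Qed.

(** * Positive definiteness of the Riesz energy *)

Section RieszEnergy.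
Local Open Scope ereal_scope.
Context {R : realType}.
Local Notation mu := (@lebesgue_measure R).

Let plane_sigma_finite : sigma_finite setT (mu \x mu).
Proof.
exists (fun n => `](- n%:R)%R, n%:R[%classic `*` `](- n%:R)%R, n%:R[%classic).
  apply/seteqP; split => // -[x y] _.
  have [n Hx Hy] : exists2 n : nat, (`|x| < n%:R)%R & (`|y| < n%:R)%R.
    exists (maxn (Num.bound x) (Num.bound y)).
      have := archi_boundP (normr_ge0 x); rewrite {1}/Num.bound normr_id => /lt_le_trans; apply.
      by rewrite ler_nat leq_maxl.
    have := archi_boundP (normr_ge0 y); rewrite {1}/Num.bound normr_id => /lt_le_trans; apply.
    by rewrite ler_nat leq_maxr.
  by exists n => //=; split; rewrite /= in_itv/= -ltr_norml.
move=> n; split; first by apply: measurableX; exact: measurable_itv.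
rewrite product_measure1E; [|exact: measurable_itv|exact: measurable_itv].
suff : lebesgue_measure (`](- n%:R)%R, n%:R[%classic : set R) *
  lebesgue_measure (`](- n%:R)%R, n%:R[%classic : set R) < +oo by [].
rewrite lebesgue_measure_itv/=; case: ifP => _; last by rewrite mul0e.
by rewrite -EFinB -EFinM ltry.
Qed.

(** The space of intervals ]u, v[ packed as a sigma-finite measure, to serve as one factor when
    Tonelli is applied against a probability on the line. *)
Definition plane_measure :
    {sigma_finite_measure set (measurableTypeR R * measurableTypeR R)%type -> \bar R} :=
  HB.pack (mu \x mu) (Measure_isSigmaFinite.Build _ _ _ (mu \x mu) plane_sigma_finite).

Lemma integral_plane_measure (f : R * R -> \bar R) : measurable_fun setT f ->
  (forall z, 0 <= f z) -> \int[plane_measure]_z f z = \int[mu]_u \int[mu]_v f (u, v).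
Proof. by move=> mf f0; rewrite /plane_measure fubini_tonelli1. Qed.

Variable s : R.
Hypothesis s0 : (0 < s)%R.

(** Minus the mixed derivative in u and v of (v - u)^(-s), so that for x < y integrating over u < x
    and v > y returns (y - x)^(-s). *)
Definition itv_weight (z : R * R) : R := (s * (s + 1) * pw (- s - 2) (z.2 - z.1))%R.

Definition itv_ind (z : R * R) (x : R) : R := ((z.1 < x)%R%:R * (x < z.2)%R%:R)%R.

Lemma itv_weight_ge0 z : (0 <= itv_weight z)%R.
Proof. by rewrite /itv_weight !mulr_ge0 ?pw_ge0 ?addr_ge0// ltW. Qed.

Lemma itv_ind_ge0 z x : (0 <= itv_ind z x)%R.
Proof. by rewrite mulr_ge0. Qed.

Lemma measurable_itv_weight : measurable_fun setT itv_weight.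
Proof. by rewrite /itv_weight; mfun. Qed.

Lemma measurable_itv_ind d (T : measurableType d) (f : T -> R * R) (g : T -> R) :
  measurable_fun setT f -> measurable_fun setT g ->
  measurable_fun setT (fun t => itv_ind (f t) (g t)).
Proof.
move=> mf mg; rewrite /itv_ind; apply: measurable_funM; apply: measurable_fun_lt_natr => //.
- exact: (measurableT_comp measurable_fst).
- exact: (measurableT_comp measurable_snd).
Qed.

Let integral_weight_above (u y : R) : (u < y)%R ->
  \int[mu]_v (itv_weight (u, v) * (y < v)%R%:R)%:E = (s * pw (- s - 1) (y - u))%:E.
Proof.
move=> uy; have s10 : (0 < s + 1)%R by rewrite addr_gt0.
rewrite (ge0_integral_shift u); last 2 first.
- by rewrite /itv_weight/=; mfun.
- by move=> v; rewrite lee_fin mulr_ge0 ?itv_weight_ge0.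
transitivity (\int[mu]_v (s * (s + 1) * (pw (- (s + 1) - 1) v * (y - u < v)%R%:R))%:E).
  apply: eq_integral => v _; congr EFin; rewrite /itv_weight/= addrK ltrBlDr -mulrA.
  by congr (_ * (pw _ _ * _))%R; ring.
rewrite ge0_integralcMl; [|by rewrite mulr_ge0 ?ltW|by mfun|by pos].
rewrite integral_pw_tail ?subr_gt0// -EFinM; congr EFin.
rewrite (_ : (- (s + 1) = - s - 1)%R); last by ring.
by field; rewrite gt_eqF.
Qed.

Let integral_weight_below (x y : R) : (x <= y)%R ->
  \int[mu]_u \int[mu]_v (itv_weight (u, v) * ((u < x)%R%:R * (y < v)%R%:R))%:E =
  \int[mu]_u (s * (pw (- s - 1) u * (y - x < u)%R%:R))%:E.
Proof.
move=> xy; rewrite [RHS](ge0_integral_reflect y); [|by mfun|by pos].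
apply: eq_integral => u _; rewrite ltrD2l ltrN2; case: (ltP u x) => ux; last first.
  by rewrite !mulr0; apply: integral0_eq => v _; rewrite mul0r mulr0.
under eq_integral => v _ do rewrite mul1r.
by rewrite (integral_weight_above (lt_le_trans ux xy)) mulr1.
Qed.

Lemma integral_pw_infinite : \int[mu]_u (pw (- s - 1) u * (0 < u)%R%:R)%:E = +oo.
Proof.
apply/eqyP => A A0.
(* The threshold c = (s A)^(-1/s) solves c^(-s) / s = A, so the tail beyond it already equals A. *)
have c0 : (0 < pw (- s^-1) (s * A))%R by rewrite pw_gt0// mulr_gt0.
apply: (@le_trans _ _ (\int[mu]_u (pw (- s - 1) u * (pw (- s^-1) (s * A) < u)%R%:R)%:E)).
  rewrite integral_pw_tail// lee_fin pw_pw ?mulr_gt0//.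
  rewrite (_ : (- s^-1 * - s = 1)%R); last by field; rewrite gt_eqF.
  by rewrite pw1 ?mulr_gt0// mulrAC divff ?mul1r// gt_eqF.
apply: ge0_le_integral; [by []|by pos|by mfun|by mfun|].
move=> u _; rewrite lee_fin ler_wpM2l ?pw_ge0//.
by case: (ltP _ u) => // cu; rewrite (lt_trans c0 cu).
Qed.

(* Integrating over the intervals that contain both x and y makes the energy
   visibly positive definite; at x = y the integral diverges, as it should. *)
Lemma riesz_kernelE x y : riesz_kernel s x y =
  \int[mu]_u \int[mu]_v (itv_weight (u, v) * (itv_ind (u, v) x * itv_ind (u, v) y))%:E.
Proof.
wlog xy : x y / (x <= y)%R.
  move=> H; have [|/ltW yx] := leP x y; first exact: H.
  rewrite (_ : riesz_kernel s x y = riesz_kernel s y x); last first.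
    by rewrite /riesz_kernel eq_sym distrC.
  rewrite (H y x yx); apply: eq_integral => u _; apply: eq_integral => v _.
  by rewrite [(itv_ind _ y * _)%R]mulrC.
transitivity (\int[mu]_u \int[mu]_v (itv_weight (u, v) * ((u < x)%R%:R * (y < v)%R%:R))%:E);
    last first.
  apply: eq_integral => u _; apply: eq_integral => v _; congr (_ * _)%:E.
  rewrite /itv_ind/=; case: (ltP u x) => ux; last by rewrite !mul0r.
  rewrite (lt_le_trans ux xy) !mul1r; case: (ltP y v) => yv; last by rewrite mulr0.
  by rewrite (le_lt_trans xy yv) mulr1.
rewrite integral_weight_below//.
rewrite ge0_integralcMl; [|exact: ltW|by mfun|by pos].
rewrite /riesz_kernel; case: eqVneq => [->|xny].
  by rewrite subrr integral_pw_infinite gt0_muley// lte_fin.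
have {}xy : (x < y)%R by rewrite lt_neqAle xny.
rewrite integral_pw_tail ?subr_gt0// -EFinM distrC gtr0_norm ?subr_gt0//.
by rewrite pwE ?subr_gt0// mulrC divfK// gt_eqF.
Qed.

Definition mutual_energy (m1 m2 : probability R R) :=
  \int[m1]_x \int[m2]_y riesz_kernel s x y.

Definition itv_mass (m : probability R R) (z : R * R) : R := fine (m `]z.1, z.2[%classic).

Lemma itv_mass_ge0 m z : (0 <= itv_mass m z)%R.
Proof. exact: fine_ge0. Qed.

Lemma integral_itv_ind (m : probability R R) z : \int[m]_x (itv_ind z x)%:E = (itv_mass m z)%:E.
Proof.
rewrite /itv_mass fineK ?fin_num_measure//.
rewrite -(setIT `]z.1, z.2[%classic) -integral_indic//; apply: eq_integral => x _; congr EFin.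
rewrite /itv_ind indicE mem_setE in_itv/=.
by case: (z.1 < x)%R; rewrite ?mul0r ?mul1r.
Qed.

Lemma measurable_itv_mass m : measurable_fun setT (itv_mass m).
Proof.
apply/measurable_EFinP; rewrite (_ : EFin \o _ = fun z => \int[m]_x (itv_ind z x)%:E).
  apply: measurable_integral_snd; last by move=> *; rewrite lee_fin itv_ind_ge0.
  apply/measurable_EFinP; apply: measurable_itv_ind; [exact: measurable_fst|exact: measurable_snd].
by apply/funext => z /=; rewrite integral_itv_ind.
Qed.

Lemma mutual_energyE (m1 m2 : probability R R) : mutual_energy m1 m2 =
  \int[plane_measure]_z (itv_weight z * (itv_mass m1 z * itv_mass m2 z))%:E.
Proof.
have mw := measurable_itv_weight.
have kE x y : riesz_kernel s x y =
    \int[plane_measure]_z (itv_weight z * (itv_ind z x * itv_ind z y))%:E.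
  rewrite riesz_kernelE integral_plane_measure//.
  - apply/measurable_EFinP/measurable_funM => //.
    by apply: measurable_funM; apply: measurable_itv_ind => //; exact: measurable_cst.
  - move=> z; rewrite lee_fin; apply: mulr_ge0; first exact: itv_weight_ge0.
    by apply: mulr_ge0; exact: itv_ind_ge0.
rewrite /mutual_energy.
under eq_integral => x _ do under eq_integral => y _ do rewrite kE.
apply: integral_rank_one => //.
- exact: itv_weight_ge0.
- exact: itv_ind_ge0.
- by apply: measurable_itv_ind; [exact: measurable_snd|exact: measurable_fst].
- exact: integral_itv_ind.
- exact: integral_itv_ind.
Qed.

Let measurable_energy_integrand (m1 m2 : probability R R) :
  measurable_fun setT (fun z => (itv_weight z * (itv_mass m1 z * itv_mass m2 z))%:E).
Proof.
apply/measurable_EFinP/measurable_funM; first exact: measurable_itv_weight.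
by apply: measurable_funM; exact: measurable_itv_mass.
Qed.

Let energy_integrand_ge0 (m1 m2 : probability R R) z :
  0 <= (itv_weight z * (itv_mass m1 z * itv_mass m2 z))%:E.
Proof.
rewrite lee_fin; apply: mulr_ge0; first exact: itv_weight_ge0.
by apply: mulr_ge0; exact: itv_mass_ge0.
Qed.

Lemma mutual_energy_ge0 m1 m2 : 0 <= mutual_energy m1 m2.
Proof. by rewrite mutual_energyE; apply: integral_ge0 => z _; exact: energy_integrand_ge0. Qed.

(** The energy of the signed measure m1 - m2, written as an integral of squares so that no infinite
    energies are subtracted. *)
Definition energy_gap (m1 m2 : probability R R) :=
  \int[plane_measure]_z (itv_weight z * (itv_mass m1 z - itv_mass m2 z) ^+ 2)%:E.

Let measurable_gap_integrand (m1 m2 : probability R R) :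
  measurable_fun setT (fun z => (itv_weight z * (itv_mass m1 z - itv_mass m2 z) ^+ 2)%:E).
Proof.
apply/measurable_EFinP/measurable_funM; first exact: measurable_itv_weight.
by apply/measurable_funX/measurable_funB; exact: measurable_itv_mass.
Qed.

Let gap_integrand_ge0 (m1 m2 : probability R R) z :
  0 <= (itv_weight z * (itv_mass m1 z - itv_mass m2 z) ^+ 2)%:E.
Proof. by rewrite lee_fin mulr_ge0 ?itv_weight_ge0 ?sqr_ge0. Qed.

Lemma energy_gap_ge0 m1 m2 : 0 <= energy_gap m1 m2.
Proof. by apply: integral_ge0 => z _; exact: gap_integrand_ge0. Qed.

(** Pointwise p^2 + r^2 = 2 p r + (p - r)^2; the statement is additive because each energy may be
    +oo. *)
Lemma energy_polarization m1 m2 :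
  mutual_energy m1 m1 + mutual_energy m2 m2 =
  mutual_energy m1 m2 + mutual_energy m1 m2 + energy_gap m1 m2.
Proof.
have D (h1 h2 : R * R -> \bar R) : measurable_fun setT h1 -> measurable_fun setT h2 ->
    (forall z, 0 <= h1 z) -> (forall z, 0 <= h2 z) ->
    \int[plane_measure]_z h1 z + \int[plane_measure]_z h2 z =
    \int[plane_measure]_z (h1 z + h2 z).
  by move=> mh1 mh2 h10 h20; rewrite ge0_integralD.
rewrite !mutual_energyE /energy_gap.
have m12 := measurable_energy_integrand m1 m2.
rewrite (D _ _ (measurable_energy_integrand m1 m1) (measurable_energy_integrand m2 m2)
  (energy_integrand_ge0 m1 m1) (energy_integrand_ge0 m2 m2)).
rewrite (D _ _ m12 m12 (energy_integrand_ge0 m1 m2) (energy_integrand_ge0 m1 m2)).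
rewrite (D _ _ (emeasurable_funD m12 m12) (measurable_gap_integrand m1 m2) _
  (gap_integrand_ge0 m1 m2)); last first.
  by move=> z; apply: adde_ge0; exact: energy_integrand_ge0.
by apply: eq_integral => z _; rewrite -!EFinD; congr EFin; ring.
Qed.

End RieszEnergy.

(** * A vanishing energy gap forces equality of the measures *)

Section EnergyUniqueness.
Local Open Scope ereal_scope.
Context {R : realType}.
Local Notation mu := (@lebesgue_measure R).
Variable s : R.
Hypothesis s0 : (0 < s)%R.

Lemma lebesgue_measure_itvoo_gt0 (a b : R) : (a < b)%R ->
  0 < lebesgue_measure (`]a, b[%classic : set R).
Proof. by move=> ab; rewrite lebesgue_measure_itv/= lte_fin ab -EFinB lte_fin subr_gt0. Qed.

(** An open rectangle has positive area, so no null set contains it; this supplies intervals whose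
    endpoints are prescribed up to an arbitrary error. *)
Lemma exists_in_rectangle (P : R * R -> Prop) (a b c d : R) :
  {ae (@plane_measure R), forall z, P z} -> (a < b)%R -> (c < d)%R ->
  exists z, [/\ (a < z.1 < b)%R, (c < z.2 < d)%R & P z].
Proof.
move=> [N [mN N0 PN]] ab cd; apply: contrapT => nP.
have sub : `]a, b[%classic `*` `]c, d[%classic `<=` N.
  move=> z [/= zab zcd]; apply: PN => /= Pz; apply: nP; exists z.
  by move: zab zcd; rewrite !in_itv/= => -> ->.
have mX : measurable (`]a, b[%classic `*` `]c, d[%classic : set (R * R)).
  by apply: measurableX; exact: measurable_itv.
have : (mu \x mu) (`]a, b[%classic `*` `]c, d[%classic) <= 0.
  by rewrite -N0; apply: le_measure => //; rewrite inE.
rewrite leNgt => /negP; apply.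
rewrite product_measure1E; [|exact: measurable_itv|exact: measurable_itv].
by apply: mule_gt0; exact: lebesgue_measure_itvoo_gt0.
Qed.

Lemma energy_gap_ae (m1 m2 : probability R R) : energy_gap s m1 m2 = 0 ->
  {ae (@plane_measure R), forall z, (z.1 < z.2)%R -> itv_mass m1 z = itv_mass m2 z}.
Proof.
move=> E0.
have mf : measurable_fun setT
    (fun z => (itv_weight s z * (itv_mass m1 z - itv_mass m2 z) ^+ 2)%:E).
  apply/measurable_EFinP/measurable_funM; first exact: measurable_itv_weight.
  by apply/measurable_funX/measurable_funB; exact: measurable_itv_mass.
have : \int[@plane_measure R]_z `|(itv_weight s z * (itv_mass m1 z - itv_mass m2 z) ^+ 2)%:E| = 0.
  rewrite -E0; apply: eq_integral => z _; rewrite gee0_abs// lee_fin.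
  by rewrite mulr_ge0 ?itv_weight_ge0 ?sqr_ge0.
move/(ae_eq_integral_abs (@plane_measure R) measurableT mf).
apply: filterS => z /(_ I)/= [] /eqP; rewrite mulf_eq0 sqrf_eq0 subr_eq0.
case/orP => /eqP// w0 zz; suff : (0 < itv_weight s z)%R by rewrite w0 ltxx.
by rewrite /itv_weight !mulr_gt0 ?pw_gt0 ?subr_gt0// addr_gt0.
Qed.

(** The index n.+2 keeps the shrunken endpoints in order: they meet at n = 0. *)
Lemma itvoo_shrink_cvg (m : probability R R) (a b : R) : (a < b)%R ->
  m `](a + (b - a) / n.+2%:R)%R, (b - (b - a) / n.+2%:R)%R[%classic @[n --> \oo]
    --> m `]a, b[%classic.
Proof.
move=> ab.
have ba : (0 < b - a)%R by rewrite subr_gt0.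
have le n k : (n <= k)%N -> ((b - a) / k.+2%:R <= (b - a) / n.+2%:R)%R.
  by move=> nk; rewrite ler_pM2l// lef_pV2 ?posrE// ler_nat !ltnS.
have E : \bigcup_n `](a + (b - a) / n.+2%:R)%R, (b - (b - a) / n.+2%:R)%R[%classic =
    `]a, b[%classic :> set R.
  apply/seteqP; split => x /=.
    case=> n _; rewrite /= !in_itv/= => /andP[ax xb].
    rewrite (le_lt_trans _ ax) ?lerDl ?divr_ge0 ?(ltW ba)//=.
    by rewrite (lt_le_trans xb)// gerBl divr_ge0// ltW.
  rewrite in_itv/= => /andP[ax xb].
  pose d := Num.min (x - a)%R (b - x)%R.
  have d0 : (0 < d)%R by rewrite lt_min !subr_gt0 ax xb.
  have := archi_boundP (divr_ge0 (ltW ba) (ltW d0)).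
  set n := Num.bound _ => Hn; exists n => //=.
  have Hd : ((b - a) / n.+2%:R < d)%R.
    rewrite ltr_pdivrMr// mulrC -ltr_pdivrMr// (lt_le_trans Hn)// ler_nat.
    exact: ltnW (leqnSn n.+1).
  move: Hd; rewrite lt_min => /andP[h1 h2]; rewrite in_itv/=.
  by rewrite -ltrBrDl h1 /= ltrBrDr -ltrBrDl.
rewrite -E; apply: nondecreasing_cvg_mu.
- by move=> n; exact: measurable_itv.
- by rewrite E; exact: measurable_itv.
- move=> n k nk; rewrite subsetEset => x; rewrite /= !in_itv/= => /andP[h1 h2].
  rewrite (le_lt_trans _ h1) ?lerD2l ?le//=.
  by rewrite (lt_le_trans h2)// lerD2l lerN2 le.
Qed.

(** The interval masses agree only for almost every pair of endpoints. A good pair between the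
    shrunken and the original interval bounds n1 of the former by n2 of the latter; the shrinking is
    undone in the limit, and symmetry gives equality. *)
Lemma energy_gap_eq0 (m1 m2 : probability R R) : energy_gap s m1 m2 = 0 ->
  forall A, measurable A -> m1 A = m2 A.
Proof.
have half (n1 n2 : probability R R) (a b : R) : energy_gap s n1 n2 = 0 -> (a < b)%R ->
    n1 `]a, b[%classic <= n2 `]a, b[%classic.
  move=> E0 ab; have cv := @itvoo_shrink_cvg n1 a b ab; rewrite -(cvg_lim _ cv)//.
  apply: lime_le; first by apply/cvg_ex; eexists; exact: cv.
  apply: nearW => n.
  have d0 : (0 < (b - a) / n.+2%:R)%R by rewrite divr_gt0// subr_gt0.
  have := energy_gap_ae E0.
  move=> /(@exists_in_rectangle _ a (a + (b - a) / n.+2%:R)%R (b - (b - a) / n.+2%:R)%R b).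
  rewrite ltrDl gtrBl => /(_ d0 d0)[z [/andP[az za] /andP[bz zb]]] H.
  have lt : (a + (b - a) / n.+2%:R <= b - (b - a) / n.+2%:R)%R.
    have : ((b - a) / n.+2%:R * n%:R + (b - a) / n.+2%:R * 2 = b - a)%R.
      by rewrite -mulrDr -natrD addn2 divfK.
    have : (0 <= (b - a) / n.+2%:R * n%:R)%R by rewrite mulr_ge0 ?(ltW d0).
    by move: (_ / _)%R => d; lra.
  have {}H := H (lt_trans za (le_lt_trans lt bz)).
  have {}H : n1 `]z.1, z.2[%classic = n2 `]z.1, z.2[%classic.
    have := congr1 EFin H; rewrite /itv_mass !fineK//; exact: fin_num_measure.
  apply: (@le_trans _ _ (n1 `]z.1, z.2[%classic)).
    apply: le_measure; rewrite ?inE; [exact: measurable_itv|exact: measurable_itv|].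
    move=> x /=; rewrite !in_itv/= => /andP[h1 h2].
    by rewrite (lt_trans za h1) (lt_trans h2 bz).
  rewrite H; apply: le_measure; rewrite ?inE; [exact: measurable_itv|exact: measurable_itv|].
  move=> x /=; rewrite !in_itv/= => /andP[h1 h2].
  by rewrite (lt_trans az h1) (lt_trans h2 zb).
move=> E0; apply: probability_eq_itvoo => a b.
have [ab|ba] := ltP a b; last by rewrite set_itv_ge -?leNgt// !measure0.
apply/le_anti; rewrite !half//.
rewrite -E0; apply: eq_integral => z _; congr (_ * _)%:E.
by rewrite -sqrrN opprB.
Qed.

End EnergyUniqueness.

(** * From the Frostman conditions to the unique minimizer *)

Section Variational.
Local Open Scope ereal_scope.
Context {R : realType}.

Lemma riesz_kernel_ge0 (s x y : R) : 0 <= riesz_kernel s x y.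
Proof. by rewrite /riesz_kernel; case: ifP; rewrite ?leey// lee_fin powR_ge0. Qed.

Lemma measurable_riesz_kernel (s : R) :
  measurable_fun setT (fun z : R * R => riesz_kernel s z.1 z.2).
Proof.
rewrite /riesz_kernel; apply: measurable_fun_ifT.
- by apply: measurable_fun_eqr; [exact: measurable_fst|exact: measurable_snd].
- exact: measurable_cst.
- apply/measurable_EFinP; apply: (measurableT_comp (measurable_powR _)).
  by mfun.
Qed.

Variables s q b : R.
Hypotheses (s0 : (0 < s)%R) (q0 : (0 < q)%R) (b0 : (0 < b)%R).

Let g (x : R) : R := (q * pw (- (s / 2)) (x ^+ 2 + b ^+ 2))%R.

(** The integral is finite, as g = - Q lies between 0 and q b^(-s). *)
Definition field_mass (nu : probability R R) : R := fine (\int[nu]_x (g x)%:E).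

Let g_ge0 x : (0 <= g x)%R. Proof. by rewrite mulr_ge0 ?pw_ge0// ltW. Qed.

Let mg : measurable_fun setT g. Proof. by rewrite /g; mfun. Qed.

Let g_le x : (g x <= q * pw (- (s / 2)) (b ^+ 2))%R.
Proof.
rewrite ler_pM2l// !pwN ?exprn_gt0 ?ltr_wpDl ?sqr_ge0// ?exprn_gt0//.
rewrite lef_pV2 ?posrE ?pw_gt0 ?exprn_gt0 ?ltr_wpDl ?sqr_ge0 ?exprn_gt0//.
by rewrite pw_le ?divr_ge0 ?(ltW s0)// lerDr sqr_ge0.
Qed.

Lemma integral_field (nu : probability R R) : \int[nu]_x (g x)%:E = (field_mass nu)%:E.
Proof.
rewrite /field_mass fineK// ge0_fin_numE; last by apply: integral_ge0 => x _; rewrite lee_fin.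
apply: (@le_lt_trans _ _ (\int[nu]_x (cst (q * pw (- (s / 2)) (b ^+ 2))%R%:E x))).
  apply: ge0_le_integral => //.
  - by move=> x _; rewrite lee_fin.
  - exact/measurable_EFinP.
  - by move=> x _; rewrite lee_fin.
by rewrite integral_cst//= probability_setT mule1 ltry.
Qed.

Lemma riesz_energyE (nu : probability R R) :
  riesz_energy s q b nu = mutual_energy s nu nu + (- (2 * field_mass nu))%:E.
Proof.
rewrite /riesz_energy /mutual_energy; congr (_ + _).
transitivity (2%:E * - (\int[nu]_x (g x)%:E)).
  congr (_ * _); rewrite -integral_ge0N; last by move=> x _; rewrite lee_fin.
  apply: eq_integral => x _; rewrite -EFinN; congr EFin.
  by rewrite /extQ /g mulNr pwE// ltr_wpDl ?sqr_ge0// exprn_gt0.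
by rewrite integral_field -EFinN -EFinM mulrN.
Qed.

(** The Frostman inequality is assumed everywhere, the equality only after integration against m.
    Integrating the inequality against nu and inserting it in the polarization identity gives E(nu)
    >= E(m) + gap(nu, m): minimality, and uniqueness since a second minimizer has zero gap. *)
Lemma equilibrium_characterization (m : probability R R) (f : R) : (0 <= f)%R ->
  (forall x, (g x)%:E <= \int[m]_y riesz_kernel s x y + f%:E) ->
  mutual_energy s m m + f%:E = (field_mass m)%:E ->
  is_equilibrium s q b m /\
  forall nu, is_equilibrium s q b nu -> forall A, measurable A -> nu A = m A.
Proof.
move=> f0 gle E.
have [e eE] : exists e : R, mutual_energy s m m = e%:E.
  move: E; case: (mutual_energy s m m) (mutual_energy_ge0 s0 m m) => [r _ _|//|//].
  by exists r.
move: E; rewrite eE -EFinD => -[E].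
have mp : measurable_fun setT (fun x => \int[m]_y riesz_kernel s x y).
  apply: measurable_integral_snd => /=; first exact: measurable_riesz_kernel.
  exact: riesz_kernel_ge0.
have Gle (nu : probability R R) : (field_mass nu)%:E <= mutual_energy s nu m + f%:E.
  rewrite -integral_field.
  apply: (@le_trans _ _ (\int[nu]_x (\int[m]_y riesz_kernel s x y + (cst f%:E) x))).
    apply: ge0_le_integral; [by []|by move=> x _; rewrite lee_fin|exact/measurable_EFinP|
      |by move=> x _; exact: gle].
    by apply: emeasurable_funD => //; exact: measurable_cst.
  rewrite ge0_integralD//.
  - by rewrite integral_cst//= probability_setT mule1.
  - by move=> x _; apply: integral_ge0 => y _; exact: riesz_kernel_ge0.
(* With e = I(m, m), the hypotheses give E(m) = e - 2 (e + f) = - e - 2 f. If I(nu, nu) is infinite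
   there is nothing to prove; otherwise every term is finite and the inequality is linear. *)
have key (nu : probability R R) :
    riesz_energy s q b m + energy_gap s nu m <= riesz_energy s q b nu.
  rewrite !riesz_energyE eE -EFinD.
  have := energy_polarization s0 nu m; have := Gle nu.
  have := mutual_energy_ge0 s0 nu nu; have := mutual_energy_ge0 s0 nu m.
  have := energy_gap_ge0 s0 nu m; rewrite eE.
  case: (mutual_energy s nu nu) => [E1| |] //; last by move=> *; rewrite leey.
  case: (mutual_energy s nu m) => [I| |] //; case: (energy_gap s nu m) => [h| |] // h0 I0 E10.
  rewrite -!EFinD !lee_fin => Hg [] HE; lra.
split=> [nu|nu Hnu].
  apply: le_trans (key nu); rewrite leeDl// energy_gap_ge0//.
apply: (energy_gap_eq0 s0); apply/le_anti; rewrite energy_gap_ge0// andbT.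
have := le_trans (key nu) (Hnu m); rewrite riesz_energyE eE -EFinD.
case: (energy_gap s nu m) (energy_gap_ge0 s0 nu m) => [h| |] // h0.
by rewrite -EFinD !lee_fin gerDl.
Qed.

End Variational.

(** * The density of the truncated mixture *)

Section EquilibriumDensity.
Local Open Scope ereal_scope.
Context {R : realType}.
Local Notation mu := (@lebesgue_measure R).
Variables s : R.
Hypotheses (s0 : (0 < s)%R) (s1 : (s < 1)%R).

Let hm0 : (0 < (1 - s) / 2)%R. Proof. by rewrite divr_gt0 ?subr_gt0. Qed.
Let hp0 : (0 < (1 + s) / 2)%R. Proof. by rewrite divr_gt0 ?addr_gt0. Qed.
Let hc0 : (0 < 1 - s / 2)%R. Proof. by rewrite subr_gt0 ltr_pdivrMr// mul1r (lt_trans s1)// ltr1n. Qed.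

(** [Ia] with A = a^2 + b^2 and d = a^2 - x^2; the endpoint value I_a(a) is d = 0. *)
Let eIa (A d : R) : \bar R :=
  \int[mu]_u (pw ((1 - s) / 2) u * pw (s / 2 - 1) (u + A) * pw (- 1) (u + d))%:E.

Let IaE (b a x : R) : (0 < b)%R -> (x ^+ 2 <= a ^+ 2)%R ->
  Ia s b a x = fine (eIa (a ^+ 2 + b ^+ 2) (a ^+ 2 - x ^+ 2)).
Proof.
move=> b0 xa; congr fine; apply: integral_mkbool => u.
rewrite mem_setE in_itv/= andbT; case: ifP => u0; last first.
  by rewrite (pw_le0 _ _) ?mul0r// leNgt u0.
rewrite !addrA pwE//.
have A0 : (0 < u + a ^+ 2 + b ^+ 2)%R by rewrite ltr_wpDl ?exprn_gt0 ?addr_ge0 ?sqr_ge0// ltW.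
have d0 : (0 < u + a ^+ 2 - x ^+ 2)%R by rewrite -addrA ltr_pwDl// subr_ge0.
rewrite pwN// pw1// (_ : (s / 2 - 1 = - (1 - s / 2))%R); last by ring.
by rewrite pwN// pwE.
Qed.

(** 1/u - 1/(u + d) = d / (u (u + d)), arranged as a sum because the integrals are not yet known to
    be finite. *)
Let eIa_diff (A d : R) : (0 < A)%R -> (0 < d)%R ->
  eIa A 0 = eIa A d +
   \int[mu]_u (d * (pw (- ((1 + s) / 2)) u * pw (s / 2 - 1) (u + A) * pw (- 1) (u + d)))%:E.
Proof.
move=> A0 d0; rewrite /eIa -ge0_integralD; [|by []|by pos|by mfun|by pos|by mfun].
apply: eq_integral => u _; rewrite -EFinD; congr EFin; rewrite addr0.
have [u0|u0] := ltP 0%R u; last by rewrite !(pw_le0 _ u0) !mul0r mulr0 addr0.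
rewrite (_ : ((1 - s) / 2 = - ((1 + s) / 2) + 1)%R); last by field.
rewrite pwD !pwN ?addr_gt0// !pw1 ?addr_gt0//.
by field; rewrite !gt_eqF ?addr_gt0 ?pw_gt0.
Qed.

(** Scaling by A makes I_a(a) a Beta integral; its finiteness is what later permits subtraction. *)
Let eIa0 (A : R) : (0 < A)%R -> eIa A 0 < +oo.
Proof.
move=> A0.
rewrite /eIa (ge0_integral_scale A0); [|by mfun|by pos].
have -> : \int[mu]_u (pw ((1 - s) / 2) (A * u) * pw (s / 2 - 1) (A * u + A) * pw (- 1) (A * u + 0))%:E
   = \int[mu]_u (pw ((1 - s) / 2) A * pw (s / 2 - 1) A * pw (- 1) A *
      (pw ((1 - s) / 2 - 1) u * pw (- ((1 - s) / 2 + 2^-1)) (1 + u)))%:E.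
  apply: eq_integral => u _; congr EFin.
  rewrite addr0 (_ : (A * u + A = A * (1 + u))%R); last by ring.
  rewrite !pwM// (pwD ((1 - s) / 2) (- 1)) (_ : (- ((1 - s) / 2 + 2^-1) = s / 2 - 1)%R); last by field.
  by ring.
rewrite ge0_integralcMl; [|by pos|by mfun|by pos].
by rewrite -/(ebetaoo _ _) ebetaooE// ?invr_gt0// -!EFinM ltry.
Qed.

(** With k = x^2 + b^2 and d = a^2 - x^2 this is, up to the factor C, the density at x of the
    dropped part t > a^2, in the variable y = t - x^2. *)
Let tail (k d : R) : \bar R :=
  \int[mu]_y (pw ((s - 1) / 2) y * pw (- (3 / 2)) (y + k) * (d < y)%R%:R)%:E.

Let integral_shifted_beta (k y : R) : (0 < k)%R -> (0 < y)%R ->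
  \int[mu]_v (pw (- ((1 + s) / 2)) v * pw (s / 2 - 2) (y * (v + 1) + k))%:E =
  (pw ((s - 1) / 2) y * pw (- (3 / 2)) (y + k))%:E * ebetaoo ((1 - s) / 2) (3 / 2).
Proof.
move=> k0 y0; have yk0 : (0 < y + k)%R by rewrite addr_gt0.
have c0 : (0 < (y + k) / y)%R by rewrite divr_gt0.
rewrite (ge0_integral_scale c0); [|by mfun|by pos].
have -> : \int[mu]_v (pw (- ((1 + s) / 2)) ((y + k) / y * v) *
      pw (s / 2 - 2) (y * ((y + k) / y * v + 1) + k))%:E
   = \int[mu]_v (pw (- ((1 + s) / 2)) ((y + k) / y) * pw (s / 2 - 2) (y + k) *
      (pw ((1 - s) / 2 - 1) v * pw (- ((1 - s) / 2 + 3 / 2)) (1 + v)))%:E.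
  apply: eq_integral => v _; congr EFin.
  rewrite (_ : (y * ((y + k) / y * v + 1) + k = (y + k) * (1 + v))%R); last first.
    by field; rewrite gt_eqF.
  rewrite !pwM// ?divr_gt0// (_ : (- ((1 - s) / 2 + 3 / 2) = s / 2 - 2)%R); last by field.
  rewrite (_ : ((1 - s) / 2 - 1 = - ((1 + s) / 2))%R); last by field.
  by ring.
rewrite ge0_integralcMl; [|by pos|by mfun|by pos].
rewrite -/(ebetaoo _ _) muleA -EFinM; congr ((_)%:E * _).
rewrite -[X in (X * (_ * _))%R](pw1 c0) mulrA -pwD pwM ?invr_gt0// pw_inv// -pwN//.
by rewrite mulrAC -pwD mulrC; congr (pw _ _ * pw _ _)%R; field.
Qed.

(** It makes I_a(a) - I_a(x) a multiple of the dropped density. After u = d v, the factor (d (v + 1)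
    + k)^(s/2 - 1) / (v + 1) is 1 - s/2 times the integral of (y (v + 1) + k)^(s/2 - 2) over y > d;
    integrating over v first leads to [integral_shifted_beta]. *)
Let integral_tailE (k d : R) : (0 < k)%R -> (0 < d)%R ->
  \int[mu]_u (d * (pw (- ((1 + s) / 2)) u * pw (s / 2 - 1) (u + (d + k)) * pw (- 1) (u + d)))%:E =
  (pw ((1 - s) / 2) d * (1 - s / 2))%:E * (tail k d * ebetaoo ((1 - s) / 2) (3 / 2)).
Proof.
move=> k0 d0.
have hc0' := ltW hc0.
transitivity ((pw ((1 - s) / 2) d * (1 - s / 2))%:E * \int[mu]_v \int[mu]_y
   (pw (- ((1 + s) / 2)) v * (pw (s / 2 - 2) (y * (v + 1) + k) * (d < y)%R%:R))%:E).
  rewrite (ge0_integral_scale d0); [|by mfun|by pos].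
  rewrite EFinM -muleA -[X in _ = _ * X]ge0_integralZl_EFin; last 4 first.
  - by [].
  - by move=> v _; apply: integral_ge0; pos.
  - by apply: measurable_integral_snd => /=; [mfun|pos].
  - exact: hc0'.
  have mJ : measurable_fun setT (fun v : R => (pw (- ((1 + s) / 2)) v *
      (pw (s / 2 - 1) (d * (v + 1) + k) * pw (- 1) (v + 1)))%R) by mfun.
  transitivity (d%:E * \int[mu]_v (pw ((1 - s) / 2 - 1) d * (pw (- ((1 + s) / 2)) v *
      (pw (s / 2 - 1) (d * (v + 1) + k) * pw (- 1) (v + 1))))%:E).
    congr (_ * _); apply: eq_integral => v _; congr EFin.
    rewrite (_ : (d * v + (d + k) = d * (v + 1) + k)%R); last by ring.
    rewrite (_ : (d * v + d = d * (v + 1))%R); last by ring.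
    rewrite !pwM// (_ : ((1 - s) / 2 - 1 = - ((1 + s) / 2))%R); last by field.
    by rewrite (pwN 1 d0) (pw1 d0); field; rewrite gt_eqF.
  rewrite ge0_integralcMl; [|by pos|exact: mJ|by pos].
  rewrite muleA -EFinM; congr ((_)%:E * _).
    by rewrite -{1}(pw1 d0) -pwD; congr pw; field.
  apply: eq_integral => v _.
  have [v0|v0] := ltP 0%R v; last first.
    rewrite (pw_le0 _ v0) mul0r (_ : \int[mu]_y _ = 0) ?mule0//.
    by apply: integral0_eq => y _; rewrite mul0r.
  have v10 : (0 < v + 1)%R by rewrite addr_gt0.
  rewrite ge0_integralcMl; [|by pos|by mfun|by pos].
  have -> : \int[mu]_y (pw (s / 2 - 2) (y * (v + 1) + k) * (d < y)%R%:R)%:E =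
      (`|v + 1|^-1)%:E * (pw (- (1 - s / 2)) (d * (v + 1) + k) / (1 - s / 2))%:E.
    rewrite -(integral_pw_tail hc0); last by rewrite addr_gt0 ?mulr_gt0.
    rewrite -(@ge0_integral_affine R (v + 1) k (fun w => (pw (- (1 - s / 2) - 1) w *
      (d * (v + 1) + k < w)%R%:R)%:E) (lt0r_neq0 v10)); [|by mfun|by pos].
    apply: eq_integral => y _; rewrite ltrD2r [((v + 1) * y)%R]mulrC ltr_pM2r//.
    by congr (pw _ _ * _)%:E; ring.
  rewrite -!EFinM gtr0_norm// (_ : (- (1 - s / 2) = s / 2 - 1)%R); last by ring.
  rewrite (pwN 1 v10) (pw1 v10); congr EFin.
  move: (pw (s / 2 - 1) _) (pw (- _) v) (1 - s / 2)%R (lt0r_neq0 hc0) => A B e en.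
  by field; rewrite en gt_eqF.
congr (_ * _); rewrite tonelli/=; [|by mfun|by pos].
rewrite /tail -ge0_integralZrE; [|exact: ebetaoo_ge0|by mfun|by pos].
apply: eq_integral => y _.
have [dy|dy] := ltP d y; last first.
  by rewrite mulr0 mul0e; apply: integral0_eq => v _; rewrite !mulr0.
rewrite mulr1 -integral_shifted_beta// ?(lt_trans d0)//.
by apply: eq_integral => v _; rewrite mulr1.
Qed.

Variables (q b : R).
Hypotheses (q0 : (0 < q)%R) (b0 : (0 < b)%R).

(** Chosen so that 2 C K b^(s-1) = q, the coefficient in [mix_pot_full]. *)
Definition mix_const : R := (q * pw (1 - s) b / (2 * riesz_const s))%R.
Local Notation C := mix_const.

Lemma mix_const_gt0 : (0 < C)%R.
Proof. by rewrite !mulr_gt0 ?invr_gt0 ?pw_gt0// mulr_gt0// riesz_const_gt0. Qed.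

Let mix_density_full (x : R) : mix_density s (full_weight b C) x =
  (C * pw (s / 2 - 1) (x ^+ 2 + b ^+ 2))%:E * ebetaoo ((1 + s) / 2) (1 - s / 2).
Proof.
have C0 := mix_const_gt0.
have A0 : (0 < x ^+ 2 + b ^+ 2)%R by rewrite ltr_wpDl ?sqr_ge0// exprn_gt0.
rewrite /mix_density /full_weight (ge0_integral_shift (x ^+ 2)%R); [|by mfun|by pos].
have -> : \int[mu]_t (C * pw (- (3 / 2)) (t + x ^+ 2 + b ^+ 2) *
      pw ((s - 1) / 2) (t + x ^+ 2 - x ^+ 2))%:E =
    \int[mu]_t (C * pw (- (3 / 2)) (t + (x ^+ 2 + b ^+ 2)) * pw ((s - 1) / 2) t)%:E.
  by apply: eq_integral => t _; rewrite addrK addrA.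
move: (x ^+ 2 + b ^+ 2)%R A0 => A A0.
rewrite (ge0_integral_scale A0); [|by mfun|by pos].
have -> : \int[mu]_t (C * pw (- (3 / 2)) (A * t + A) * pw ((s - 1) / 2) (A * t))%:E =
    \int[mu]_t (C * pw (- (3 / 2)) A * pw ((s - 1) / 2) A *
      (pw ((1 + s) / 2 - 1) t * pw (- ((1 + s) / 2 + (1 - s / 2))) (1 + t)))%:E.
  apply: eq_integral => t _; congr EFin.
  rewrite (_ : (A * t + A = A * (1 + t))%R); last by ring.
  rewrite !pwM// (_ : ((1 + s) / 2 - 1 = (s - 1) / 2)%R); last by field.
  rewrite (_ : (- ((1 + s) / 2 + (1 - s / 2)) = - (3 / 2))%R); last by field.
  by ring.
rewrite ge0_integralcMl; [|by pos|by mfun|by pos].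
rewrite -/(ebetaoo _ _) muleA -EFinM; congr ((_)%:E * _).
have -> : (pw (s / 2 - 1) A = pw 1 A * pw (- (3 / 2)) A * pw ((s - 1) / 2) A)%R.
  by rewrite -!pwD; congr pw; field.
by rewrite pw1//; ring.
Qed.

Let mix_density_high (T x : R) : mix_density s (high_weight b C T) x =
  C%:E * tail (x ^+ 2 + b ^+ 2) (T - x ^+ 2).
Proof.
have C0 := mix_const_gt0.
rewrite /mix_density /high_weight /full_weight /tail (ge0_integral_shift (x ^+ 2)%R);
  [|by mfun|by pos].
rewrite -ge0_integralcMl; [|by pos|by mfun|by pos].
apply: eq_integral => t _; rewrite addrK addrA ltrBlDr; congr EFin; ring.
Qed.

Lemma GammafS_half : Gammaf (3 / 2) = (Num.sqrt pi / 2)%R :> R.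
Proof.
rewrite (_ : (3 / 2 = 2^-1 + 1)%R); last by field.
by rewrite GammafD1 ?invr_gt0// Gammaf_half mulrC.
Qed.

(** Full density minus dropped density: the full mixture scales to the first term of [eq_density],
    and [integral_tailE] turns the dropped part into the term with I_a. *)
Lemma mix_density_low (a x : R) : (0 < a)%R -> (x ^+ 2 < a ^+ 2)%R ->
  mix_density s (low_weight b C (a ^+ 2)%R) x = (eq_density s q b a x)%:E.
Proof.
move=> a0 xa; have C0 := mix_const_gt0.
have d0 : (0 < a ^+ 2 - x ^+ 2)%R by rewrite subr_gt0.
have k0 : (0 < x ^+ 2 + b ^+ 2)%R by rewrite ltr_wpDl ?sqr_ge0// exprn_gt0.
have A0 : (0 < a ^+ 2 + b ^+ 2)%R by rewrite ltr_wpDl ?sqr_ge0// exprn_gt0.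
have L0 t : (0 <= low_weight b C (a ^+ 2)%R t)%R by exact: low_weight_ge0.
have H0 t : (0 <= high_weight b C (a ^+ 2)%R t)%R by exact: high_weight_ge0.
have mF : measurable_fun setT (full_weight b C) by exact: measurable_full_weight.
have mL : measurable_fun setT (low_weight b C (a ^+ 2)%R) by exact: measurable_low_weight.
have mH : measurable_fun setT (high_weight b C (a ^+ 2)%R) by exact: measurable_high_weight.
have : mix_density s (full_weight b C) x =
    mix_density s (low_weight b C (a ^+ 2)%R) x + mix_density s (high_weight b C (a ^+ 2)%R) x.
  apply: (@mix_density_split _ _ _ _ _ (a ^+ 2)%R) => // t; exact: full_weight_split.
rewrite mix_density_full mix_density_high.
have E := eIa_diff A0 d0.
have tE := integral_tailE k0 d0.
rewrite (_ : (a ^+ 2 - x ^+ 2 + (x ^+ 2 + b ^+ 2) = a ^+ 2 + b ^+ 2)%R) in tE; last by ring.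
rewrite {}tE in E.
have fin0 : eIa (a ^+ 2 + b ^+ 2) 0 \is a fin_num.
  by rewrite ge0_fin_numE ?eIa0//; apply: integral_ge0; pos.
have I1 : Ia s b a a = fine (eIa (a ^+ 2 + b ^+ 2) 0) by rewrite (IaE b0 (lexx _)) subrr.
have I2 : Ia s b a x = fine (eIa (a ^+ 2 + b ^+ 2) (a ^+ 2 - x ^+ 2)) by exact: (IaE b0 (ltW xa)).
have t0 : 0 <= tail (x ^+ 2 + b ^+ 2) (a ^+ 2 - x ^+ 2) by apply: integral_ge0; pos.
have e0 : 0 <= eIa (a ^+ 2 + b ^+ 2) (a ^+ 2 - x ^+ 2) by apply: integral_ge0; pos.
have m0 : 0 <= mix_density s (low_weight b C (a ^+ 2)%R) x by exact: mix_density_ge0.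
have hm32 : (0 < 3 / 2 :> R)%R by rewrite divr_gt0.
have [r r0 rE] : exists2 r : R, (0 < r)%R & Num.sqrt pi = r.
  by exists (Num.sqrt pi); rewrite ?sqrtr_gt0 ?pi_gt0.
have h20 : (0 < 2^-1 :> R)%R by rewrite invr_gt0.
have Gm := Gammaf_gt0 hm0; have Gp := Gammaf_gt0 hp0; have Gc := Gammaf_gt0 hc0.
have B1 : ebetaoo ((1 + s) / 2) (1 - s / 2) =
    (Gammaf ((1 + s) / 2) * Gammaf (1 - s / 2) / (r / 2))%:E.
  rewrite (ebetaooE hp0 hc0) (_ : ((1 + s) / 2 + (1 - s / 2) = 3 / 2)%R) ?GammafS_half ?rE//.
  by field.
have B2 : ebetaoo ((1 - s) / 2) (3 / 2) =
    (Gammaf ((1 - s) / 2) * (r / 2) / ((1 - s / 2) * Gammaf (1 - s / 2)))%:E.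
  rewrite (ebetaooE hm0 hm32) GammafS_half rE.
  rewrite (_ : ((1 - s) / 2 + 3 / 2 = 1 - s / 2 + 1)%R); last by field.
  by rewrite (GammafD1 hc0).
pose D := pw ((1 - s) / 2) (a ^+ 2 - x ^+ 2)%R.
have D0 : (0 < D)%R by rewrite pw_gt0.
(* The factor between I_a(a) - I_a(x) and [tail], once the Beta function of [integral_tailE] is
   evaluated. *)
pose k := (D * Gammaf ((1 - s) / 2) * r / (2 * Gammaf (1 - s / 2)))%R.
have kk : (0 < k)%R.
  exact: divr_gt0 (mulr_gt0 (mulr_gt0 D0 Gm) r0) (mulr_gt0 (ltr0Sn R 1) Gc).
have {}E : eIa (a ^+ 2 + b ^+ 2) 0 = eIa (a ^+ 2 + b ^+ 2) (a ^+ 2 - x ^+ 2) +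
    k%:E * tail (x ^+ 2 + b ^+ 2) (a ^+ 2 - x ^+ 2).
  rewrite E B2 [tail _ _ * _]muleC muleA -EFinM; congr (_ + _%:E * _).
  rewrite -/D /k; move: (1 - s / 2)%R (lt0r_neq0 hc0) Gc => e en Gc.
  by field; rewrite en gt_eqF.
have E1 : Betaf (1 / 2) ((1 - s) / 2) = (r * Gammaf ((1 - s) / 2) / Gammaf (1 - s / 2))%R.
  rewrite mul1r (BetafE h20 hm0) Gammaf_half rE.
  by rewrite (_ : (2^-1 + (1 - s) / 2 = 1 - s / 2)%R)//; field.
have E2 : Betaf ((1 + s) / 2) ((1 - s) / 2) = riesz_const s.
  rewrite (BetafE hp0 hm0) (_ : ((1 + s) / 2 + (1 - s) / 2 = 1)%R); last by field.
  by rewrite Gammaf1 divr1 mulrC.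
rewrite /eq_density E1 E2 I1 I2 -!pwE// B1.
rewrite (_ : (s / 2 - 1 = - (1 - s / 2))%R); last by ring.
rewrite pwN// -/D /mix_const /riesz_const.
move: E fin0 t0 e0 m0.
move: (eIa _ 0) (eIa _ (a ^+ 2 - x ^+ 2)%R) (tail _ _) (mix_density _ _ _).
move: (Gammaf _) (Gammaf _) (Gammaf _) Gm Gp Gc @k kk => g2 gp gm Gm Gp G2 k kk.
move=> e1 e2 t m E fin0 t0 e0 m0.
(* I_a(a) is finite and at least k times the tail with k > 0, so the tail is finite too. *)
have tf : t \is a fin_num.
  rewrite ge0_fin_numE// ltey; apply/eqP => ty; move: fin0; rewrite E ty gt0_muley ?lte_fin//.
  by case: e2 e0 E.
move: E; case: t tf t0 => // t _ t0; case: e1 fin0 => // i1 _.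
case: e2 e0 => [i2| |] // i20; rewrite -EFinM -EFinD => -[E].
case: m m0 => [m| |] // m0; rewrite -!EFinM -EFinD => -[H]; congr EFin.
rewrite /= {}E (addrC i2) addrK.
have P0 : (0 < pw (1 - s / 2) (x ^+ 2 + b ^+ 2))%R by rewrite pw_gt0.
move: (pw (1 - s / 2) _) (pw (1 - s) b) P0 H => P B P0 H.
(* The added term is the dropped density, so both sides become the density of the full mixture. *)
apply: (addIr (q * B / (2 * (gm * gp)) * t)%R); rewrite -H /k; field.
by rewrite !gt_eqF.
Qed.

End EquilibriumDensity.

(** * Termwise differentiation inside the unit disc *)

Section PowerSeries.
Context {R : realType}.
Implicit Types (f : R^nat) (x z : R).

Lemma cvg_pseries_bounded f z : (forall n, `|f n| <= 1) -> `|z| < 1 -> cvgn (pseries f z).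
Proof.
move=> f1 z1; apply: normed_cvg; apply: (@series_le_cvg _ _ (fun n => `|z| ^+ n)).
- by move=> n /=.
- by move=> n; rewrite exprn_ge0.
- by move=> n /=; rewrite normrM normrX ler_piMl ?exprn_ge0.
rewrite (_ : (fun n => _) = geometric 1 `|z|); last by apply/funext => n /=; rewrite mul1r.
by apply: is_cvg_geometric_series; rewrite normr_id.
Qed.

(* With |z / x| = sigma^2, the bound (n + 1) sigma^n <= 1 / (1 - sigma) leaves a geometric series. *)
Lemma cvg_pseries_diffs_inside f x z : cvgn (pseries f x) -> `|z| < `|x| ->
  cvgn (pseries (pseries_diffs f) z).
Proof.
move=> Cx zx; have [K [_ Kf]] := cvg_series_bounded Cx.
have x0 : 0 < `|x| by rewrite (le_lt_trans _ zx).
pose sg := Num.sqrt (`|z| / `|x|).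
have r0 : 0 <= `|z| / `|x| by rewrite divr_ge0.
have sg2 : sg ^+ 2 = `|z| / `|x| by rewrite sqr_sqrtr.
have sg0 : 0 <= sg by rewrite sqrtr_ge0.
have sg1 : sg < 1.
  by rewrite -(@ltr_pXn2r _ 2)// ?nnegrE// expr1n sg2 ltr_pdivrMr// mul1r.
have M0 n : `|f n * x ^+ n| <= `|K + 1|.
  by apply: Kf => //; rewrite (lt_le_trans _ (ler_norm _))// ltrDl.
have geo n : n.+1%:R * sg ^+ n <= (1 - sg)^-1.
  rewrite -[leRHS]mul1r ler_pdivlMr ?subr_gt0//.
  apply: (@le_trans _ _ (1 - sg ^+ n.+1)); last by rewrite gerBl exprn_ge0.
  rewrite -[1 in X in _ <= X](expr1n _ n.+1) subrXX mulrC ler_wpM2l ?subr_ge0 ?(ltW sg1)//.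
  rewrite -[n.+1 in leLHS]card_ord mulr_natl -sumr_const ler_sum// => i _.
  by rewrite expr1n mul1r ler_wiXn2l// ?ltW// -ltnS.
apply: normed_cvg.
apply: (@series_le_cvg _ _ (geometric (`|K + 1| / `|x| / (1 - sg)) sg)).
- by move=> n /=.
- by move=> n /=; rewrite !mulr_ge0 ?invr_ge0 ?exprn_ge0 ?subr_ge0 ?(ltW sg1).
- move=> n /=; rewrite /pseries_diffs !normrM normr_nat normrX.
  have -> : `|z| = `|x| * sg ^+ 2 by rewrite sg2 mulrC divfK ?gt_eqF.
  rewrite exprMn -exprM mul2n -addnn exprD.
  have := M0 n.+1; rewrite normrM normrX exprSr => Hn.
  have Hn' : `|f n.+1| * `|x| ^+ n <= `|K + 1| / `|x| by rewrite ler_pdivlMr// -mulrA.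
  have -> : n.+1%:R * `|f n.+1| * (`|x| ^+ n * (sg ^+ n * sg ^+ n)) =
     (`|f n.+1| * `|x| ^+ n) * (n.+1%:R * sg ^+ n) * sg ^+ n by ring.
  rewrite ler_wpM2r ?exprn_ge0// ler_pM// ?mulr_ge0 ?exprn_ge0//.
- by apply: is_cvg_geometric_series; rewrite ger0_norm.
Qed.

Lemma is_derive_pseries f z : (forall n, `|f n| <= 1) -> `|z| < 1 ->
  is_derive z 1 (fun y => limn (pseries f y)) (limn (pseries (pseries_diffs f) z)).
Proof.
move=> f1 z1.
(* Termwise differentiation asks for convergence of the series and of its first two formal
   derivatives at a point beyond z. Each formal derivative costs some radius, hence the chain |z| <
   k1 < k2 < k3 < 1. *)
have between (t : R) : 0 <= t < 1 -> exists2 u, t < u & u < 1.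
  by move=> /andP[t0 t1]; exists ((t + 1) / 2); lra.
have [k1 zk1 k11] := between `|z| (introT andP (conj (normr_ge0 _) z1)).
have k10 : 0 <= k1 by rewrite (le_trans _ (ltW zk1)).
have [k2 k12 k21] := between k1 (introT andP (conj k10 k11)).
have k20 := le_trans k10 (ltW k12).
have [k3 k23 k31] := between k2 (introT andP (conj k20 k21)).
have k30 := le_trans k20 (ltW k23).
have c3 : cvgn (pseries f k3) by apply: cvg_pseries_bounded; rewrite ?ger0_norm.
have c2 : cvgn (pseries (pseries_diffs f) k2).
  by apply: cvg_pseries_diffs_inside c3 _; rewrite !ger0_norm.
have c1 : cvgn (pseries (pseries_diffs (pseries_diffs f)) k1).
  by apply: cvg_pseries_diffs_inside c2 _; rewrite !ger0_norm.
apply: (@pseries_snd_diffs _ _ k1) => //.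
- by apply: is_cvg_pseries_inside c3 _; rewrite !ger0_norm// (lt_trans k12).
- by apply: is_cvg_pseries_inside c2 _; rewrite !ger0_norm.
- by rewrite (ger0_norm k10).
Qed.

Lemma limn_pseries0 f : limn (pseries f 0) = f 0%N.
Proof.
apply/cvg_lim => //; rewrite -cvg_shiftS.
rewrite (_ : (fun n => _) = (fun=> f 0%N)); first exact: cvg_cst.
apply/funext => n; rewrite /pseries /series/= big_nat_recl// expr0 mulr1 big1 ?addr0// => i _.
by rewrite exprS mul0r mulr0.
Qed.

(** The Euler operator z d/dz multiplies the n-th coefficient by n; in this form recurrences on
    coefficients become differential equations. *)
Lemma mulr_limn_pseries_diffs f z : (forall n, `|f n| <= 1) -> `|z| < 1 ->
  series (fun n => n%:R * f n * z ^+ n) n @[n --> \oo] -->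
    z * limn (pseries (pseries_diffs f) z).
Proof.
move=> f1 z1.
have Cd : cvgn (pseries (pseries_diffs f) z).
  have k0 : 0 <= (`|z| + 1) / 2 by rewrite divr_ge0 ?addr_ge0.
  apply: (@cvg_pseries_diffs_inside _ ((`|z| + 1) / 2)).
    by apply: cvg_pseries_bounded => //; rewrite ger0_norm//; lra.
  by rewrite [X in _ < X]ger0_norm//; lra.
rewrite (_ : series _ = (cst z \* series (fun i => i%:R * f i * z ^+ i.-1)) :> R^nat).
  by apply: cvgM; [exact: cvg_cst|exact: pseries_diffs_equiv].
apply/funext => n; rewrite /series/= mulr_sumr; apply: eq_bigr => -[|i] _.
  by rewrite !mul0r mulr0.
by rewrite /= exprS; ring.
Qed.

End PowerSeries.

(** * The function 2F1(a, be; a + 1; z) *)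

Section Hypergeometric.
Context {R : realType}.
Variables a be : R.
Hypotheses (a0 : 0 < a) (be0 : 0 < be) (be1 : be <= 1).

Lemma pochS (x : R) n : poch x n.+1 = poch x n * (x + n%:R).
Proof. by rewrite /poch big_ord_recr. Qed.

Lemma poch_gt0 (x : R) n : 0 < x -> 0 < poch x n.
Proof. by move=> x0; apply: prodr_gt0 => i _; rewrite ltr_wpDr. Qed.

Lemma poch_shift (x : R) n : poch x n * (x + n%:R) = x * poch (x + 1) n.
Proof.
elim: n => [|n IH]; first by rewrite /poch !big_ord0 addr0 mulr1 mul1r.
by rewrite !pochS IH -natr1; ring.
Qed.

(** [g] holds the binomial coefficients of (1 - z)^(-be), [f] those of the hypergeometric series.
    The third parameter a + 1 makes f n equal to a / (a + n) times g n, and be <= 1 bounds both by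
    1. *)
Let g n : R := poch be n / n`!%:R.
Let f n : R := poch a n * poch be n / (poch (a + 1) n * n`!%:R).

Let fact0 n : 0 < n`!%:R :> R. Proof. by rewrite ltr0n fact_gt0. Qed.

Let gS n : n.+1%:R * g n.+1 = (be + n%:R) * g n.
Proof.
by rewrite /g pochS factS natrM; field; rewrite !gt_eqF//.
Qed.

Let fE n : (n%:R + a) * f n = a * g n.
Proof.
have p0 := poch_gt0 n (addr_gt0 a0 ltr01); rewrite /f /g.
have : poch a n = a * poch (a + 1) n / (a + n%:R).
  by rewrite -poch_shift mulfK// gt_eqF// ltr_wpDr.
move=> ->; field; rewrite !gt_eqF// ?ltr_wpDr//.
Qed.

Let g_ge0 n : 0 <= g n. Proof. by rewrite divr_ge0 ?ltW// poch_gt0. Qed.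

Let g_le1 n : g n <= 1.
Proof.
elim: n => [|n IH]; first by rewrite /g /poch big_ord0 divr1.
rewrite -(@ler_pM2l _ n.+1%:R)// gS mulr1 (le_trans (ler_wpM2l _ IH)) ?addr_ge0 ?(ltW be0)//.
by rewrite mulr1 -natr1 addrC lerD2l.
Qed.

Let ng n : `|g n| <= 1. Proof. by rewrite ger0_norm. Qed.

Let nf n : `|f n| <= 1.
Proof.
have na : 0 < n%:R + a by rewrite ltr_wpDl.
have -> : f n = a * g n / (n%:R + a).
  by apply: (mulfI (lt0r_neq0 na)); rewrite fE [RHS]mulrC divfK// gt_eqF.
rewrite ger0_norm; last by apply: divr_ge0; [apply: mulr_ge0 => //|]; exact: ltW.
rewrite ler_pdivrMr// mul1r (le_trans (ler_wpM2l (ltW a0) (g_le1 n)))//.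
by rewrite mulr1 lerDr.
Qed.

Let G z := limn (pseries g z).
Let F z := limn (pseries f z).
Let dG z := limn (pseries (pseries_diffs g) z).
Let dF z := limn (pseries (pseries_diffs f) z).

(* z^a F(z) has derivative a z^(a-1) G(z), where G is the binomial series of (1 - z)^(-be). *)
Let ode_F z : `|z| < 1 -> z * dF z + a * F z = a * G z.
Proof.
move=> z1.
have h1 := mulr_limn_pseries_diffs nf z1.
have h2 : pseries f z n @[n --> \oo] --> F z by exact: cvg_pseries_bounded.
have h3 : pseries g z n @[n --> \oo] --> G z by exact: cvg_pseries_bounded.
have hF : series (fun n => n%:R * f n * z ^+ n) n + a * pseries f z n @[n --> \oo] -->
    z * dF z + a * F z.
  by apply: cvgD => //; apply: cvgM => //; exact: cvg_cst.
have hG : a * pseries g z n @[n --> \oo] --> a * G z.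
  by apply: cvgM => //; exact: cvg_cst.
rewrite (_ : (fun n => _ + _) = (fun n => a * pseries g z n)) in hF.
  by rewrite -(cvg_lim _ hF)// -(cvg_lim _ hG).
apply/funext => n; rewrite /pseries /series/= !mulr_sumr -big_split/=.
by apply: eq_bigr => i _; rewrite [RHS]mulrA -fE; ring.
Qed.

Let ode_G z : `|z| < 1 -> (1 - z) * dG z = be * G z.
Proof.
move=> z1.
have h1 := mulr_limn_pseries_diffs ng z1.
have h3 : pseries g z n @[n --> \oo] --> G z by exact: cvg_pseries_bounded.
suff : dG z = z * dG z + be * G z by move=> h; rewrite mulrBl mul1r {1}h addrC addKr.
have hG : series (fun n => n%:R * g n * z ^+ n) n + be * pseries g z n @[n --> \oo] -->
    z * dG z + be * G z.
  by apply: cvgD => //; apply: cvgM => //; exact: cvg_cst.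
rewrite (_ : (fun n => _ + _) = pseries (pseries_diffs g) z) in hG.
  by rewrite -(cvg_lim _ hG).
apply/funext => n; rewrite /pseries /series/= mulr_sumr -big_split/=.
by apply: eq_bigr => i _; rewrite /pseries_diffs gS; ring.
Qed.

(** By [ode_G] the product of G and (1 - z)^be has zero derivative on ]-1, 1[, so it keeps its value
    1 at z = 0. *)
Lemma limn_binomial_series z : 0 <= z < 1 -> G z = pw (- be) (1 - z).
Proof.
move=> /andP[]; rewrite le_eqVlt => /orP[/eqP <- _|z0 z1].
  by rewrite /G limn_pseries0 /g /poch big_ord0 divr1 subr0 pwE// powR1.
pose P (y : R) := G y * pw be (1 - y).
have dP (y : R) : -1 < y < 1 -> is_derive y 1 P 0.
  move=> /andP[y0 y1].
  have ny : `|y| < 1 by rewrite ltr_norml y0.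
  have y10 : 0 < 1 - y by rewrite subr_gt0.
  have d1 : is_derive y 1 G (dG y) by exact: is_derive_pseries.
  have d2 : is_derive y 1 (fun u => pw be (1 - u)) (- (be * pw (be - 1) (1 - y))).
    have d3 : is_derive y 1 (fun u : R => 1 - u) (-1).
      have := is_deriveB (@is_derive_cst R R R 1 y 1) (@is_derive_id R R y 1).
      by rewrite sub0r.
    have d4 := is_derive_pw be y10.
    by apply: (is_derive_eq (@is_derive1_comp _ (pw be) (fun u => 1 - u) y _ _ d4 d3)); rewrite mulrN1.
  apply: (is_derive_eq (is_deriveM d1 d2)).
  rewrite /GRing.scale/=.
  have -> : pw be (1 - y) = pw (be - 1) (1 - y) * (1 - y).
    by rewrite -{3}(pw1 y10) -pwD subrK.
  transitivity (pw (be - 1) (1 - y) * ((1 - y) * dG y - be * G y)); first by ring.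
  by rewrite ode_G// subrr mulr0.
have cP (y : R) : -1 < y < 1 -> {for y, continuous P}.
  move=> h; apply: differentiable_continuous; apply/derivable1_diffP.
  by case: (dP y h).
have [y||c _] := @MVT R P (fun=> 0) 0 z z0.
- rewrite in_itv/= => /andP[y0 yz]; apply: dP; lra.
- apply: continuous_in_subspaceT => y; rewrite inE/= in_itv/= => /andP[y0 yz].
  by apply: cP; rewrite (lt_le_trans _ y0) ?ltrN10// (le_lt_trans yz).
rewrite mul0r => /eqP; rewrite subr_eq0 => /eqP H.
have P0 : P 0 = 1.
  by rewrite /P /G limn_pseries0 /g /poch big_ord0 divr1 subr0 pwE// powR1 mulr1.
have pz : 0 < pw be (1 - z) by rewrite pw_gt0 ?subr_gt0.
rewrite pwN ?subr_gt0//; apply: (mulIf (lt0r_neq0 pz)).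
by rewrite mulVf ?gt_eqF//; exact: etrans H P0.
Qed.

Lemma is_derive_pw_hyp2F1 (z : R) : 0 < z < 1 ->
  is_derive z 1 (fun y => pw a y * hyp2F1 a be (a + 1) y) (a * pw (a - 1) z * pw (- be) (1 - z)).
Proof.
move=> /andP[z0 z1]; have nz : `|z| < 1 by rewrite gtr0_norm.
have d1 := is_derive_pw a z0.
have d2 : is_derive z 1 F (dF z) by exact: is_derive_pseries.
apply: (is_derive_eq (is_deriveM d1 d2)); rewrite /GRing.scale/=.
have -> : pw a z = pw (a - 1) z * z by rewrite -{3}(pw1 z0) -pwD subrK.
rewrite -limn_binomial_series; last by rewrite (ltW z0).
transitivity (pw (a - 1) z * (z * dF z + a * F z)); first by ring.
by rewrite ode_F//; ring.
Qed.

Lemma cvg_pw_hyp2F1_0 : pw a y * hyp2F1 a be (a + 1) y @[y --> 0^'+] --> (0 : R).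
Proof.
have d2 : is_derive (0 : R) 1 F (dF 0) by apply: is_derive_pseries; rewrite ?normr0.
have cF : F y @[y --> (0 : R)^'+] --> F 0.
  apply: cvg_at_right_filter; apply: differentiable_continuous; apply/derivable1_diffP.
  by case: d2.
rewrite -[X in _ --> X](mul0r (F 0)); apply: cvgM => //.
apply: cvg_trans (powR_cvg0 a0); apply: near_eq_cvg; near=> y.
by rewrite pwE//.
Unshelve. all: by end_near. Qed.

End Hypergeometric.

(** * The mass of the truncated mixture as a function of t = a^2 *)

Section MassFunction.
Context {R : realType}.
Variables s b : R.
Hypotheses (s0 : 0 < s) (s1 : s < 1) (b0 : 0 < b).
Local Notation mu := (@lebesgue_measure R).
Implicit Types t T : R.

Let h0 : 0 < s / 2. Proof. by rewrite divr_gt0. Qed.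
Let be0 : 0 < (1 + s) / 2. Proof. by rewrite divr_gt0 ?addr_gt0. Qed.
Let be1 : (1 + s) / 2 <= 1. Proof. by move: s1 => ?; lra. Qed.
Let hm0 : 0 < (1 - s) / 2. Proof. by rewrite divr_gt0 ?subr_gt0. Qed.
Let b20 : 0 < b ^+ 2. Proof. by rewrite exprn_gt0. Qed.

Let tb0 t : 0 <= t -> 0 < t + b ^+ 2. Proof. by move=> ?; rewrite ltr_wpDl. Qed.

Definition hyp_part t : R :=
  pw (s / 2) (t / (t + b ^+ 2)) * hyp2F1 (s / 2) ((1 + s) / 2) (s / 2 + 1) (t / (t + b ^+ 2)).

(** Here 1 - z = b^2 / (t + b^2), so the binomial factor and the chain rule combine into elementary
    powers and no hypergeometric function survives. *)
Lemma is_derive_hyp_part t : 0 < t -> is_derive t 1 hyp_part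
  (s / 2 * pw (s / 2 - 1) t * pw (1 - s) b * pw (- 2^-1) (t + b ^+ 2)).
Proof.
move=> t0; have A0 := tb0 (ltW t0).
have z0 : 0 < t / (t + b ^+ 2) by rewrite divr_gt0.
have z1 : t / (t + b ^+ 2) < 1 by rewrite ltr_pdivrMr// mul1r ltrDl.
have d1 : is_derive t 1 (fun u : R => u / (u + b ^+ 2)) (b ^+ 2 / (t + b ^+ 2) ^+ 2).
  have dA : is_derive t 1 (fun u : R => u + b ^+ 2) 1.
    have := is_deriveD (@is_derive_id R R t 1) (@is_derive_cst R R R (b ^+ 2) t 1).
    by rewrite addr0.
  have dV : is_derive t 1 (fun u : R => (u + b ^+ 2)^-1) (- (t + b ^+ 2) ^- 2 *: 1).
    by apply: (is_deriveV (f := fun u : R => u + b ^+ 2)); rewrite ?gt_eqF.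
  apply: (is_derive_eq (is_deriveM (@is_derive_id R R t 1) dV)).
  by rewrite /GRing.scale/=; field; rewrite gt_eqF.
have d2 := is_derive_pw_hyp2F1 h0 be0 be1 (introT andP (conj z0 z1)).
apply: (is_derive_eq (@is_derive1_comp _ _ (fun u : R => u / (u + b ^+ 2)) t _ _ d2 d1)).
have -> : 1 - t / (t + b ^+ 2) = b ^+ 2 / (t + b ^+ 2) by field; rewrite gt_eqF.
have E1 : pw (s / 2 - 1) (t / (t + b ^+ 2)) = pw (s / 2 - 1) t * pw (1 - s / 2) (t + b ^+ 2).
  by rewrite pwM// pw_inv// -pwN//; congr (_ * pw _ _); ring.
have E2 : pw (- ((1 + s) / 2)) (b ^+ 2 / (t + b ^+ 2)) =
    pw (- (1 + s)) b * pw ((1 + s) / 2) (t + b ^+ 2).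
  rewrite pwM// pw_inv// -pwN// expr2 pwM// -pwD; congr (pw _ _ * pw _ _); last by ring.
  by field.
have E3 : pw (1 - s) b = pw (- (1 + s)) b * b ^+ 2.
  by rewrite -pw_natr// -pwD; congr pw; ring.
have E4 : pw (- 2^-1) (t + b ^+ 2) =
    pw (1 - s / 2) (t + b ^+ 2) * pw ((1 + s) / 2) (t + b ^+ 2) / (t + b ^+ 2) ^+ 2.
  by rewrite -[(t + b ^+ 2) ^+ 2]pw_natr// -pwN// -!pwD; congr pw; field.
by rewrite E1 E2 E3 E4; ring.
Qed.

(** Equal to h - (2/s) t h' for h = [hyp_part], which is what differentiating a^(-s) (const - Q
    h(a^2)) leaves. Its derivative is, up to a constant, t^(s/2) (t + b^2)^(-3/2), the mass of w_t
    times its weight in the mixture; this is the link between F_s' and the mass. *)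
Definition mass_fun t : R := hyp_part t - pw (1 - s) b * (pw (s / 2) t * pw (- 2^-1) (t + b ^+ 2)).

Lemma is_derive_mass_fun t : 0 < t -> is_derive t 1 mass_fun
  (2^-1 * pw (1 - s) b * (pw (s / 2) t * pw (- (3 / 2)) (t + b ^+ 2))).
Proof.
move=> t0; have A0 := tb0 (ltW t0).
have dA : is_derive t 1 (fun u : R => u + b ^+ 2) 1.
  have := is_deriveD (@is_derive_id R R t 1) (@is_derive_cst R R R (b ^+ 2) t 1).
  by rewrite addr0.
have d1 := @is_derive1_comp _ _ (fun u : R => u + b ^+ 2) t _ _ (is_derive_pw (- 2^-1) A0) dA.
have d2 := is_deriveZ (pw (1 - s) b) (is_deriveM (is_derive_pw (s / 2) t0) d1).
apply: (is_derive_eq (is_deriveB (is_derive_hyp_part t0) d2)).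
rewrite /GRing.scale/= mulr1.
have E1 : pw (- 2^-1) (t + b ^+ 2) = pw (- 2^-1 - 1) (t + b ^+ 2) * (t + b ^+ 2).
  by rewrite -{3}(pw1 A0) -pwD subrK.
have E2 : pw (s / 2) t = pw (s / 2 - 1) t * t by rewrite -{3}(pw1 t0) -pwD subrK.
have -> : - (3 / 2) = - 2^-1 - 1 :> R by field.
by rewrite E1 E2; field.
Qed.

Lemma mass_fun0 : mass_fun 0 = 0.
Proof. by rewrite /mass_fun /hyp_part !mul0r pw_le0// !mul0r mulr0 subr0. Qed.

Let cvg_addA : t + b ^+ 2 @[t --> (0 : R)^'+] --> b ^+ 2.
Proof.
rewrite -[X in _ --> X]add0r; apply: cvgD; last exact: cvg_cst.
by apply: cvg_at_right_filter; exact: cvg_id.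
Qed.

Let cvg_shift0 : (t / (t + b ^+ 2)) @[t --> (0 : R)^'+] --> (0 : R)^'+.
Proof.
have c0 : (t / (t + b ^+ 2)) @[t --> (0 : R)^'+] --> (0 : R).
  rewrite -[X in _ --> X](mul0r (b ^+ 2)^-1); apply: cvgM.
    by apply: cvg_at_right_filter; exact: cvg_id.
  by apply: cvgV; rewrite ?gt_eqF//; exact: cvg_addA.
move=> P HP.
have h : \forall t \near (0 : R)^'+, 0 < t / (t + b ^+ 2) -> P (t / (t + b ^+ 2)).
  exact: (c0 _ HP).
suff : \forall t \near (0 : R)^'+, P (t / (t + b ^+ 2)) by [].
near=> t; have : 0 < t / (t + b ^+ 2) -> P (t / (t + b ^+ 2)) by near: t; exact: h.
apply; have t0 : 0 < t by [].
by rewrite divr_gt0// tb0// ltW.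
Unshelve. all: by end_near. Qed.

Let cvg_pw0 (p : R) : 0 < p -> pw p t @[t --> (0 : R)^'+] --> (0 : R).
Proof.
move=> p0; apply: cvg_trans (powR_cvg0 p0); apply: near_eq_cvg; near=> y.
by rewrite pwE//.
Unshelve. all: by end_near. Qed.

Let cvg_pwA (p : R) : pw p (t + b ^+ 2) @[t --> (0 : R)^'+] --> pw p (b ^+ 2).
Proof. by apply: continuous_cvg; [exact: continuous_pw|exact: cvg_addA]. Qed.

Lemma cvg_mass_fun0 : mass_fun t @[t --> (0 : R)^'+] --> (0 : R).
Proof.
rewrite /mass_fun -[X in _ --> X]subr0; apply: cvgB.
  exact: (@cvg_comp _ _ _ (fun t : R => t / (t + b ^+ 2))
    (fun z => pw (s / 2) z * hyp2F1 (s / 2) ((1 + s) / 2) (s / 2 + 1) z) _ _ _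
    cvg_shift0 (cvg_pw_hyp2F1_0 h0 be0 be1)).
rewrite -[X in _ --> X](mulr0 (pw (1 - s) b)); apply: cvgM; first exact: cvg_cst.
rewrite -[X in _ --> X](mul0r (pw (- 2^-1) (b ^+ 2))).
by apply: cvgM; [exact: cvg_pw0|exact: cvg_pwA].
Qed.

Let continuous_mass_fun t : 0 < t -> {for t, continuous mass_fun}.
Proof.
move=> t0; apply: differentiable_continuous; apply/derivable1_diffP.
by case: (is_derive_mass_fun t0).
Qed.

Let mass_fun_LR T : 0 < T -> derivable_oo_LRcontinuous mass_fun 0 T.
Proof.
move=> T0; split.
- by move=> t; rewrite in_itv/= => /andP[t0 _]; case: (is_derive_mass_fun t0).
- by rewrite mass_fun0; exact: cvg_mass_fun0.
- exact/cvg_at_left_filter/continuous_mass_fun.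
Qed.

Lemma integral_mass_fun T : 0 < T ->
  (\int[mu]_t (pw (s / 2) t * pw (- (3 / 2)) (t + b ^+ 2) * (t < T)%R%:R)%:E =
   (2 * pw (s - 1) b * mass_fun T)%:E)%E.
Proof.
move=> T0.
pose f t := 2^-1 * pw (1 - s) b * (pw (s / 2) t * pw (- (3 / 2)) (t + b ^+ 2)).
have cf (t : R) : 0 < t -> {for t, continuous f}.
  move=> t0; rewrite /f; apply: cvgM; first exact: cvg_cst.
  apply: cvgM; first exact: continuous_pw.
  apply: continuous_cvg; first by apply: continuous_pw; rewrite tb0// ltW.
  by apply: cvgD; [exact: cvg_id|exact: cvg_cst].
(* As s/2 > 0, the integrand tends from the right to its truncated value 0 at t = 0, so the
   fundamental theorem applies on the closed interval. *)
have FTC : (\int[mu]_(t in `[0%R, T]) (f t)%:E = (mass_fun T)%:E - (mass_fun 0)%:E)%E.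
  apply: continuous_FTC2 => //.
  - apply/continuous_within_itvP => //; split.
    + by move=> t; rewrite in_itv/= => /andP[t0 _]; exact: cf.
    + rewrite /f [X in _ --> X](_ : _ = 2^-1 * pw (1 - s) b * (0 * pw (- (3 / 2)) (b ^+ 2))).
        apply: cvgM; first exact: cvg_cst.
        by apply: cvgM; [exact: cvg_pw0|exact: cvg_pwA].
      by rewrite add0r (pw_le0 _ (lexx 0)).
    + exact/cvg_at_left_filter/cf.
  - exact: mass_fun_LR.
  - move=> t; rewrite in_itv/= => /andP[t0 _]; rewrite derive1E.
    by case: (is_derive_mass_fun t0).
have k0 : 0 < 2^-1 * pw (1 - s) b by rewrite mulr_gt0 ?invr_gt0 ?pw_gt0.
have -> : 2 * pw (s - 1) b * mass_fun T = mass_fun T / (2^-1 * pw (1 - s) b).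
  rewrite -opprB pwN//; field.
  by rewrite gt_eqF ?pw_gt0.
apply: eq_divEFin => //; rewrite -ge0_integralcMl; [|exact: ltW|by mfun|by pos].
rewrite mass_fun0 sube0 in FTC; rewrite -FTC.
rewrite -integral_itv_bndo_bndc; last first.
  by apply: measurable_funTS; rewrite /f; mfun.
apply/esym/integral_mkbool => t; rewrite mem_setE in_itv/= /f.
have [t0|t0] := leP 0 t; last by rewrite (pw_le0 _ (ltW t0)) !mul0r mulr0.
by case: (ltP t T) => tT; rewrite ?mulr1 ?mulr0.
Qed.

Lemma mass_fun_lt T1 T2 : 0 < T1 -> T1 < T2 -> mass_fun T1 < mass_fun T2.
Proof.
move=> T10 T12.
have [t||c] := @MVT R mass_fun
  (fun t => 2^-1 * pw (1 - s) b * (pw (s / 2) t * pw (- (3 / 2)) (t + b ^+ 2))) T1 T2 T12.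
- rewrite in_itv/= => /andP[t0 _]; apply: is_derive_mass_fun; exact: lt_trans t0.
- apply: continuous_in_subspaceT => y; rewrite inE/= in_itv/= => /andP[y0 _].
  exact/continuous_mass_fun/(lt_le_trans T10).
rewrite in_itv/= => /andP[c0 _] E; rewrite -subr_gt0 E.
have {}c0 := lt_trans T10 c0.
by rewrite !mulr_gt0 ?pw_gt0 ?subr_gt0 ?tb0 ?ltW// invr_gt0.
Qed.

Lemma integral_mass_full :
  (\int[mu]_t (pw (s / 2) t * pw (- (3 / 2)) (t + b ^+ 2))%:E =
   (pw (s - 1) b * (Gammaf (1 + s / 2) * Gammaf ((1 - s) / 2) / Gammaf (3 / 2)))%:E)%E.
Proof.
rewrite (ge0_integral_scale b20); [|by mfun|by pos].
transitivity ((b ^+ 2)%:E * \int[mu]_t (pw (s / 2) (b ^+ 2) * pw (- (3 / 2)) (b ^+ 2) *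
    (pw (1 + s / 2 - 1) t * pw (- (1 + s / 2 + (1 - s) / 2)) (1 + t)))%:E)%E.
  congr (_ * _)%E; apply: eq_integral => t _; congr EFin.
  rewrite (_ : b ^+ 2 * t + b ^+ 2 = b ^+ 2 * (1 + t)); last by ring.
  rewrite !pwM// (_ : 1 + s / 2 - 1 = s / 2); last by ring.
  rewrite (_ : - (1 + s / 2 + (1 - s) / 2) = - (3 / 2)); last by field.
  by ring.
rewrite ge0_integralcMl; [|by pos|by mfun|by pos].
rewrite -/(ebetaoo _ _) ebetaooE ?addr_gt0// -!EFinM; congr EFin.
rewrite (_ : 1 + s / 2 + (1 - s) / 2 = 3 / 2); last by field.
rewrite mulrA; congr (_ * _).
rewrite -[X in X * (_ * _)](pw1 b20) -!pwD expr2 pwM// -pwD.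
by congr pw; field.
Qed.

(** The bound is the limit of [mass_fun] at infinity, read off from [integral_mass_full]. Dropping
    b^2 bounds the integral above T by T^(-(1-s)/2) / ((1-s)/2). *)
Lemma mass_fun_large (M : R) : M < Gammaf (1 + s / 2) * Gammaf ((1 - s) / 2) / Num.sqrt pi ->
  exists2 T, 0 < T & M < mass_fun T.
Proof.
move=> HM; set B := Gammaf _ * _ / _ in HM.
(* Chosen so that the tail bound e / ((1-s)/2) is (B - M) b^(s-1); comparing integrals then gives 2
   [mass_fun T] >= B + M > 2 M. The T below solves T^(-(1-s)/2) = e. *)
pose e := (B - M) * pw (s - 1) b * (1 - s) / 2.
have pb0 : 0 < pw (s - 1) b by rewrite pw_gt0.
have e0 : 0 < e by rewrite /e !mulr_gt0 ?subr_gt0 ?invr_gt0.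
pose T := pw (- ((1 - s) / 2)^-1) e; have T0 : 0 < T by rewrite pw_gt0.
have pT : pw (- ((1 - s) / 2)) T = e.
  rewrite /T pw_pw// (_ : - ((1 - s) / 2)^-1 * - ((1 - s) / 2) = 1) ?pw1//.
  by rewrite mulrNN mulVf// gt_eqF.
exists T => //.
have tail : (\int[mu]_t (pw (s / 2) t * pw (- (3 / 2)) (t + b ^+ 2) * (T < t)%R%:R)%:E <=
    (e / ((1 - s) / 2))%:E)%E.
  rewrite -pT -integral_pw_tail//; apply: ge0_le_integral; [by []|by pos|by mfun|by mfun|].
  move=> t _; rewrite lee_fin; have [Tt|Tt] := ltP T t; last by rewrite !mulr0.
  have t0 := lt_trans T0 Tt.
  rewrite !mulr1 (_ : - ((1 - s) / 2) - 1 = s / 2 - 3 / 2); last by field.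
  rewrite pwD ler_wpM2l ?pw_ge0// !pwN ?tb0 ?(ltW t0)//.
  rewrite lef_pV2 ?posrE ?pw_gt0 ?tb0 ?(ltW t0)// pw_le ?divr_ge0//.
  by rewrite lerDl sqr_ge0.
have : (\int[mu]_t (pw (s / 2) t * pw (- (3 / 2)) (t + b ^+ 2))%:E =
   \int[mu]_t (pw (s / 2) t * pw (- (3 / 2)) (t + b ^+ 2) * (t < T)%R%:R)%:E +
   \int[mu]_t (pw (s / 2) t * pw (- (3 / 2)) (t + b ^+ 2) * (T < t)%R%:R)%:E)%E.
  rewrite -ge0_integralD; [|by []|by pos|by mfun|by pos|by mfun].
  apply: (@eq_integral_setD1 _ T); [by mfun|by apply: emeasurable_funD; mfun|].
  by move=> t tT; rewrite -EFinD -mulrDr; case: ltgtP tT => // _ _; rewrite ?addr0 ?add0r mulr1.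
rewrite integral_mass_full (integral_mass_fun T0) GammafS_half => H.
have {}H : ((pw (s - 1) b * (2 * B))%:E <=
    (2 * pw (s - 1) b * mass_fun T)%:E + (e / ((1 - s) / 2))%:E)%E.
  apply: le_trans (leeD2l _ tail); rewrite -H lee_fin le_eqVlt; apply/orP; left.
  by apply/eqP; congr (_ * _); rewrite /B; move: (Gammaf _ * _) => g; field;
    rewrite gt_eqF// sqrtr_gt0 pi_gt0.
move: H; rewrite -EFinD lee_fin.
have -> : e / ((1 - s) / 2) = (B - M) * pw (s - 1) b.
  by rewrite /e; field; rewrite subr_eq0 gt_eqF.
rewrite (_ : 2 * pw (s - 1) b * mass_fun T + (B - M) * pw (s - 1) b =
   pw (s - 1) b * (2 * mass_fun T + (B - M))); last by ring.
rewrite ler_pM2l// => H; lra.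
Qed.

Lemma exists_mass_fun (M : R) : 0 < M ->
  M < Gammaf (1 + s / 2) * Gammaf ((1 - s) / 2) / Num.sqrt pi ->
  exists2 T, 0 < T & mass_fun T = M.
Proof.
move=> M0 /mass_fun_large[T T0 MT].
have [||c] := @IVT R mass_fun 0 T M (ltW T0).
- exact/derivable_oo_LRcontinuous_within/mass_fun_LR.
- by rewrite mass_fun0 ge_min le_max (ltW M0) (ltW MT) orbT.
rewrite in_itv/= le_eqVlt => /andP[/orP[/eqP <-|c0] _] E; last by exists c.
by move: M0; rewrite -E mass_fun0 ltxx.
Qed.

End MassFunction.

(** * The derivative of F_s *)

Section FsDerivative.
Context {R : realType}.
Variables s q b : R.
Hypotheses (s0 : 0 < s) (s1 : s < 1) (b0 : 0 < b).

Let C : R := Gammaf (1 + s) / (2 `^ s * Gammaf ((1 + s) / 2)).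
Let Q : R := q * (Num.sqrt pi / Gammaf (1 + s / 2)).

Let FsE (a : R) : 0 < a ->
  Fs s q b a = C * pw (- s) a * (Gammaf ((1 - s) / 2) - Q * hyp_part s b (a ^+ 2)).
Proof.
move=> a0; have A0 : 0 < a ^+ 2 + b ^+ 2 by rewrite addr_gt0// exprn_gt0.
have z0 : 0 < a / Num.sqrt (a ^+ 2 + b ^+ 2) by rewrite divr_gt0// sqrtr_gt0.
have -> : hyp_part s b (a ^+ 2) = (a / Num.sqrt (a ^+ 2 + b ^+ 2)) `^ s *
    hyp2F1 (s / 2) ((1 + s) / 2) (1 + s / 2) (a ^+ 2 / (a ^+ 2 + b ^+ 2)).
  rewrite /hyp_part (addrC (s / 2) 1); congr (_ * _).
  have -> : a ^+ 2 / (a ^+ 2 + b ^+ 2) = (a / Num.sqrt (a ^+ 2 + b ^+ 2)) ^+ 2.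
    by rewrite expr_div_n sqr_sqrtr// ltW.
  by rewrite expr2 pwM// -pwD -pwE//; congr pw; field.
by rewrite /Fs -/C (pwE _ a0) /Q mulrA.
Qed.

Lemma is_derive_Fs (a : R) : 0 < a -> is_derive a 1 (Fs s q b)
  (- (C * s * pw (- s - 1) a) * (Gammaf ((1 - s) / 2) - Q * mass_fun s b (a ^+ 2))).
Proof.
move=> a0; have a20 : 0 < a ^+ 2 by rewrite exprn_gt0.
apply: (@near_eq_is_derive _ _ _
   (fun u : R => C * pw (- s) u * (Gammaf ((1 - s) / 2) - Q * hyp_part s b (u ^+ 2)))).
  by near=> u; rewrite FsE//; near: u; exact: lt_nbhsr.
have dX : is_derive a 1 (fun u : R => u ^+ 2) (2 * a).
  apply: (is_derive_eq (is_deriveM (@is_derive_id R R a 1) (@is_derive_id R R a 1))).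
  by rewrite /GRing.scale/= mulr1 mulr_natl.
have d1 := @is_derive1_comp _ (hyp_part s b) (fun u : R => u ^+ 2) a _ _
  (is_derive_hyp_part s0 s1 b0 a20) dX.
have d2 := is_deriveZ Q d1.
have d3 := is_deriveB (@is_derive_cst R R R (Gammaf ((1 - s) / 2)) a 1) d2.
have d4 := is_deriveZ C (is_derive_pw (- s) a0).
apply: (is_derive_eq (is_deriveM d4 d3)).
transitivity (C * pw (- s) a * (0 - Q * (s / 2 * pw (s / 2 - 1) (a ^+ 2) * pw (1 - s) b *
    pw (- 2^-1) (a ^+ 2 + b ^+ 2) * (2 * a))) +
  (Gammaf ((1 - s) / 2) - Q * hyp_part s b (a ^+ 2)) * (C * (- s * pw (- s - 1) a))) => //.
rewrite /mass_fun.
have -> : pw (- s) a = pw (- s - 1) a * a by rewrite -{3}(pw1 a0) -pwD subrK.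
have -> : pw (s / 2) (a ^+ 2) = pw (s / 2 - 1) (a ^+ 2) * a ^+ 2.
  by rewrite -{3}(pw1 a20) -pwD subrK.
by field.
Unshelve. all: by end_near. Qed.

Lemma is_derive_Fs0P (a : R) : 0 < a ->
  is_derive a 1 (Fs s q b) 0 <-> Q * mass_fun s b (a ^+ 2) = Gammaf ((1 - s) / 2).
Proof.
move=> a0; have d := is_derive_Fs a0; split=> [d0|E]; last first.
  by apply: (is_derive_eq d); rewrite E subrr mulr0.
have := @derive_val _ _ _ _ _ _ _ d; rewrite (@derive_val _ _ _ _ _ _ _ d0).
have C0 : C * s * pw (- s - 1) a != 0.
  rewrite gt_eqF// /C !mulr_gt0 ?invr_gt0 ?mulr_gt0 ?powR_gt0 ?pw_gt0 ?Gammaf_gt0//;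
  by rewrite ?divr_gt0 ?addr_gt0.
move=> /esym/eqP; rewrite mulf_eq0 oppr_eq0 (negPf C0)/= subr_eq0 => /eqP <- //.
Qed.

End FsDerivative.

(** * Strict positivity of integrals *)

Section PositiveIntegrals.
Local Open Scope ereal_scope.
Context {R : realType}.
Local Notation mu := (@lebesgue_measure R).

Lemma integral_itvoo_gt0 (u v : R) (h : R -> \bar R) : (u < v)%R ->
  measurable_fun setT h -> (forall x, 0 <= h x) ->
  (forall x, (u < x < v)%R -> 0 < h x) -> 0 < \int[mu]_(x in `]u, v[) h x.
Proof.
move=> uv mh h0 hpos; rewrite lt_neqAle integral_ge0// andbT eq_sym; apply/eqP => I0.
have : \int[mu]_(x in `]u, v[) `|h x| = 0.
  by rewrite -I0; apply: eq_integral => x _; rewrite gee0_abs.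
move/(ae_eq_integral_abs mu (measurable_itv _) (measurable_funTS mh)) => -[N [mN N0 sN]].
have sub : (`]u, v[%classic : set R) `<=` N.
  move=> x xuv; apply: sN => /= H; have := hpos x; rewrite (H xuv)/= ltxx.
  by move=> /(_ _)/negP; apply; [move: xuv; rewrite /= in_itv|].
have := lebesgue_measure_itvoo_gt0 uv; rewrite ltNge => /negP; apply.
by rewrite -N0; apply: le_measure => //; rewrite inE//; exact: measurable_itv.
Qed.

End PositiveIntegrals.

Lemma max_lt_min_interval (R : realDomainType) (a x e : R) :
  0 < a -> - a <= x -> x <= a -> 0 < e -> Num.max (- a) (x - e) < Num.min a (x + e).
Proof.
move=> a0 ax xa e0; rewrite gt_max !lt_min; apply/andP; split; apply/andP; split; lra.
Qed.

(** * Mass, Frostman conditions and support of the candidate measure *)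

Section EquilibriumMeasure.
Local Open Scope ereal_scope.
Context {R : realType}.
Local Notation mu := (@lebesgue_measure R).
Variables s q b a : R.
Hypotheses (s0 : (0 < s)%R) (s1 : (s < 1)%R) (q0 : (0 < q)%R) (b0 : (0 < b)%R) (a0 : (0 < a)%R).

Let a20 : (0 < a ^+ 2)%R. Proof. by rewrite exprn_gt0. Qed.
Let C := mix_const s q b.
Let C0 : (0 < C)%R. Proof. exact: mix_const_gt0. Qed.
Let w := low_weight b C (a ^+ 2)%R.

Definition eq_rho : R -> \bar R := mix_density s w.

Let w0 t : (0 <= w t)%R. Proof. exact: low_weight_ge0. Qed.
Let mw : measurable_fun setT w. Proof. exact: measurable_low_weight. Qed.

Lemma eq_rho_ge0 x : 0 <= eq_rho x. Proof. exact: mix_density_ge0. Qed.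

Lemma measurable_eq_rho : measurable_fun setT eq_rho.
Proof. exact: measurable_mix_density. Qed.

Lemma eq_rho_out x : (a ^+ 2 <= x ^+ 2)%R -> eq_rho x = 0.
Proof.
move=> ax; apply: integral0_eq => t _; rewrite /w /low_weight.
case: (ltP t (a ^+ 2)%R) => ta; last by rewrite mulr0 mul0r.
by rewrite (@pw_le0 _ ((s - 1) / 2)) ?mulr0// subr_le0 (le_trans (ltW ta)).
Qed.

Lemma eq_rho_in x : (x ^+ 2 < a ^+ 2)%R -> eq_rho x = (eq_density s q b a x)%:E.
Proof. exact: mix_density_low. Qed.

Lemma eq_rho_gt0 x : (x ^+ 2 < a ^+ 2)%R -> 0 < eq_rho x.
Proof.
move=> xa; pose h t := (w t * pw ((s - 1) / 2) (t - x ^+ 2))%:E.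
have mh : measurable_fun setT h.
  by apply/measurable_EFinP/measurable_funM; [exact: mw|mfun].
have h0 t : 0 <= h t by rewrite lee_fin mulr_ge0 ?pw_ge0.
apply: (@lt_le_trans _ _ (\int[mu]_(t in `](x ^+ 2)%R, (a ^+ 2)%R[) h t)).
  apply: integral_itvoo_gt0 => // t /andP[xt ta]; rewrite lte_fin mulr_gt0//; last first.
    by rewrite pw_gt0// subr_gt0.
  rewrite /w /low_weight ta mulr1 /full_weight mulr_gt0// pw_gt0//.
  by rewrite addr_gt0 ?exprn_gt0// (le_lt_trans _ xt)// sqr_ge0.
by apply: ge0_subset_integral => //; exact: measurable_itv.
Qed.

(** The mass is [mass_fun] at a^2 divided by the value at which F_s' vanishes, so having mass one is
    the critical-point equation. *)
Lemma integral_eq_rho :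
  \int[mu]_x eq_rho x = (q * (Num.sqrt pi / Gammaf (1 + s / 2)) * mass_fun s b (a ^+ 2) /
    Gammaf ((1 - s) / 2))%:E.
Proof.
have hm0 : (0 < (1 - s) / 2)%R by rewrite divr_gt0 ?subr_gt0.
have hp0 : (0 < (1 + s) / 2)%R by rewrite divr_gt0 ?addr_gt0.
have hh0 : (0 < 1 + s / 2)%R by rewrite addr_gt0 ?divr_gt0.
rewrite /eq_rho integral_mix_density//.
have -> : \int[mu]_t (w t * pw (s / 2) t)%:E = (C * (2 * pw (s - 1) b * mass_fun s b (a ^+ 2)))%:E.
  rewrite EFinM -integral_mass_fun// -ge0_integralcMl; [|exact: ltW|by mfun|by pos].
  by apply: eq_integral => t _; congr EFin; rewrite /w /low_weight /full_weight; ring.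
rewrite (ehalfbetaE hp0) (_ : ((1 + s) / 2 + 2^-1 = 1 + s / 2)%R); last by field.
rewrite -EFinM; congr EFin; rewrite /C /mix_const /riesz_const.
rewrite -(opprB 1 s) pwN//.
have := Gammaf_gt0 hm0; have := Gammaf_gt0 hp0; have := Gammaf_gt0 hh0.
have := pw_gt0 (1 - s) b0.
move: (Gammaf (1 + s / 2)) (Gammaf ((1 + s) / 2)) (Gammaf ((1 - s) / 2)) (pw _ b).
move=> g1 g2 g3 p p0 g10 g20 g30; field.
by rewrite !gt_eqF.
Qed.

Variable m : probability R R.
Hypothesis mE : forall A, measurable A -> m A = \int[mu]_(x in A) eq_rho x.

Let K2 : (2 * C * riesz_const s = q * pw (1 - s) b)%R.
Proof.
have k0 := riesz_const_gt0 s0 s1.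
by rewrite /C /mix_const; field; rewrite gt_eqF.
Qed.

(** The Frostman constant: the potential on [-a, a] of the dropped part of the mixture. *)
Let f : R := (q * pw (1 - s) b * pw (- 2^-1) (a ^+ 2 + b ^+ 2))%R.

(** Having a density, m does not charge the point x, where [riesz_kernel] is +oo and the truncated
    power is 0. *)
Lemma riesz_kernel_pot x : \int[m]_y riesz_kernel s x y = mix_pot s w x.
Proof.
have m0 : m [set x] = 0 by rewrite mE// integral_set1.
have mk : measurable_fun setT (fun y => riesz_kernel s x y).
  exact: (measurable_fun_pair2 x (measurable_riesz_kernel s)).
have k0 y : 0 <= riesz_kernel s x y by exact: riesz_kernel_ge0.
transitivity (\int[m]_y (pw (- s) `|x - y|)%:E).
  rewrite (ge0_negligible_integral (measurable_set1 x) _ _ _ m0)//.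
  rewrite [RHS](ge0_negligible_integral (measurable_set1 x) _ _ _ m0)//; last 2 first.
  - by mfun.
  - by pos.
  apply: eq_integral => y; rewrite inE/= => -[_ yx].
  have {}yx : x != y by apply/eqP => xy; exact/yx/esym.
  by rewrite /riesz_kernel (negPf yx) pwE// normr_gt0 subr_eq0.
rewrite (integral_density measurable_eq_rho eq_rho_ge0 mE)//; last by pos.
by mfun.
Qed.

Let pot_split x : (q * pw (- (s / 2)) (x ^+ 2 + b ^+ 2))%:E =
  mix_pot s w x + mix_pot s (high_weight b C (a ^+ 2)%R) x.
Proof.
rewrite /w -(mix_pot_split s b C0) (mix_pot_full s0 s1 b0 C0) K2; congr EFin.
have pb : (0 < pw (1 - s) b)%R by rewrite pw_gt0.
rewrite -(opprB 1 s) (pwN (1 - s) b0); field.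
by rewrite gt_eqF.
Qed.

Lemma field_le_pot x : (q * pw (- (s / 2)) (x ^+ 2 + b ^+ 2))%:E <=
  \int[m]_y riesz_kernel s x y + f%:E.
Proof.
rewrite riesz_kernel_pot pot_split leeD2l// /f -K2.
exact: (mix_pot_high_le s0 s1 b0 C0 _ (ltW a20)).
Qed.

Lemma field_eq_pot x : (x ^+ 2 <= a ^+ 2)%R -> (q * pw (- (s / 2)) (x ^+ 2 + b ^+ 2))%:E =
  \int[m]_y riesz_kernel s x y + f%:E.
Proof.
by move=> xa; rewrite riesz_kernel_pot pot_split (mix_pot_high_in s0 s1 b0 C0 a20 xa) K2.
Qed.

(** m gives no mass to x^2 > a^2, and elsewhere [field_eq_pot] holds pointwise. *)
Lemma energy_field_mass : mutual_energy s m m + f%:E = (field_mass s q b m)%:E.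
Proof.
have f0 : (0 <= f)%R by rewrite /f !mulr_ge0 ?pw_ge0 ?(ltW q0).
have mp : measurable_fun setT (fun x => \int[m]_y riesz_kernel s x y).
  apply: measurable_integral_snd => /=; first exact: measurable_riesz_kernel.
  exact: riesz_kernel_ge0.
have p0 x : 0 <= \int[m]_y riesz_kernel s x y.
  by apply: integral_ge0 => y _; exact: riesz_kernel_ge0.
rewrite -(integral_field s0 q0 b0).
have -> : mutual_energy s m m + f%:E = \int[m]_x (\int[m]_y riesz_kernel s x y + (cst f%:E) x).
  rewrite ge0_integralD//.
  by rewrite integral_cst//= probability_setT mule1.
have mN : measurable [set x : R | (a ^+ 2 < x ^+ 2)%R].
  have mf : measurable_fun setT (fun x : R => x ^+ 2)%R by mfun.
  rewrite (_ : [set x : R | _] = setT `&` (fun x : R => x ^+ 2)%R @^-1` `](a ^+ 2)%R, +oo[%classic).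
    by apply: mf => //; exact: measurable_itv.
  by apply/seteqP; split => x /=; rewrite in_itv/= andbT; [split|case].
have N0 : m [set x : R | (a ^+ 2 < x ^+ 2)%R] = 0.
  rewrite mE//; apply: integral0_eq => x /= xa; exact: eq_rho_out (ltW xa).
rewrite (ge0_negligible_integral mN _ _ _ N0)//; last 2 first.
- by apply: emeasurable_funD => //; exact: measurable_cst.
- by move=> x _; rewrite adde_ge0.
rewrite [RHS](ge0_negligible_integral mN _ _ _ N0)//; last 2 first.
- by mfun.
- by move=> x _; rewrite lee_fin mulr_ge0 ?pw_ge0// ltW.
apply: eq_integral => x; rewrite inE/= => -[_ /negP]; rewrite -leNgt => xa.
by rewrite field_eq_pot.
Qed.

Lemma eq_measure_equilibrium : is_equilibrium s q b m /\
  forall nu, is_equilibrium s q b nu -> forall A, measurable A -> nu A = m A.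
Proof.
apply: (@equilibrium_characterization R s q b s0 q0 b0 m f).
- by rewrite /f !mulr_ge0 ?pw_ge0 ?(ltW q0).
- exact: field_le_pot.
- exact: energy_field_mass.
Qed.

Let in_supp x : (- a < x < a)%R = (x ^+ 2 < a ^+ 2)%R.
Proof.
by rewrite -ltr_norml -[in RHS]real_normK ?num_real// ltr_pXn2r ?nnegrE// ltW.
Qed.

Lemma eq_measure_density (A : set R) : measurable A ->
  m A = \int[mu]_(x in A `&` `](- a)%R, a[%classic) (eq_density s q b a x)%:E.
Proof.
move=> mA; rewrite (mE mA) [LHS]integral_mkcond [RHS]integral_mkcond.
apply: eq_integral => x _; rewrite !patchE in_setI; case: (x \in A); last by [].
rewrite andTb mem_setE in_itv/= in_supp.
by case: ltP => xa; [exact: eq_rho_in|exact: eq_rho_out].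
Qed.

Lemma msupport_eq_measure (nu : probability R R) :
  (forall A, measurable A -> nu A = m A) -> msupport nu = `[(- a)%R, a]%classic.
Proof.
move=> nE; apply/seteqP; split => x /=.
  move=> H; rewrite in_itv/= -ler_norml leNgt; apply/negP => ax.
  (* The ball of radius |x| - a around x misses ]-a, a[. *)
  have e0 : (0 < `|x| - a)%R by rewrite subr_gt0.
  have := H _ e0; rewrite nE ?mE//; [|exact: measurable_ball|exact: measurable_ball].
  rewrite (_ : \int[mu]_(y in _) _ = 0) ?ltxx//; apply: integral0_eq => y.
  rewrite /ball/= => xy; apply: eq_rho_out.
  rewrite leNgt -in_supp -ltr_norml -leNgt.
  have := ler_normD (x - y)%R y; rewrite subrK => h; lra.
rewrite in_itv/= => /andP[ax xa] e e0.
have mb : measurable (ball x e) by exact: measurable_ball.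
rewrite nE// mE//.
(* Every ball around a point of [-a, a], endpoints included, meets ]-a, a[ in an interval ]u, v[ on
   which the density is positive. *)
pose u := (Num.max (- a) (x - e))%R; pose v := (Num.min a (x + e))%R.
have uv : (u < v)%R.
  exact: max_lt_min_interval.
apply: (@lt_le_trans _ _ (\int[mu]_(y in `]u, v[) eq_rho y)).
  apply: (integral_itvoo_gt0 uv measurable_eq_rho eq_rho_ge0) => y.
  rewrite /u /v gt_max lt_min => /andP[/andP[h1 h2] /andP[h3 h4]].
  by apply: eq_rho_gt0; rewrite -in_supp h1 h3.
apply: ge0_subset_integral => //.
- exact: measurable_funTS measurable_eq_rho.
- by move=> y _; exact: eq_rho_ge0.
move=> y /=; rewrite in_itv/= /u /v gt_max lt_min /ball/= ltr_distl.
move=> /andP[/andP[h1 h2] /andP[h3 h4]]; apply/andP; split; lra.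
Qed.

End EquilibriumMeasure.

Theorem theorem2p2 (R : realType) (s q b : R)
  (hs0 : 0 < s) (hs1 : s < 1) (hq : 1 < q) (hb : 0 < b) :
  exists ta : R,
    [/\ 0 < ta, is_derive ta 1 (Fs s q b) 0,
        (forall a : R, 0 < a -> is_derive a 1 (Fs s q b) 0 -> a = ta),
        (exists mu : probability R R, is_equilibrium s q b mu) &
        (forall mu : probability R R, is_equilibrium s q b mu ->
           msupport mu = `[- ta, ta]%classic /\
           (forall A : set R, measurable A ->
              mu A = (\int[lebesgue_measure]_(x in (A `&` `]- ta, ta[%classic)%R)
                        (eq_density s q b ta x)%:E)%E))].
Proof.
have hm0 : 0 < (1 - s) / 2 by rewrite divr_gt0 ?subr_gt0.
have hh0 : 0 < 1 + s / 2 by rewrite addr_gt0 ?divr_gt0.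
have q0 : 0 < q := lt_trans ltr01 hq.
have g0 := Gammaf_gt0 hm0; have g1 := Gammaf_gt0 hh0.
have p0 : 0 < Num.sqrt (pi : R) by rewrite sqrtr_gt0 pi_gt0.
pose Q := q * (Num.sqrt pi / Gammaf (1 + s / 2)).
have Q0 : 0 < Q by rewrite mulr_gt0// divr_gt0.
have M0 : 0 < Gammaf ((1 - s) / 2) / Q by rewrite divr_gt0.
(* The value of [mass_fun] that gives mass one is 1/q times its limit at infinity; this is where q >
   1 enters. *)
have M1 : Gammaf ((1 - s) / 2) / Q < Gammaf (1 + s / 2) * Gammaf ((1 - s) / 2) / Num.sqrt pi.
  have -> : Gammaf ((1 - s) / 2) / Q =
      q^-1 * (Gammaf (1 + s / 2) * Gammaf ((1 - s) / 2) / Num.sqrt pi).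
    rewrite /Q; move: g0 g1 p0.
    move: (Gammaf ((1 - s) / 2)) (Gammaf (1 + s / 2)) (Num.sqrt pi) => x y z x0 y0 z0.
    by field; rewrite !gt_eqF.
  by rewrite gtr_pMl ?invf_lt1// divr_gt0// mulr_gt0.
have [T T0 MT] := exists_mass_fun hs0 hs1 hb M0 M1.
pose ta := Num.sqrt T.
have ta0 : 0 < ta by rewrite sqrtr_gt0.
have taE : ta ^+ 2 = T by rewrite sqr_sqrtr// ltW.
have mass1 : Q * mass_fun s b (ta ^+ 2) = Gammaf ((1 - s) / 2).
  by rewrite taE MT mulrC divfK// gt_eqF.
have := integral_eq_rho hs0 hs1 q0 hb ta0; rewrite -/Q mass1 divff ?gt_eqF// => rho1.
have [m mE] := exists_density_probability (measurable_eq_rho ta hs0 hs1 q0 hb)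
  (eq_rho_ge0 ta hs0 hs1 q0 hb) rho1.
have [m_eq m_uniq] := eq_measure_equilibrium hs0 hs1 q0 hb ta0 mE.
exists ta; split => //.
- exact/(is_derive_Fs0P _ hs0 hs1 hb ta0).
- move=> a a0 /(is_derive_Fs0P _ hs0 hs1 hb a0); rewrite -/Q -mass1 => /(mulfI _).
  move=> /(_ (lt0r_neq0 Q0)) E; apply/eqP.
  rewrite -(@eqrXn2 _ 2)// ?ltW//; apply/eqP.
  have a20 : 0 < a ^+ 2 by rewrite exprn_gt0.
  have ta20 : 0 < ta ^+ 2 by rewrite exprn_gt0.
  case: (ltgtP (a ^+ 2) (ta ^+ 2)) => // h.
    by have := mass_fun_lt hs0 hs1 hb a20 h; rewrite E ltxx.
  by have := mass_fun_lt hs0 hs1 hb ta20 h; rewrite E ltxx.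
- by exists m.
- move=> nu nu_eq; have nuE := m_uniq nu nu_eq; split.
    exact: (msupport_eq_measure hs0 hs1 q0 hb ta0 mE nuE).
  by move=> A mA; rewrite nuE// (eq_measure_density hs0 hs1 q0 hb ta0 mE mA).
Qed.
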